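(* Let $K$ be an infinite field or the ring of integers $\mathbb{Z}$, and let $R(K)$, its elements $q,h,f_1,\ldots,f_{10}$, and the $12$-variable integer polynomial $A$ be as defined in the context. Then $R(K)$ is minimally generated as a $K$-algebra by the twelve elements $q,h,f_1,\ldots,f_{10}$, satisfying the single algebraic relation $A(q,h,f_1,\ldots,f_{10})=0$ (that is, the ideal of all polynomial relations over $K$ among these twelve generators is generated by $A$). Moreover, the eleven elements $h,f_1,\ldots,f_{10}$ are algebraically independent over $K$, and $R(K)$ is a free module with basis $1,q$ over its $K$-subalgebra generated by $h,f_1,\ldots,f_{10}$.
   Context: For an infinite field $K$, $M_3(K)^3$ is the space of triples $(A_1,A_2,A_3)$ of $3\times 3$ matrices over $K$; $SL_3(K)\times SL_3(K)$ acts on it by $(g,g')\cdot(A_1,A_2,A_3)=(gA_1g'^{-1},gA_2g'^{-1},gA_3g'^{-1})$, and $R(K)=K[M_3(K)^3]^{SL_3(K)\times SL_3(K)}$ is the algebra of invariant polynomial functions. For $K=\mathbb{Z}$, put $R(\mathbb{Z})=R(\mathbb{Q})\cap\mathbb{Z}[x_{ij}^{(r)}\mid i,j,r=1,2,3]$, where $x_{ij}^{(r)}$ is the coordinate function on $M_3(\mathbb{Q})^3$ sending $(A_1,A_2,A_3)$ to the $(i,j)$-entry of $A_r$. The elements $f_{i,j,k}\in R(K)$ ($i+j+k=3$) are defined by \[ \det(t_1A_1+t_2A_2+t_3A_3)=\sum_{i+j+k=3}t_1^it_2^jt_3^kf_{i,j,k}(A_1,A_2,A_3), \] and we write $f_1=f_{3,0,0}$,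 $f_2=f_{2,1,0}$, $f_3=f_{2,0,1}$, $f_4=f_{1,2,0}$, $f_5=f_{1,1,1}$, $f_6=f_{1,0,2}$, $f_7=f_{0,3,0}$, $f_8=f_{0,2,1}$, $f_9=f_{0,1,2}$, $f_{10}=f_{0,0,3}$. $h\in R(K)$ is the coefficient of $t_1^2t_2^2t_3^2$ in $\det\left(\begin{array}{cc}t_2A_2 & t_1A_1 \\t_1A_1 & t_3A_3\end{array}\right)$, and $q\in R(K)$ is the coefficient of $t_1^2t_2t_3^2t_4t_5^2t_6$ in $\det\left(\begin{array}{ccc}0 & t_1A_1 & t_2A_2 \\t_4A_1 & 0 & t_3A_3 \\t_5A_2 & t_6A_3 & 0\end{array}\right)$. The polynomial $A$ is \begin{align*} &A(q,h,f_1,\ldots,f_{10})=q^2 - qhf_5\\ & + 3qf_1f_7f_{10} - qf_1f_8f_9 - qf_2f_4f_{10} + qf_2f_6f_8 + qf_3f_4f_9 - qf_3f_6f_7 - qf_4f_5f_6\\ & - h^3 + h^2f_2f_9 + h^2f_3f_8 - 2h^2f_4f_6\\ & + 3hf_1f_4f_8f_{10} - hf_1f_4f_9^2 - 6hf_1f_5f_7f_{10} + hf_1f_5f_8f_9 + 3hf_1f_6f_7f_9 - hf_1f_6f_8^2\\ & - hf_2^2f_8f_{10} + 3hf_2f_3f_7f_{10} - hf_2f_3f_8f_9 + hf_2f_4f_5f_{10} + hf_2f_4f_6f_9 - hf_2f_6^2f_7\\ & - hf_3^2f_7f_9 - hf_3f_4^2f_{10} + hf_3f_4f_6f_8 + hf_3f_5f_6f_7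 - hf_4^2f_6^2 + 9f_1^2f_7^2f_{10}^2\\ & - 6f_1^2f_7f_8f_9f_{10} + f_1^2f_7f_9^3 + f_1^2f_8^3f_{10} - 6f_1f_2f_4f_7f_{10}^2 + f_1f_2f_4f_8f_9f_{10}\\ & + 3f_1f_2f_5f_7f_9f_{10} - f_1f_2f_5f_8^2f_{10} + 3f_1f_2f_6f_7f_8f_{10} - 2f_1f_2f_6f_7f_9^2\\ & + 3f_1f_3f_4f_7f_9f_{10} - 2f_1f_3f_4f_8^2f_{10} + 3f_1f_3f_5f_7f_8f_{10} - f_1f_3f_5f_7f_9^2 - 6f_1f_3f_6f_7^2f_{10}\\ & + f_1f_3f_6f_7f_8f_9 + f_1f_4^3f_{10}^2 - f_1f_4^2f_5f_9f_{10} + f_1f_4^2f_6f_8f_{10} + f_1f_4f_5^2f_8f_{10}\\ & - 3f_1f_4f_5f_6f_7f_{10} + f_1f_4f_6^2f_7f_9 - f_1f_5^3f_7f_{10} + f_1f_5^2f_6f_7f_9 - f_1f_5f_6^2f_7f_8 + f_1f_6^3f_7^2\\ & + f_2^3f_7f_{10}^2 - 2f_2^2f_3f_7f_9f_{10} + f_2^2f_3f_8^2f_{10} - f_2^2f_4f_6f_8f_{10} - f_2^2f_5f_6f_7f_{10} + f_2^2f_6^2f_7f_9\\ & - 2f_2f_3^2f_7f_8f_{10} + f_2f_3^2f_7f_9^2 - f_2f_3f_4f_5f_8f_{10} + 4f_2f_3f_4f_6f_7f_{10} + f_2f_3f_5^2f_7f_{10}\\ & - f_2f_3f_5f_6f_7f_9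 + f_2f_4^2f_5f_6f_{10} - f_2f_4f_6^3f_7 + f_3^3f_7^2f_{10} + f_3^2f_4^2f_8f_{10} - f_3^2f_4f_5f_7f_{10}\\ & - f_3^2f_4f_6f_7f_9 - f_3f_4^3f_6f_{10} + f_3f_4f_5f_6^2f_7. \end{align*} ''Minimally generated'' means that the elements generate the algebra and no proper subset of them does. *)

(* Defs.v *)
From mathcomp Require Import all_boot all_order all_algebra.
From mathcomp Require Import mpoly.

Set Implicit Arguments.
Unset Strict Implicit.
Unset Printing Implicit Defensive.

Import GRing.Theory.

Local Open Scope ring_scope.

Definition infinite_type (T : eqType) : Prop :=
  ~ exists s : seq T, forall x, x \in s.

Section Algebras.
Variables (K : comNzRingType) (n : nat).
Implicit Types (s : seq {mpoly K[n]}) (B M : {mpoly K[n]} -> Prop).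

(* The K-subalgebra K[s_1, ..., s_m]: all polynomial expressions in s. *)
Definition subalgebra s (p : {mpoly K[n]}) : Prop :=
  exists P : {mpoly K[size s]}, p = P \mPo in_tuple s.

Definition generates s M : Prop := forall p, M p <-> subalgebra s p.

Definition minimally_generates s M : Prop :=
  generates s M /\
  forall s', {subset s' <= s} -> generates s' M -> {subset s <= s'}.

Definition algebraic_relation m (s : m.-tuple {mpoly K[n]})
  (P : {mpoly K[m]}) : Prop := P \mPo s = 0.

Definition algebraically_independent m (s : m.-tuple {mpoly K[n]}) : Prop :=
  forall P : {mpoly K[m]}, algebraic_relation s P -> P = 0.

Definition principal_ideal (a b : {mpoly K[n]}) : Prop :=
  exists c, b = c * a.

(* M is a free B-module with basis e, for a subring B of K[x]; the module     *)
(* structure is given by multiplication in K[x].                              *)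
Definition free_module_basis B M m (e : m.-tuple {mpoly K[n]}) : Prop :=
  (forall p, M p <->
     exists2 c : 'I_m -> {mpoly K[n]},
       forall i, B (c i) & p = \sum_i c i * tnth e i) /\
  (forall c : 'I_m -> {mpoly K[n]},
     (forall i, B (c i)) -> \sum_i c i * tnth e i = 0 -> forall i, c i = 0).

End Algebras.

(* The coordinate ring of triples of 3 x 3 matrices. The coordinate functions *)
(* are indexed by 'I_(3 * (3 * 3)): the variable x_ij^(r) is                  *)
(* 'X_(mxvec_index r (mxvec_index i j)), with r, i, j : 'I_3 counted from 0.  *)
Notation coord_ring K := {mpoly K[3 * (3 * 3)]}.

Definition coordinates (K : nzRingType) (A : 'I_3 -> 'M[K]_3) :
    'I_(3 * (3 * 3)) -> K :=
  fun k => mxvec (\matrix_r mxvec (A r)) 0 k.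

Definition SL_act (K : comUnitRingType) (g g' : 'M[K]_3)
    (A : 'I_3 -> 'M[K]_3) : 'I_3 -> 'M[K]_3 :=
  fun r => g *m A r *m invmx g'.

(* Over an infinite field, polynomial functions are the same as polynomials,  *)
(* so an element of K[M_3(K)^3] is represented by a polynomial.               *)
Definition SL_invariant (K : fieldType) (p : coord_ring K) : Prop :=
  forall g g' : 'M[K]_3, \det g = 1 -> \det g' = 1 ->
  forall A : 'I_3 -> 'M[K]_3,
    p.@[coordinates (SL_act g g' A)] = p.@[coordinates A].

Definition SL_invariant_int (p : coord_ring int) : Prop :=
  SL_invariant (map_mpoly intr p : coord_ring rat).

Section Generators.
Variable K : comNzRingType.

Definition generic_matrix (r : 'I_3) : 'M[coord_ring K]_3 :=
  \matrix_(i, j) 'X_(mxvec_index r (mxvec_index i j)).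

(* t_k A_r over K[x][t_1, ..., t_n.+1], with k and r counted from 1. *)
Definition tA (n k r : nat) : 'M[{mpoly (coord_ring K)[n.+1]}]_3 :=
  'X_(inord k.-1) *:
    map_mx (@mpolyC n.+1 (coord_ring K)) (generic_matrix (inord r.-1)).

Definition f_ (i j k : nat) : coord_ring K :=
  (\det (tA 2 1 1 + tA 2 2 2 + tA 2 3 3))@_[multinom [tuple i; j; k]].

Definition h_ : coord_ring K :=
  (\det (block_mx (tA 2 2 2) (tA 2 1 1)
                  (tA 2 1 1) (tA 2 3 3)))@_[multinom [tuple 2; 2; 2]%N].

Definition q_ : coord_ring K :=
  (\det (col_mx (row_mx 0          (row_mx (tA 5 1 1) (tA 5 2 2)))
        (col_mx (row_mx (tA 5 4 1) (row_mx 0          (tA 5 3 3)))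
                (row_mx (tA 5 5 2) (row_mx (tA 5 6 3) 0)))))
    @_[multinom [tuple 2; 1; 2; 1; 2; 1]%N].

Definition hf_tuple : 11.-tuple (coord_ring K) :=
  [tuple h_; f_ 3 0 0; f_ 2 1 0; f_ 2 0 1; f_ 1 2 0; f_ 1 1 1; f_ 1 0 2;
         f_ 0 3 0; f_ 0 2 1; f_ 0 1 2; f_ 0 0 3].

Definition qhf_tuple : 12.-tuple (coord_ring K) := [tuple of q_ :: hf_tuple].

End Generators.

Definition A_expr (R : comNzRingType)
    (q h f1 f2 f3 f4 f5 f6 f7 f8 f9 f10 : R) : R :=
  q ^+ 2 - q * h * f5
  + 3 * q * f1 * f7 * f10 - q * f1 * f8 * f9 - q * f2 * f4 * f10
  + q * f2 * f6 * f8 + q * f3 * f4 * f9 - q * f3 * f6 * f7 - q * f4 * f5 * f6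
  - h ^+ 3 + h ^+ 2 * f2 * f9 + h ^+ 2 * f3 * f8 - 2 * h ^+ 2 * f4 * f6
  + 3 * h * f1 * f4 * f8 * f10 - h * f1 * f4 * f9 ^+ 2
  - 6 * h * f1 * f5 * f7 * f10 + h * f1 * f5 * f8 * f9
  + 3 * h * f1 * f6 * f7 * f9 - h * f1 * f6 * f8 ^+ 2
  - h * f2 ^+ 2 * f8 * f10 + 3 * h * f2 * f3 * f7 * f10
  - h * f2 * f3 * f8 * f9 + h * f2 * f4 * f5 * f10 + h * f2 * f4 * f6 * f9
  - h * f2 * f6 ^+ 2 * f7
  - h * f3 ^+ 2 * f7 * f9 - h * f3 * f4 ^+ 2 * f10 + h * f3 * f4 * f6 * f8
  + h * f3 * f5 * f6 * f7 - h * f4 ^+ 2 * f6 ^+ 2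
  + 9 * f1 ^+ 2 * f7 ^+ 2 * f10 ^+ 2
  - 6 * f1 ^+ 2 * f7 * f8 * f9 * f10 + f1 ^+ 2 * f7 * f9 ^+ 3
  + f1 ^+ 2 * f8 ^+ 3 * f10 - 6 * f1 * f2 * f4 * f7 * f10 ^+ 2
  + f1 * f2 * f4 * f8 * f9 * f10
  + 3 * f1 * f2 * f5 * f7 * f9 * f10 - f1 * f2 * f5 * f8 ^+ 2 * f10
  + 3 * f1 * f2 * f6 * f7 * f8 * f10 - 2 * f1 * f2 * f6 * f7 * f9 ^+ 2
  + 3 * f1 * f3 * f4 * f7 * f9 * f10 - 2 * f1 * f3 * f4 * f8 ^+ 2 * f10
  + 3 * f1 * f3 * f5 * f7 * f8 * f10 - f1 * f3 * f5 * f7 * f9 ^+ 2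
  - 6 * f1 * f3 * f6 * f7 ^+ 2 * f10
  + f1 * f3 * f6 * f7 * f8 * f9 + f1 * f4 ^+ 3 * f10 ^+ 2
  - f1 * f4 ^+ 2 * f5 * f9 * f10 + f1 * f4 ^+ 2 * f6 * f8 * f10
  + f1 * f4 * f5 ^+ 2 * f8 * f10
  - 3 * f1 * f4 * f5 * f6 * f7 * f10 + f1 * f4 * f6 ^+ 2 * f7 * f9
  - f1 * f5 ^+ 3 * f7 * f10 + f1 * f5 ^+ 2 * f6 * f7 * f9
  - f1 * f5 * f6 ^+ 2 * f7 * f8 + f1 * f6 ^+ 3 * f7 ^+ 2
  + f2 ^+ 3 * f7 * f10 ^+ 2 - 2 * f2 ^+ 2 * f3 * f7 * f9 * f10
  + f2 ^+ 2 * f3 * f8 ^+ 2 * f10 - f2 ^+ 2 * f4 * f6 * f8 * f10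
  - f2 ^+ 2 * f5 * f6 * f7 * f10 + f2 ^+ 2 * f6 ^+ 2 * f7 * f9
  - 2 * f2 * f3 ^+ 2 * f7 * f8 * f10 + f2 * f3 ^+ 2 * f7 * f9 ^+ 2
  - f2 * f3 * f4 * f5 * f8 * f10 + 4 * f2 * f3 * f4 * f6 * f7 * f10
  + f2 * f3 * f5 ^+ 2 * f7 * f10
  - f2 * f3 * f5 * f6 * f7 * f9 + f2 * f4 ^+ 2 * f5 * f6 * f10
  - f2 * f4 * f6 ^+ 3 * f7 + f3 ^+ 3 * f7 ^+ 2 * f10
  + f3 ^+ 2 * f4 ^+ 2 * f8 * f10 - f3 ^+ 2 * f4 * f5 * f7 * f10
  - f3 ^+ 2 * f4 * f6 * f7 * f9 - f3 * f4 ^+ 3 * f6 * f10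
  + f3 * f4 * f5 * f6 ^+ 2 * f7.

Definition A_poly (K : comNzRingType) : {mpoly K[12]} :=
  let y (i : nat) : {mpoly K[12]} := 'X_(inord i) in
  A_expr (y 0%N) (y 1%N) (y 2%N) (y 3%N) (y 4%N) (y 5%N) (y 6%N) (y 7%N)
         (y 8%N) (y 9%N) (y 10%N) (y 11%N).

(* Main.v *)
Require Import Defs.
From mathcomp Require Import all_boot all_order all_algebra all_fingroup all_field.
From mathcomp Require Import mpoly.
From mathcomp Require Import ring zify.
From Stdlib Require Import Classical.
From HB Require Import structures.

Set Implicit Arguments.
Unset Strict Implicit.
Unset Printing Implicit Defensive.

Import GRing.Theory.

Local Open Scope ring_scope.

(** Write T for the transposition of all three matrices, and let
    B = K[h, f_1, ..., f_10] + K[h, f_1, ..., f_10] q.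

    The f's are the coefficients of the polarized determinant, and column
    operations in the two block determinants give
      h = - tr (adj A3 A1 adj A2 A1),
      q = tr (adj A3 A1 adj A2 A3 adj A1 A2)
    ([ev_hE], [ev_qE]), which makes their behaviour under (g, g'), under T and
    under exchanging A1 and A3 visible.

    After a field extension the generic triple is (g, g').(1, diag x, Y)
    ([generic_diag]: diagonalize A1^-1 A2), so an identity between
    semi-invariants holds as soon as it holds on these slices
    ([slice_principle]).  There every quantity is an explicit polynomial, and
    this yields the relation A = 0 ([A_relation]), as well as q + qT = S, with S
    minus the coefficient of q in A ([qv_tr]).  So A is the monic quadratic
    polynomial with roots q and qT, while h and the f's are fixed by T.

    Relations.  Almost every choice of values of h, f_1, ..., f_10 is attained by
    some triple over an extension ([realize]), so these eleven elements are
    algebraically independent.  If a + b q = 0 with a, b in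
    K[h, f_1, ..., f_10], transposing gives b (q - qT) = 0, hence a = b = 0
    ([hfq_independent]).  Since A is monic in q, division by A shows that A
    generates the ideal of relations ([relation_ideal]).  All this works over any
    integral domain.

    Generation over an infinite field.  Let p be a homogeneous invariant.  As K is
    infinite, p is a semi-invariant of GL_3 x GL_3 over every K-algebra
    ([semi_alg]).  The torus acts on the slice by conjugating Y, so only monomials
    in Y of balanced weight occur in the restriction of p, and each of these is,
    up to a power of the Vandermonde determinant of x, a combination a + b q whose
    coefficients are polynomials in x and in the values of h and of the f's
    ([smem_balanced]).  The group S_3 permutes the x_i and fixes p, q, h and the
    f's; comparison with the transposed triple shows that the values of a and b
    are themselves unchanged, so a and b can be symmetrized and the x_i
    disappear: they enter through f_2, f_4, f_7.  Hence G p lies in B, where G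
    is a product of powers of f_1 and of the discriminant of det (t A1 + A2)
    ([invariant_localized]).  Exchanging A1 and A3 preserves B and gives
    G' p in B with G' built from A3 in place of A1.  The polynomials G and G' are
    coprime, in the sense that G' a in (G) implies a in (G)
    ([denominators_coprime]), and a + b q representations are unique, so p itself
    lies in B ([invariant_hfq_span]).

    Integers.  If p is an integral invariant then m p lies in B over the integers
    for some m > 0.  For a prime l dividing m, the representation of m p vanishes
    modulo l, and independence over the field with l elements makes its
    coefficients divisible by l; so m can be divided by l
    ([hfq_span_saturated]).

    Minimality.  If the i-th generator were a polynomial Q in the others, X_i - Q
    would be a multiple of A.  But X_i - Q has a nonzero linear term on the i-th
    coordinate axis, where A vanishes to order at least two ([A_axis]). *)

(** * Three by three matrices *)

Definition o0 : 'I_3 := @Ordinal 3 0 isT.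
Definition o1 : 'I_3 := @Ordinal 3 1 isT.
Definition o2 : 'I_3 := @Ordinal 3 2 isT.

Lemma ord3P (P : 'I_3 -> Prop) : P o0 -> P o1 -> P o2 -> forall i, P i.
Proof.
move=> h0 h1 h2 [[|[|[|//]]] lti].
- by rewrite (_ : Ordinal _ = o0) //; apply: val_inj.
- by rewrite (_ : Ordinal _ = o1) //; apply: val_inj.
by rewrite (_ : Ordinal _ = o2) //; apply: val_inj.
Qed.

Section Mx3.
Variable R : comNzRingType.
Implicit Types A B C X Y : 'M[R]_3.

Lemma sum3 (V : nmodType) (F : 'I_3 -> V) : \sum_i F i = F o0 + F o1 + F o2.
Proof.
by rewrite 3!big_ord_recl big_ord0 addr0 addrA; congr (F _ + F _ + F _);
   apply: val_inj.
Qed.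

Lemma prod3 (f : 'I_3 -> R) : \prod_i f i = f o0 * f o1 * f o2.
Proof.
by rewrite 3!big_ord_recl big_ord0 mulr1 mulrA; congr (f _ * f _ * f _); apply: val_inj.
Qed.

Lemma lift3 : (lift o0 (0 : 'I_2) = o1) * (lift o0 (1 : 'I_2) = o2)
  * (lift o1 (0 : 'I_2) = o0) * (lift o1 (1 : 'I_2) = o2)
  * (lift o2 (0 : 'I_2) = o0) * (lift o2 (1 : 'I_2) = o1).
Proof. by do !split; apply: val_inj. Qed.

Lemma det2 (M : 'M[R]_2) : \det M = M 0 0 * M 1 1 - M 0 1 * M 1 0.
Proof.
rewrite (expand_det_row _ 0) !big_ord_recl big_ord0 addr0 /cofactor !det_mx11.
rewrite !mxE /= expr0 expr1 mul1r mulN1r mulrN.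
by congr (_ * M _ _ - M _ _ * M _ _); apply: val_inj.
Qed.

Lemma adj3E A : \adj A = \matrix_(i, j)
  (if i == o0 then
     if j == o0 then A o1 o1 * A o2 o2 - A o1 o2 * A o2 o1
     else if j == o1 then A o0 o2 * A o2 o1 - A o0 o1 * A o2 o2
     else A o0 o1 * A o1 o2 - A o0 o2 * A o1 o1
   else if i == o1 then
     if j == o0 then A o1 o2 * A o2 o0 - A o1 o0 * A o2 o2
     else if j == o1 then A o0 o0 * A o2 o2 - A o0 o2 * A o2 o0
     else A o0 o2 * A o1 o0 - A o0 o0 * A o1 o2
   else
     if j == o0 then A o1 o0 * A o2 o1 - A o1 o1 * A o2 o0
     else if j == o1 then A o0 o1 * A o2 o0 - A o0 o0 * A o2 o1
     else A o0 o0 * A o1 o1 - A o0 o1 * A o1 o0).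
Proof.
apply/matrixP; elim/ord3P; elim/ord3P;
  rewrite !mxE /cofactor det2 !mxE !lift3 /=; ring.
Qed.

Lemma det3 A : \det A = A o0 o0 * (A o1 o1 * A o2 o2 - A o1 o2 * A o2 o1)
  + A o0 o1 * (A o1 o2 * A o2 o0 - A o1 o0 * A o2 o2)
  + A o0 o2 * (A o1 o0 * A o2 o1 - A o1 o1 * A o2 o0).
Proof.
by rewrite (expand_det_row _ o0) sum3 /cofactor !det2 !mxE !lift3 /=; ring.
Qed.

(** The polarization of the determinant: the coefficient of a ^+ 2 * b in det
    (a A + b B). *)
Definition polar A B := \tr (\adj A *m B).

Lemma polarE A B : polar A B =
    (A o1 o1 * A o2 o2 - A o1 o2 * A o2 o1) * B o0 o0
  + (A o0 o2 * A o2 o1 - A o0 o1 * A o2 o2) * B o1 o0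
  + (A o0 o1 * A o1 o2 - A o0 o2 * A o1 o1) * B o2 o0
  + (A o1 o2 * A o2 o0 - A o1 o0 * A o2 o2) * B o0 o1
  + (A o0 o0 * A o2 o2 - A o0 o2 * A o2 o0) * B o1 o1
  + (A o0 o2 * A o1 o0 - A o0 o0 * A o1 o2) * B o2 o1
  + (A o1 o0 * A o2 o1 - A o1 o1 * A o2 o0) * B o0 o2
  + (A o0 o1 * A o2 o0 - A o0 o0 * A o2 o1) * B o1 o2
  + (A o0 o0 * A o1 o1 - A o0 o1 * A o1 o0) * B o2 o2.
Proof. by rewrite /polar /mxtrace sum3 adj3E !mxE !sum3 !mxE /=; ring. Qed.

(** The coefficient of a * b * c in det (a A + b B + c C), obtained by
    comparing the polarization at A + B with those at A and at B. *)
Definition mixed A B C := polar (A + B) C - polar A C - polar B C.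

Lemma det_pencil2 A B (a b : R) :
  \det (a *: A + b *: B) =
  a ^+ 3 * \det A + a ^+ 2 * b * polar A B + a * b ^+ 2 * polar B A + b ^+ 3 * \det B.
Proof. rewrite !det3 !polarE !mxE; ring. Qed.

Lemma det_pencil3 A B C (a b c : R) :
  \det (a *: A + b *: B + c *: C) =
    a ^+ 3 * \det A + a ^+ 2 * b * polar A B + a ^+ 2 * c * polar A C
  + a * b ^+ 2 * polar B A + a * b * c * mixed A B C + a * c ^+ 2 * polar C A
  + b ^+ 3 * \det B + b ^+ 2 * c * polar B C + b * c ^+ 2 * polar C B
  + c ^+ 3 * \det C.
Proof. rewrite /mixed !det3 !polarE !mxE; ring. Qed.

(** Entrywise expansion, so that it holds over any commutative ring, without
    inverting determinants. *)
Lemma adjM A B : \adj (A *m B) = \adj B *m \adj A.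
Proof.
apply/matrixP; elim/ord3P; elim/ord3P; rewrite !adj3E !(mxE, sum3) /=; ring.
Qed.

End Mx3.

(** * Evaluation at a triple of matrices, and the generators f *)

Definition block33 (R : nmodType) (X1 X2 X3 X4 X5 X6 : 'M[R]_3) :=
  col_mx (row_mx 0 (row_mx X1 X2))
    (col_mx (row_mx X4 (row_mx 0 X3)) (row_mx X5 (row_mx X6 0))).

Lemma map_block33 (R S : nmodType) (f : {additive R -> S})
    (X1 X2 X3 X4 X5 X6 : 'M[R]_3) :
  map_mx f (block33 X1 X2 X3 X4 X5 X6) =
  block33 (map_mx f X1) (map_mx f X2) (map_mx f X3) (map_mx f X4) (map_mx f X5)
    (map_mx f X6).
Proof. by rewrite /block33 !map_col_mx !map_row_mx !map_mx0. Qed.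

Section Ev.
Variables (K F : comNzRingType) (iota : {rmorphism K -> F}).
(** Every K-algebra valued point of the space of triples gives an evaluation;
    [iota] is the structure map of the algebra. Points with values in
    extensions of K are what reaches the slice. *)
Definition ev (A : 'I_3 -> 'M[F]_3) : coord_ring K -> F :=
  mmap iota (coordinates A).
HB.instance Definition _ A :=
  GRing.RMorphism.copy (ev A) (mmap iota (coordinates A)).

Lemma evC A c : ev A c%:MP = iota c.
Proof. exact: mmapC. Qed.

Lemma ev_generic A r : map_mx (ev A) (generic_matrix K r) = A r.
Proof.
apply/matrixP => i j; rewrite !mxE /ev mmapX mmap1U /coordinates mxvecE mxE.
by rewrite mxvecE.
Qed.

(** The matrices t_k A_r over F[t], with the same index conventions as
    [tA]. *)
Definition tM n (A : 'I_3 -> 'M[F]_3) (k r : nat) : 'M[{mpoly F[n.+1]}]_3 :=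
  'X_(inord k.-1) *: map_mx (@mpolyC n.+1 F) (A (inord r.-1)).

Lemma map_tA n A k r : map_mx (map_mpoly (ev A)) (tA K n k r) = tM n A k r.
Proof.
apply/matrixP => i j; rewrite /tM -(ev_generic A) !mxE rmorphM /= map_mpolyX.
by rewrite map_mpolyC.
Qed.

Lemma ev_f A i j k : ev A (f_ K i j k) =
  (\det (tM 2 A 1 1 + tM 2 A 2 2 + tM 2 A 3 3))@_[multinom [tuple i; j; k]].
Proof.
rewrite -!map_tA -!(map_mxD (map_mpoly (ev A))) (det_map_mx (map_mpoly (ev A))).
exact: esym (mcoeff_map_mpoly _ _ _).
Qed.

Lemma ev_h A : ev A (h_ K) =
  (\det (block_mx (tM 2 A 2 2) (tM 2 A 1 1) (tM 2 A 1 1) (tM 2 A 3 3)))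
   @_[multinom [tuple 2; 2; 2]%N].
Proof.
rewrite -!map_tA -map_block_mx (det_map_mx (map_mpoly (ev A))).
exact: esym (mcoeff_map_mpoly _ _ _).
Qed.

Lemma ev_q A : ev A (q_ K) =
  (\det (block33 (tM 5 A 1 1) (tM 5 A 2 2) (tM 5 A 3 3)
                 (tM 5 A 4 1) (tM 5 A 5 2) (tM 5 A 6 3)))
    @_[multinom [tuple 2; 1; 2; 1; 2; 1]%N].
Proof.
rewrite -!map_tA -map_block33 (det_map_mx (map_mpoly (ev A))).
exact: esym (mcoeff_map_mpoly _ _ _).
Qed.

End Ev.

Lemma inord3 : (inord 0 = o0) * (inord 1 = o1) * (inord 2 = o2).
Proof. by do !split; apply: val_inj; rewrite /= inordK. Qed.

(** Turns the comparison of exponents in three variables into a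
    computation. *)
Lemma mnm3_eq (m m' : 'X_{1..3}) :
  (m == m') = [&& m o0 == m' o0, m o1 == m' o1 & m o2 == m' o2].
Proof.
apply/eqP/and3P => [->|[/eqP h0 /eqP h1 /eqP h2]]; first by rewrite !eqxx.
by apply/mnmP; elim/ord3P.
Qed.

Lemma map_polar (R S : comNzRingType) (f : {rmorphism R -> S}) (A B : 'M[R]_3) :
  polar (map_mx f A) (map_mx f B) = f (polar A B).
Proof. by rewrite /polar -map_mx_adj -map_mxM trace_map_mx. Qed.

Lemma map_mixed (R S : comNzRingType) (f : {rmorphism R -> S}) (A B C : 'M[R]_3) :
  mixed (map_mx f A) (map_mx f B) (map_mx f C) = f (mixed A B C).
Proof. by rewrite /mixed -map_mxD !map_polar !rmorphB. Qed.

Section Formulas.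
Variables (K F : comNzRingType) (iota : {rmorphism K -> F}).
Variable A : 'I_3 -> 'M[F]_3.

Definition fval (i j k : nat) : F := ev iota A (f_ K i j k).

Lemma tpencil :
  \det (tM 2 A 1 1 + tM 2 A 2 2 + tM 2 A 3 3) =
    \det (A o0) *: 'X_[U_(o0) *+ 3] + polar (A o0) (A o1) *: 'X_[U_(o0) *+ 2 + U_(o1)]
  + polar (A o0) (A o2) *: 'X_[U_(o0) *+ 2 + U_(o2)]
  + polar (A o1) (A o0) *: 'X_[U_(o0) + U_(o1) *+ 2]
  + mixed (A o0) (A o1) (A o2) *: 'X_[U_(o0) + U_(o1) + U_(o2)]
  + polar (A o2) (A o0) *: 'X_[U_(o0) + U_(o2) *+ 2]
  + \det (A o1) *: 'X_[U_(o1) *+ 3] + polar (A o1) (A o2) *: 'X_[U_(o1) *+ 2 + U_(o2)]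
  + polar (A o2) (A o1) *: 'X_[U_(o1) + U_(o2) *+ 2]
  + \det (A o2) *: 'X_[U_(o2) *+ 3].
Proof.
rewrite /tM !inord3 det_pencil3 !map_polar !map_mixed !det_map_mx.
rewrite -!mul_mpolyC !(mpolyXD, mpolyXn).
ring.
Qed.

Lemma ev_fE :
  [/\ fval 3 0 0 = \det (A o0), fval 2 1 0 = polar (A o0) (A o1),
      fval 2 0 1 = polar (A o0) (A o2), fval 1 2 0 = polar (A o1) (A o0) &
      fval 1 1 1 = mixed (A o0) (A o1) (A o2)] /\
  [/\ fval 1 0 2 = polar (A o2) (A o0), fval 0 3 0 = \det (A o1),
      fval 0 2 1 = polar (A o1) (A o2), fval 0 1 2 = polar (A o2) (A o1) &
      fval 0 0 3 = \det (A o2)].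
Proof.
by split; split; rewrite /fval ev_f tpencil !mcoeffD !mcoeffZ !mcoeffX !mnm3_eq
  !(mnmDE, mulmnE, mnm1E) !multinomE !(tnth_nth 0%N) /=
  ?(mulr0, mulr1, addr0, add0r).
Qed.
End Formulas.

(** * The two block determinants *)

Section BlockDet.
Variable R : idomainType.

Section Ops.
Variables n1 n2 : nat.
Variables (A : 'M[R]_n1) (B : 'M[R]_(n1, n2)) (C : 'M[R]_(n2, n1)) (D : 'M[R]_n2).

Lemma det_col_addr (U : 'M_(n1, n2)) :
  \det (block_mx A (A *m U + B) C (C *m U + D)) = \det (block_mx A B C D).
Proof.
have -> : block_mx A (A *m U + B) C (C *m U + D) =
          block_mx A B C D *m block_mx 1%:M U 0 1%:M.
  by rewrite mulmx_block !mulmx1 !mulmx0 !addr0.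
by rewrite det_mulmx det_ublock !det1 !mulr1.
Qed.

Lemma det_col_addl (U : 'M_(n2, n1)) :
  \det (block_mx (A + B *m U) B (C + D *m U) D) = \det (block_mx A B C D).
Proof.
have -> : block_mx (A + B *m U) B (C + D *m U) D =
          block_mx A B C D *m block_mx 1%:M 0 U 1%:M.
  by rewrite mulmx_block !mulmx1 !mulmx0 !add0r.
by rewrite det_mulmx det_lblock !det1 !mulr1.
Qed.

Lemma det_col_mull (G : 'M_n1) :
  \det (block_mx (A *m G) B (C *m G) D) = \det (block_mx A B C D) * \det G.
Proof.
have -> : block_mx (A *m G) B (C *m G) D =
          block_mx A B C D *m block_mx G 0 0 1%:M.
  by rewrite mulmx_block !mulmx1 !mulmx0 !addr0 !add0r.
by rewrite det_mulmx det_lblock det1 mulr1.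
Qed.
End Ops.

Lemma detN3 (Z : 'M[R]_3) : \det (- Z) = - \det Z.
Proof. by rewrite -scaleN1r detZ; ring. Qed.

(** Over a domain, a scalar off-diagonal block can be used to eliminate by
    column operations, at the price of multiplying the determinant by b ^+ 3,
    which is then cancelled. *)
Lemma det_block_scalar2 (X Y : 'M[R]_3) (b : R) : b != 0 ->
  \det (block_mx X b%:M b%:M Y) = \det (Y *m X - (b ^+ 2)%:M).
Proof.
move=> b0; have b30 : b ^+ 3 != 0 by rewrite expf_neq0.
apply: (mulIf b30); rewrite -{1}(det_scalar 3 b) -det_col_mull.
rewrite -(det_col_addl _ _ _ _ (- X)) -(det_col_addl _ _ _ _ 1%:M).
rewrite -(det_col_addr _ _ _ _ (- 1%:M)) !mulmx1 !mulmxN !mulmx1.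
rewrite !mul_mx_scalar !mul_scalar_mx subrr add0r addNr opprD addrNK.
rewrite det_lblock det_scalar mulrC opprB; congr (\det _ * _).
by rewrite scale_scalar_mx expr2.
Qed.

Definition Blk (A11 A12 A13 A21 A22 A23 A31 A32 A33 : 'M[R]_3) :=
  col_mx (row_mx A11 (row_mx A12 A13))
    (col_mx (row_mx A21 (row_mx A22 A23)) (row_mx A31 (row_mx A32 A33))).

Lemma mul_Blk A11 A12 A13 A21 A22 A23 A31 A32 A33
    B11 B12 B13 B21 B22 B23 B31 B32 B33 :
  Blk A11 A12 A13 A21 A22 A23 A31 A32 A33
    *m Blk B11 B12 B13 B21 B22 B23 B31 B32 B33 =
  Blk (A11 *m B11 + A12 *m B21 + A13 *m B31)
      (A11 *m B12 + A12 *m B22 + A13 *m B32)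
      (A11 *m B13 + A12 *m B23 + A13 *m B33)
      (A21 *m B11 + A22 *m B21 + A23 *m B31)
      (A21 *m B12 + A22 *m B22 + A23 *m B32)
      (A21 *m B13 + A22 *m B23 + A23 *m B33)
      (A31 *m B11 + A32 *m B21 + A33 *m B31)
      (A31 *m B12 + A32 *m B22 + A33 *m B32)
      (A31 *m B13 + A32 *m B23 + A33 *m B33).
Proof.
by rewrite /Blk !mul_col_mx !mul_row_col !mul_mx_row !add_row_mx -!addrA.
Qed.

Lemma Blk_block A11 A12 A13 A21 A22 A23 A31 A32 A33 :
  Blk A11 A12 A13 A21 A22 A23 A31 A32 A33 =
  block_mx A11 (row_mx A12 A13) (col_mx A21 A31) (block_mx A22 A23 A32 A33).
Proof.
by rewrite /Blk -[col_mx (row_mx A21 _) _]block_mxEv block_mxEh -block_mxEv.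
Qed.

Lemma det_Blk_lower A11 A21 A22 A31 A32 A33 :
  \det (Blk A11 0 0 A21 A22 0 A31 A32 A33) = \det A11 * (\det A22 * \det A33).
Proof. by rewrite Blk_block row_mx0 det_lblock det_lblock. Qed.

Lemma det_Blk_upper A11 A12 A13 A22 A23 A33 :
  \det (Blk A11 A12 A13 0 A22 A23 0 0 A33) = \det A11 * (\det A22 * \det A33).
Proof. by rewrite Blk_block col_mx0 det_ublock det_ublock. Qed.

(** The same elimination as in the 2 x 2 case: one multiplication on the right
    by a triangular block matrix of determinant (a d) ^+ 3 makes the matrix
    block triangular up to unimodular column operations. *)
Lemma det_block33_scalar (X X' Y Y' : 'M[R]_3) (a d : R) : a != 0 -> d != 0 ->
  \det (block33 a%:M X Y d%:M X' Y') = \det (a *: (X' *m Y) + d *: (Y' *m X)).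
Proof.
move=> a0 d0; have ad0 : (a * d) ^+ 3 != 0 by rewrite expf_neq0 // mulf_neq0.
apply: (mulIf ad0).
(* N1 clears the first two block entries of the last column; E1 and E2 bring
   the resulting matrix to block triangular form. *)
pose N1 := Blk 1%:M 0 (- (a *: Y)) 0 1%:M (- (d *: X)) 0 0 (a * d)%:M.
pose E1 := Blk 1%:M 0 0 1%:M 1%:M 0 0 0 1%:M.
pose E2 := Blk 1%:M (- 1%:M) 0 0 1%:M 0 0 0 1%:M.
have d1 : \det N1 = (a * d) ^+ 3 by rewrite det_Blk_upper !det1 det_scalar !mul1r.
have d2 : \det E1 = 1 by rewrite det_Blk_lower !det1 !mul1r.
have d3 : \det E2 = 1 by rewrite det_Blk_upper !det1 !mul1r.
rewrite -{1}d1 -det_mulmx -[LHS]mulr1 -d2 -det_mulmx -[LHS]mulr1 -d3 -det_mulmx.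
rewrite [block33 _ _ _ _ _ _]/(Blk 0 _ _ _ 0 _ _ _ 0) /N1 /E1 /E2 !mul_Blk.
rewrite !(mulmx0, mul0mx, mulmx1, mul1mx, addr0, add0r, mulmxN, mulmx1).
rewrite !(mul_mx_scalar, mul_scalar_mx) !scalerA (mulrC d a) !addNr opprD addrNK.
rewrite det_Blk_lower -!scalemxAr -opprD !detN3 !det_scalar exprMn.
by rewrite mulrNN mulrA mulrC.
Qed.
End BlockDet.

Lemma mX_neq0 (F : nzRingType) n (m : 'X_{1..n}) : 'X_[m] != 0 :> {mpoly F[n]}.
Proof.
apply/eqP => /(congr1 (mcoeff m)); rewrite mcoeffX eqxx mcoeff0.
by move/eqP; rewrite oner_eq0.
Qed.

Section BlockCoefficients.
Variables (F : idomainType) (A : 'I_3 -> 'M[F]_3) (X Y : 'M[F]_3).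
Hypotheses (A1E : A o1 = A o0 *m X) (A2E : A o2 = A o0 *m Y).

Lemma block_factor2 (S : idomainType) (A0 X0 Y0 : 'M[S]_3) (t1 t2 t3 : S) :
  \det (block_mx (t2 *: (A0 *m X0)) (t1 *: A0) (t1 *: A0) (t3 *: (A0 *m Y0))) =
  \det A0 ^+ 2 *
  \det (block_mx (t2 *: X0) t1%:M t1%:M (t3 *: Y0)).
Proof.
have <- : \det (block_mx A0 0 0 A0 : 'M[S]_(3 + 3)) = \det A0 ^+ 2.
  by rewrite det_lblock expr2.
rewrite -det_mulmx mulmx_block !mul0mx !add0r !addr0 -!scalemxAr.
by rewrite !mul_mx_scalar.
Qed.

Lemma block_factor3 (S : idomainType) (A0 X0 Y0 : 'M[S]_3) (t1 t2 t3 t4 t5 t6 : S) :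
  \det (block33 (t1 *: A0) (t2 *: (A0 *m X0)) (t3 *: (A0 *m Y0))
                (t4 *: A0) (t5 *: (A0 *m X0)) (t6 *: (A0 *m Y0))) =
  \det A0 ^+ 3 *
  \det (block33 t1%:M (t2 *: X0) (t3 *: Y0) t4%:M (t5 *: X0) (t6 *: Y0)).
Proof.
have <- : \det (Blk A0 0 0 0 A0 0 0 0 A0) = \det A0 ^+ 3.
  by rewrite det_Blk_lower !exprS expr0 mulr1.
rewrite -det_mulmx -[block33 t1%:M _ _ _ _ _]/(Blk 0 _ _ _ 0 _ _ _ 0) mul_Blk.
rewrite !mul0mx !mulmx0 !add0r !addr0 -!scalemxAr.
by rewrite !mul_mx_scalar.
Qed.

(** With A2 = A1 X and A3 = A1 Y the factor A1 comes out, and the rest is the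
    determinant of a pencil in Y X and the identity. *)
Lemma block_h_coef : (\det (block_mx (tM 2 A 2 2) (tM 2 A 1 1) (tM 2 A 1 1) (tM 2 A 3 3)))
   @_[multinom [tuple 2; 2; 2]%N] = - \det (A o0) ^+ 2 * polar (Y *m X) 1%:M.
Proof.
rewrite /tM !inord3 A1E A2E !map_mxM block_factor2.
rewrite det_block_scalar2 ?mX_neq0 // -!scalemxAl -!scalemxAr scalerA -map_mxM.
have -> : - (('X_o0 : {mpoly F[3]}) ^+ 2)%:M =
    (- 'X_o0 ^+ 2) *: map_mx (@mpolyC 3 F) (1%:M : 'M_3).
  by rewrite map_mx1 -scalemx1 scaleNr.
rewrite det_pencil2 /= !map_polar !det_map_mx /=.
set d := \det (A o0); set D := \det (Y *m X); set t1 := polar _ _; set t2 := polar _ _.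
set t3 := \det _.
have -> : d%:MP ^+ 2 *
   (('X_o2 * 'X_o1) ^+ 3 * D%:MP + ('X_o2 * 'X_o1) ^+ 2 * - 'X_o0 ^+ 2 * t1%:MP +
    'X_o2 * 'X_o1 * (- 'X_o0 ^+ 2) ^+ 2 * t2%:MP + (- 'X_o0 ^+ 2) ^+ 3 * t3%:MP) =
   (d ^+ 2 * D) *: 'X_[U_(o2) *+ 3 + U_(o1) *+ 3]
   - (d ^+ 2 * t1) *: 'X_[U_(o2) *+ 2 + U_(o1) *+ 2 + U_(o0) *+ 2]
   + (d ^+ 2 * t2) *: 'X_[U_(o2) + U_(o1) + U_(o0) *+ 4]
   - (d ^+ 2 * t3) *: 'X_[U_(o0) *+ 6] :> {mpoly F[3]}.
  by rewrite -!mul_mpolyC !(mpolyXD, mpolyXn) !rmorphM /=; ring.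
rewrite !(mcoeffD, mcoeffN) !mcoeffZ !mcoeffX !mnm3_eq.
rewrite !(mnmDE, mulmnE, mnm1E) !multinomE !(tnth_nth 0%N) /=.
by rewrite !(mulr0, mulr1, addr0, add0r, subr0) mulNr.
Qed.

Lemma inord6_eq a b : (a < 6)%N -> (b < 6)%N ->
  (inord a == inord b :> 'I_6) = (a == b).
Proof. by move=> lta ltb; rewrite -val_eqE /= !inordK. Qed.

(** With A2 = A1 X and A3 = A1 Y the determinant reduces to that of a pencil
    in X Y and Y X; its monomials are u ^+ i * v ^+ j with u = t1 t3 t5 and v
    = t2 t4 t6, and the requested one is u ^+ 2 * v. *)
Lemma block_q_coef : (\det (block33 (tM 5 A 1 1) (tM 5 A 2 2) (tM 5 A 3 3)
                 (tM 5 A 4 1) (tM 5 A 5 2) (tM 5 A 6 3)))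
    @_[multinom [tuple 2; 1; 2; 1; 2; 1]%N] = \det (A o0) ^+ 3 * polar (X *m Y) (Y *m X).
Proof.
rewrite /tM /= !inord3 A1E A2E !map_mxM block_factor3.
rewrite det_block33_scalar ?mX_neq0 // -!scalemxAl -!scalemxAr !scalerA -!map_mxM.
rewrite det_pencil2 /= !map_polar !det_map_mx /=.
set d := \det (A o0); set D := \det (X *m Y); set t1 := polar _ _; set t2 := polar _ _.
set D' := \det _.
pose u := (U_(inord 0 : 'I_6) + U_(inord 2) + U_(inord 4))%MM.
pose v := (U_(inord 1 : 'I_6) + U_(inord 3) + U_(inord 5))%MM.
transitivity (((d ^+ 3 * D) *: 'X_[u *+ 3] + (d ^+ 3 * t1) *: 'X_[u *+ 2 + v]
   + (d ^+ 3 * t2) *: 'X_[u + v *+ 2] + (d ^+ 3 * D') *: 'X_[v *+ 3])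
    @_[multinom [tuple 2; 1; 2; 1; 2; 1]%N]).
  congr (mcoeff _ _).
  by rewrite -!mul_mpolyC !(mpolyXD, mpolyXn) /u /v !rmorphM /=; ring.
have mP (w : 'X_{1..6}) : (w == [multinom [tuple 2; 1; 2; 1; 2; 1]%N])  = (w == (u *+ 2 + v)%MM).
  congr (_ == _); apply/mnmP => -[[|[|[|[|[|[|//]]]]]] lti];
  rewrite multinomE (tnth_nth 0%N) /= !(mnmDE, mulmnE, mnm1E) -!val_eqE /= !inordK //.
rewrite !mcoeffD !mcoeffZ !mcoeffX !mP eqxx.
have neq (w : 'X_{1..6}) : w (inord 0 : 'I_6) != 2 -> (w == (u *+ 2 + v)%MM) = false.
  move=> neq; apply: contraNF neq => /eqP ->.
  by rewrite !(mnmDE, mulmnE, mnm1E) !inord6_eq.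
rewrite !neq; rewrite ?(mnmDE, mulmnE, mnm1E) ?inord6_eq //.
by rewrite !(mulr0, mulr1, addr0, add0r).
Qed.

End BlockCoefficients.

(** * Trace formulas for h and q *)

Lemma mmap_ext n (K F : nzRingType) (f g : K -> F) (u v : 'I_n -> F)
  (p : {mpoly K[n]}) : f =1 g -> u =1 v -> mmap f u p = mmap g v p.
Proof.
move=> fg uv; apply: eq_bigr => m _; rewrite fg; congr (_ * _).
by apply: eq_bigr => i _; rewrite uv.
Qed.

Section Morphisms.
Variables (n : nat) (K : nzRingType) (F : comNzRingType).

(** A morphism out of a polynomial ring is the evaluation at the images of
    constants and variables; two morphisms are compared through this form. *)
Lemma rmorph_mmap (phi : {rmorphism {mpoly K[n]} -> F}) p :
  mmap (phi \o @mpolyC n K) (fun i => phi 'X_i) p = phi p.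
Proof.
rewrite {2}(mpolyE p) rmorph_sum /mmap; apply: eq_bigr => m _ /=.
rewrite -mul_mpolyC rmorphM; congr (_ * _).
rewrite mpolyXE_id rmorph_prod /mmap1; apply: eq_bigr => i _.
by rewrite rmorphXn.
Qed.

End Morphisms.

Lemma mmap_comp n (K : nzRingType) (F S : comNzRingType) (iota : {rmorphism K -> F})
    (phi : {rmorphism F -> S}) v (p : {mpoly K[n]}) :
  phi (mmap iota v p) = mmap (phi \o iota) (phi \o v) p.
Proof.
rewrite -[LHS]/((phi \o mmap iota v) p) -(rmorph_mmap (phi \o mmap iota v)).
apply: mmap_ext => [c|i] /=.
  by rewrite mmapC.
by rewrite mmapX mmap1U.
Qed.

Lemma rmorph_ev (K F : comNzRingType) (phi : {rmorphism coord_ring K -> F}) p :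
  phi p = ev (phi \o @mpolyC _ K) (fun r => map_mx phi (generic_matrix K r)) p.
Proof.
rewrite -rmorph_mmap; apply: mmap_ext => // k.
case/mxvec_indexP: k => r k; case/mxvec_indexP: k => i j.
by rewrite /coordinates mxvecE mxE mxvecE !mxE.
Qed.

Definition hmx (R : comNzRingType) (A B C : 'M[R]_3) :=
  - \tr (\adj C *m A *m \adj B *m A).
Definition qmx (R : comNzRingType) (A B C : 'M[R]_3) :=
  \tr (\adj C *m A *m \adj B *m C *m \adj A *m B).

Lemma map_hmx (R S : comNzRingType) (f : {rmorphism R -> S}) (A B C : 'M[R]_3) :
  hmx (map_mx f A) (map_mx f B) (map_mx f C) = f (hmx A B C).
Proof. by rewrite /hmx -!map_mx_adj -!map_mxM trace_map_mx rmorphN. Qed.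

Lemma map_qmx (R S : comNzRingType) (f : {rmorphism R -> S}) (A B C : 'M[R]_3) :
  qmx (map_mx f A) (map_mx f B) (map_mx f C) = f (qmx A B C).
Proof. by rewrite /qmx -!map_mx_adj -!map_mxM trace_map_mx. Qed.

Lemma hmx_mull (R : comNzRingType) (A X Y : 'M[R]_3) :
  hmx A (A *m X) (A *m Y) = - \det A ^+ 2 * polar (Y *m X) 1%:M.
Proof.
rewrite /hmx /polar mulmx1 !adjM -!mulmxA mul_adj_mx !mulmxA -[_ *m \adj A *m A]mulmxA.
rewrite mul_adj_mx !mul_mx_scalar -!scalemxAl !mxtraceZ mxtrace_mulC.
by rewrite mulrA -expr2 mulNr.
Qed.

Lemma qmx_mull (R : comNzRingType) (A X Y : 'M[R]_3) :
  qmx A (A *m X) (A *m Y) = \det A ^+ 3 * polar (X *m Y) (Y *m X).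
Proof.
rewrite /qmx /polar !adjM.
have e (B C : 'M[R]_3) : B *m \adj A *m (A *m C) = \det A *: (B *m C).
  by rewrite -mulmxA [\adj A *m _]mulmxA mul_adj_mx mul_scalar_mx -scalemxAr.
rewrite -[\adj Y *m \adj A *m A]mulmx1 -!mulmxA.
rewrite ![\adj A *m (A *m _)]mulmxA mul_adj_mx !mul_scalar_mx -!scalemxAr.
by rewrite !mxtraceZ !mulrA !exprS expr0 mulr1 mulrA.
Qed.

Lemma generic_det_neq0 (K : comNzRingType) r : \det (generic_matrix K r) != 0.
Proof.
apply/eqP => /(congr1 (@ev K K idfun (fun=> 1%:M))).
rewrite -det_map_mx ev_generic det1 rmorph0 => /eqP; by rewrite oner_eq0.
Qed.

(** The first generic matrix is invertible over the fraction field of the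
    integral coordinate ring, which reduces the formulas to A2 = A1 X, A3 = A1
    Y. The integral generic triple then specializes to every triple over every
    commutative ring. *)
Lemma generic_hq (gen := generic_matrix int) :
  h_ int = hmx (gen o0) (gen o1) (gen o2) /\
  q_ int = qmx (gen o0) (gen o1) (gen o2).
Proof.
pose j := @tofrac (coord_ring int).
pose A r := map_mx j (gen r).
have uA : A o0 \in unitmx.
  by rewrite unitmxE unitfE det_map_mx tofrac_eq0 generic_det_neq0.
pose X := invmx (A o0) *m A o1; pose Y := invmx (A o0) *m A o2.
have A1E : A o1 = A o0 *m X by rewrite mulKVmx.
have A2E : A o2 = A o0 *m Y by rewrite mulKVmx.
have evj (p : coord_ring int) : ev (j \o @mpolyC _ int) A p = j p.
  by rewrite -(rmorph_ev j).
have jI : injective j.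
  by move=> x y /eqP; rewrite -subr_eq0 -rmorphB tofrac_eq0 subr_eq0 => /eqP.
split; apply: jI.
  transitivity (hmx (A o0) (A o1) (A o2)); last exact: map_hmx.
  by rewrite -evj ev_h (block_h_coef A1E A2E) -hmx_mull -A1E -A2E.
transitivity (qmx (A o0) (A o1) (A o2)); last exact: map_qmx.
by rewrite -evj ev_q (block_q_coef A1E A2E) -qmx_mull -A1E -A2E.
Qed.

Lemma ev_hE (K F : comNzRingType) (iota : {rmorphism K -> F}) A :
  ev iota A (h_ K) = hmx (A o0) (A o1) (A o2).
Proof.
rewrite ev_h -(ev_h intr) (generic_hq.1) -map_hmx.
by rewrite !ev_generic.
Qed.

Lemma ev_qE (K F : comNzRingType) (iota : {rmorphism K -> F}) A :
  ev iota A (q_ K) = qmx (A o0) (A o1) (A o2).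
Proof.
rewrite ev_q -(ev_q intr) (generic_hq.2) -map_qmx.
by rewrite !ev_generic.
Qed.

(** * Values on the slice (1, diag x, Y) *)

(** The value of A on the slice, in terms of the eigenvalues x, the diagonal y
    of Y, the products z of opposite off-diagonal entries of Y, and the two
    cyclic products u, v. It vanishes because u v = z0 z1 z2 for the entries
    of a matrix. *)
Lemma A_slice (R : comNzRingType) (x0 x1 x2 y0 y1 y2 z0 z1 z2 u v : R) :
  let m0 := y1 * y2 - z0 in let m1 := y0 * y2 - z1 in let m2 := y0 * y1 - z2 in
  let al := x0 ^+ 2 * x1 + x1 ^+ 2 * x2 + x2 ^+ 2 * x0 in
  let be := x0 ^+ 2 * x2 + x1 ^+ 2 * x0 + x2 ^+ 2 * x1 in
  A_expr (al * u + be * v + (x0 * x1 * x2 * (y0 * m0 + y1 * m1 + y2 * m2)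
            - (y0 * z0 * x0 * (x1 ^+ 2 + x2 ^+ 2) + y1 * z1 * x1 * (x0 ^+ 2 + x2 ^+ 2)
               + y2 * z2 * x2 * (x0 ^+ 2 + x1 ^+ 2))))
   (- (x1 * x2 * m0 + x0 * x2 * m1 + x0 * x1 * m2))
   1 (x0 + x1 + x2) (y0 + y1 + y2) (x0 * x1 + x0 * x2 + x1 * x2)
   (y0 * (x1 + x2) + y1 * (x0 + x2) + y2 * (x0 + x1)) (m0 + m1 + m2)
   (x0 * x1 * x2) (y0 * (x1 * x2) + y1 * (x0 * x2) + y2 * (x0 * x1))
   (x0 * m0 + x1 * m1 + x2 * m2)
   (u + v + y0 * y1 * y2 - (y0 * z0 + y1 * z1 + y2 * z2)) =
   (al - be) ^+ 2 * (z0 * z1 * z2 - u * v).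
Proof.
rewrite /A_expr /=.
ring.
Qed.

Section Values.
Variable R : comNzRingType.
Implicit Types (A : 'I_3 -> 'M[R]_3) (x : 'I_3 -> R) (Y : 'M[R]_3).

(** The values of h, f_1, ..., f_10 at a triple, in the order of
    [hf_tuple]. *)
Definition hfseq A : seq R :=
  let a := A o0 in let b := A o1 in let c := A o2 in
  [:: hmx a b c; \det a; polar a b; polar a c; polar b a; mixed a b c; polar c a; \det b; polar b c;
      polar c b; \det c].
Definition qv A : R := qmx (A o0) (A o1) (A o2).
Definition A_of (q : R) (s : seq R) : R :=
  A_expr q s`_0 s`_1 s`_2 s`_3 s`_4 s`_5 s`_6 s`_7 s`_8 s`_9 s`_10.
(** The action of pairs of matrices by multiplication on both sides; g' stands
    for the inverse that occurs in [SL_act], and enters polynomially. *)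
Definition lract (g g' : 'M[R]_3) A r := g *m A r *m g'.
Definition trA A r := (A r)^T.
Definition swA A r := A (if r == o0 then o2 else if r == o1 then o1 else o0).
Definition slc x Y (r : 'I_3) : 'M[R]_3 :=
  if r == o0 then 1%:M else if r == o1 then diag_mx (\row_i x i) else Y.

(** The discriminant of the binary cubic form with coefficients f1, f2, f4,
    f7. *)
Definition disc4 (f1 f2 f4 f7 : R) : R :=
  f2 ^+ 2 * f4 ^+ 2 - 4 * f1 * f4 ^+ 3 - 4 * f2 ^+ 3 * f7
  - 27 * f1 ^+ 2 * f7 ^+ 2 + 18 * f1 * f2 * f4 * f7.
Definition vdm x := (x o0 - x o1) * (x o0 - x o2) * (x o1 - x o2).

Lemma disc4E x : disc4 1 (x o0 + x o1 + x o2)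
   (x o0 * x o1 + x o0 * x o2 + x o1 * x o2) (x o0 * x o1 * x o2) = vdm x ^+ 2.
Proof. rewrite /disc4 /vdm; ring. Qed.

Section Slice.
Variables (x : 'I_3 -> R) (Y : 'M[R]_3).
Let x0 := x o0. Let x1 := x o1. Let x2 := x o2.
Let y0 := Y o0 o0. Let y1 := Y o1 o1. Let y2 := Y o2 o2.
Let z0 := Y o1 o2 * Y o2 o1. Let z1 := Y o0 o2 * Y o2 o0. Let z2 := Y o0 o1 * Y o1 o0.
Let u := Y o0 o1 * Y o1 o2 * Y o2 o0. Let v := Y o0 o2 * Y o2 o1 * Y o1 o0.
Let m0 := y1 * y2 - z0. Let m1 := y0 * y2 - z1. Let m2 := y0 * y1 - z2.
Let al := x0 ^+ 2 * x1 + x1 ^+ 2 * x2 + x2 ^+ 2 * x0.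
Let be := x0 ^+ 2 * x2 + x1 ^+ 2 * x0 + x2 ^+ 2 * x1.
Let rr := x0 * x1 * x2 * (y0 * m0 + y1 * m1 + y2 * m2)
            - (y0 * z0 * x0 * (x1 ^+ 2 + x2 ^+ 2) + y1 * z1 * x1 * (x0 ^+ 2 + x2 ^+ 2)
               + y2 * z2 * x2 * (x0 ^+ 2 + x1 ^+ 2)).

Lemma hf_slc : hfseq (slc x Y) =
  [:: - (x1 * x2 * m0 + x0 * x2 * m1 + x0 * x1 * m2); 1; x0 + x1 + x2; y0 + y1 + y2;
      x0 * x1 + x0 * x2 + x1 * x2;
      y0 * (x1 + x2) + y1 * (x0 + x2) + y2 * (x0 + x1); m0 + m1 + m2;
      x0 * x1 * x2; y0 * (x1 * x2) + y1 * (x0 * x2) + y2 * (x0 * x1);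
      x0 * m0 + x1 * m1 + x2 * m2;
      u + v + y0 * y1 * y2 - (y0 * z0 + y1 * z1 + y2 * z2)].
Proof.
rewrite /hfseq /slc /= /m0 /m1 /m2 /z0 /z1 /z2 /y0 /y1 /y2 /u /v /x0 /x1 /x2.
congr [:: _; _; _; _; _; _; _; _; _; _; _].
- rewrite /hmx -!mulmxA mul1mx mulmx1 mxtrace_mulC -/(polar _ _) polarE.
  by rewrite !adj3E !mxE /=; ring.
- by rewrite det1.
all: rewrite /mixed ?det3 ?polarE ?mxE /=; ring.
Qed.

(** Only here do u and v enter separately: al - be is the Vandermonde
    determinant of x, so together with u + v, known from f_10, the value of q
    determines both. *)
Lemma qv_slc : qv (slc x Y) = al * u + be * v + rr.
Proof.
rewrite /qv /slc /= /qmx adj1 mulmx1 mulmx1 /al /be /u /v /rr /m0 /m1 /m2 /z0 /z1 /z2.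
rewrite /y0 /y1 /y2 /x0 /x1 /x2.
pose a (i : 'I_3) := if i == o0 then x o1 * x o2 else if i == o1 then x o0 * x o2
  else x o0 * x o1.
have -> : \adj (diag_mx (\row_i x i)) = diag_mx (\row_i a i).
  by apply/matrixP; elim/ord3P; elim/ord3P; rewrite adj3E !mxE /a /=; ring.
rewrite -!mulmxA -/(polar _ _).
have -> : diag_mx (\row_i a i) *m (Y *m diag_mx (\row_i x i)) =
    \matrix_(i, j) (a i * (Y i j * x j)).
  by rewrite mul_diag_mx mul_mx_diag; apply/matrixP => i j; rewrite !mxE.
rewrite polarE !mxE /a /=; ring.
Qed.

Lemma A_of_slc : A_of (qv (slc x Y)) (hfseq (slc x Y)) = 0.
Proof.
rewrite /A_of qv_slc hf_slc; apply: (etrans (A_slice x0 x1 x2 y0 y1 y2 z0 z1 z2 u v)).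
by rewrite /z0 /z1 /z2 /u /v; ring.
Qed.
End Slice.
End Values.

(** * Equivariance, transposition and exchange *)

Section Equivariance.
Variables (R : comNzRingType) (g g' : 'M[R]_3).
Implicit Types A B C : 'M[R]_3.
Let d := \det g * \det g'.

Lemma polar_lract A B : polar (g *m A *m g') (g *m B *m g') = d * polar A B.
Proof.
rewrite /polar !adjM -!mulmxA [\adj g *m _]mulmxA mul_adj_mx mul_scalar_mx.
rewrite -!scalemxAr mxtraceZ mxtrace_mulC -!mulmxA mul_mx_adj mul_mx_scalar.
by rewrite -scalemxAr mxtraceZ mulrA.
Qed.

Lemma mixed_lract A B C :
  mixed (g *m A *m g') (g *m B *m g') (g *m C *m g') = d * mixed A B C.
Proof. by rewrite /mixed -mulmxDl -mulmxDr !polar_lract !mulrBr. Qed.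

Lemma adj_lract_mul A B :
  \adj (g *m A *m g') *m (g *m B *m g') = \det g *: (\adj g' *m (\adj A *m B) *m g').
Proof.
rewrite !adjM -!mulmxA [\adj g *m _]mulmxA mul_adj_mx mul_scalar_mx.
by rewrite -!scalemxAr.
Qed.

(** Products of conjugates by g' telescope, each inner adj g' g' leaving a
    determinant. *)
Lemma conj_adj_mul (M N : 'M[R]_3) :
  \adj g' *m M *m g' *m (\adj g' *m N *m g') = \det g' *: (\adj g' *m (M *m N) *m g').
Proof.
by rewrite -!mulmxA [g' *m (\adj g' *m _)]mulmxA mul_mx_adj mul_scalar_mx -!scalemxAr.
Qed.

Lemma tr_conj_adj (M : 'M[R]_3) : \tr (\adj g' *m M *m g') = \det g' * \tr M.
Proof. by rewrite -mulmxA mxtrace_mulC -mulmxA mul_mx_adj mul_mx_scalar mxtraceZ. Qed.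

Lemma hmx_lract A B C :
  hmx (g *m A *m g') (g *m B *m g') (g *m C *m g') = d ^+ 2 * hmx A B C.
Proof.
rewrite /hmx -[_ *m \adj _ *m _]mulmxA !adj_lract_mul -scalemxAl -scalemxAr.
rewrite conj_adj_mul !mxtraceZ tr_conj_adj -mulmxA /d; ring.
Qed.

Lemma qmx_lract A B C :
  qmx (g *m A *m g') (g *m B *m g') (g *m C *m g') = d ^+ 3 * qmx A B C.
Proof.
rewrite /qmx -[_ *m \adj (g *m A *m g') *m _]mulmxA.
rewrite -[X in \tr (X *m _)]mulmxA !adj_lract_mul.
rewrite -!(scalemxAl, scalemxAr) !conj_adj_mul -!(scalemxAl, scalemxAr).
rewrite conj_adj_mul !mxtraceZ tr_conj_adj !mulmxA /d; ring.
Qed.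

Lemma qv_lract (A : 'I_3 -> 'M[R]_3) : qv (lract g g' A) = d ^+ 3 * qv A.
Proof. exact: qmx_lract. Qed.

End Equivariance.

Section TransposeSwap.
Variable R : comNzRingType.
Implicit Types (A B C : 'M[R]_3).

Lemma adj_tr A : \adj A^T = (\adj A)^T.
Proof. by apply/matrixP => i j; rewrite !mxE cofactor_tr. Qed.

Lemma polar_tr A B : polar A^T B^T = polar A B.
Proof. by rewrite /polar adj_tr -trmx_mul mxtrace_tr mxtrace_mulC. Qed.

Lemma mixed_tr A B C : mixed A^T B^T C^T = mixed A B C.
Proof.
rewrite /mixed; have -> : A^T + B^T = (A + B)^T by rewrite linearD.
by rewrite !polar_tr.
Qed.

Lemma hmx_tr A B C : hmx A^T B^T C^T = hmx A B C.
Proof.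
rewrite /hmx !adj_tr -!trmx_mul mxtrace_tr !mulmxA mxtrace_mulC.
by rewrite -!mulmxA mxtrace_mulC -!mulmxA mxtrace_mulC -!mulmxA.
Qed.

Lemma qmx_tr_sw A B C : qmx A^T B^T C^T = qmx C B A.
Proof.
rewrite /qmx !adj_tr -!trmx_mul mxtrace_tr !mulmxA -!mulmxA mxtrace_mulC.
by rewrite -!mulmxA.
Qed.

Lemma mixed_sw A B C : mixed C B A = mixed A B C.
Proof. rewrite /mixed !polarE !mxE; ring. Qed.

(** Minus the coefficient of q in A: A is q ^+ 2 - S q + A_0, and evaluating
    at q = 0 and q = 1 extracts S. *)
Definition Sval (s : seq R) : R := 1 + A_of 0 s - A_of 1 s.

Lemma A_ofE q s : A_of q s = q ^+ 2 - Sval s * q + A_of 0 s.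
Proof. rewrite /Sval /A_of /A_expr; ring. Qed.

Lemma SvalE s : Sval s = s`_0 * s`_5 - 3 * s`_1 * s`_7 * s`_10 + s`_1 * s`_8 * s`_9
  + s`_2 * s`_4 * s`_10 - s`_2 * s`_6 * s`_8 - s`_3 * s`_4 * s`_9
  + s`_3 * s`_6 * s`_7 + s`_4 * s`_5 * s`_6.
Proof. rewrite /Sval /A_of /A_expr; ring. Qed.

Lemma trA_slc x (Y : 'M[R]_3) r : trA (slc x Y) r = slc x Y^T r.
Proof. by rewrite /trA /slc; case: ifP => _; [|case: ifP => _]; rewrite ?trmx1 ?tr_diag_mx. Qed.

(** On the slice, q and its transpose are the two roots of A; their sum is
    S. *)
Lemma S_slc x (Y : 'M[R]_3) :
  qv (slc x Y) + qv (slc x Y^T) = Sval (hfseq (slc x Y)).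
Proof. rewrite !qv_slc SvalE hf_slc !mxE /=; ring. Qed.

(** The discriminant of A with respect to q is generically nonzero:
    transposition exchanges u and v. *)
Lemma qv_sub_slc x (Y : 'M[R]_3) : qv (slc x Y) - qv (slc x Y^T) =
  vdm x * (Y o0 o1 * Y o1 o2 * Y o2 o0 - Y o0 o2 * Y o2 o1 * Y o1 o0).
Proof. rewrite !qv_slc /vdm !mxE /=; ring. Qed.

Lemma h_sw_slc x (Y : 'M[R]_3) (s := hfseq (slc x Y)) :
  hmx Y (diag_mx (\row_i x i)) 1%:M = s`_0 - s`_3 * s`_8 + s`_4 * s`_6.
Proof.
rewrite /s hf_slc /= /hmx adj1 mul1mx mxtrace_mulC mulmxA mxtrace_mulC -/(polar _ _).
by rewrite polarE !(mxE, sum3) /=; ring.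
Qed.

End TransposeSwap.

(** * Splitting a cubic and diagonalizing over an extension *)

(** A root exists after an extension: pass to a proper divisor until the
    polynomial is irreducible, then adjoin a root. *)
Lemma root_ext (F : fieldType) (p : {poly F}) : (1 < size p)%N ->
  exists (F' : fieldType) (iota : {rmorphism F -> F'}) (x : F'),
    root (map_poly iota p) x.
Proof.
have [n] := ubnP (size p); elim: n p => // n IHn p; rewrite ltnS => lep p1.
case: (classic (irreducible_poly p)) => [irr|nirr].
  have [L _ [z z0 _]] := irredp_FAdjoin irr.
  by exists L, (in_alg L), z.
have [q q1 [qp nq]] : exists2 q : {poly F}, size q != 1%N & q %| p /\ ~~ (q %= p).
  apply: NNPP => nex; apply: nirr; split=> // q q1 qp.
  by apply: contraT => nq; case: nex; exists q.
have p0 : p != 0 by rewrite -size_poly_gt0 ltnW.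
have q0 : q != 0 by apply: contraNneq p0 => q0; rewrite q0 dvd0p in qp.
have ltqp : (size q < size p)%N.
  by rewrite ltn_neqAle dvdp_leq // andbT dvdp_size_eqp.
have [||F' [iota [x xq]]] := IHn q; first exact: leq_trans ltqp lep.
  by rewrite ltn_neqAle eq_sym q1 size_poly_gt0.
exists F', iota, x; apply: (root_dvdp _ xq); by rewrite dvdp_map.
Qed.

(** Two successive root extractions; the third root is forced by the sum of
    the roots. *)
Lemma split3 (F : fieldType) (a b c : F) :
  exists (F' : fieldType) (iota : {rmorphism F -> F'}) (x : 'I_3 -> F'),
  [/\ iota a = x o0 + x o1 + x o2, iota b = x o0 * x o1 + x o0 * x o2 + x o1 * x o2
    & iota c = x o0 * x o1 * x o2].
Proof.
pose p : {poly F} := 'X^3 - a *: 'X^2 + b *: 'X - c%:P.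
have sp : size p = 4.
  rewrite /p -!addrA size_polyDl size_polyXn // ltnS.
  rewrite (leq_trans (size_polyD _ _)) // geq_max size_polyN.
  rewrite (leq_trans (size_scale_leq _ _)) ?size_polyXn //=.
  rewrite (leq_trans (size_polyD _ _)) // geq_max size_polyN size_polyC.
  by rewrite (leq_trans (size_scale_leq _ _)) ?size_polyX //; case: (c != 0).
have [|F1 [i1 [x0 r0]]] := @root_ext _ p; first by rewrite sp.
have {r0} e0 : x0 ^+ 3 - i1 a * x0 ^+ 2 + i1 b * x0 - i1 c = 0.
  move: r0; rewrite /root /p !(rmorphB, rmorphD) /= !map_polyZ /= !map_polyXn.
  rewrite map_polyX map_polyC !hornerE => /eqP <-; ring.
have [d dE] : exists d, d = x0 ^+ 2 - i1 a * x0 + i1 b by eexists.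
pose q : {poly F1} := 'X^2 - (i1 a - x0) *: 'X + d%:P.
have sq : size q = 3.
  rewrite /q -!addrA size_polyDl size_polyXn // ltnS.
  rewrite (leq_trans (size_polyD _ _)) // geq_max size_polyN size_polyC.
  by rewrite (leq_trans (size_scale_leq _ _)) ?size_polyX //; case: (d != 0).
have [|F2 [i2 [x1 r1]]] := @root_ext _ q; first by rewrite sq.
have {r1} e1 : x1 ^+ 2 - (i2 (i1 a) - i2 x0) * x1 + i2 d = 0.
  move: r1; rewrite /root /q !(rmorphB, rmorphD) /= !map_polyZ /= !map_polyXn.
  rewrite map_polyX map_polyC !rmorphB !hornerE => /eqP <-; ring.
exists F2, (i2 \o i1), (fun r => if r == o0 then i2 x0 else if r == o1 then x1
  else i2 (i1 a) - i2 x0 - x1) => /=.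
have {e0} e0 := congr1 i2 e0.
move: e0 e1; rewrite dE !(rmorphB, rmorphD, rmorphM, rmorphXn, rmorph0) /=.
move=> e0 e1; split; first by ring.
  by apply/eqP; rewrite -subr_eq0 -e1; apply/eqP; ring.
apply/eqP; rewrite -subr_eq0; apply/eqP.
have -> : 0 = i2 x0 * 0 - 0 :> F2 by rewrite mulr0 subr0.
rewrite -[X in _ = _ * X - _]e1 -[X in _ = _ - X]e0; ring.
Qed.

Section Diagonalize.
Variables (F : fieldType) (M : 'M[F]_3) (x : 'I_3 -> F).
Hypotheses (xI : injective x) (xT : polar 1%:M M = x o0 + x o1 + x o2)
  (xS : polar M 1%:M = x o0 * x o1 + x o0 * x o2 + x o1 * x o2)
  (xD : \det M = x o0 * x o1 * x o2).

(** The hypotheses say that x lists the roots of the characteristic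
    polynomial, so M - x_i has a left kernel. *)
Lemma eigenvector i : exists2 v : 'rV[F]_3, v != 0 & v *m M = x i *: v.
Proof.
have /eqP/det0P[v v0 vM] : \det (x i *: 1%:M + (-1) *: M) = 0.
  by rewrite det_pencil2 xT xS xD det1; elim/ord3P: i; ring.
exists v => //; move: vM; rewrite mulmxDr -!scalemxAr mulmx1 scaleN1r => /eqP.
by rewrite subr_eq0 => /eqP.
Qed.

(** Eigenvectors for distinct eigenvalues are independent: multiplying a
    relation between them by (M - x_j) (M - x_k) isolates the i-th term. *)
Lemma diagonalize3 : exists2 P : 'M[F]_3, P \in unitmx &
  P *m M = diag_mx (\row_i x i) *m P.
Proof.
have [v0 v00 v0M] := eigenvector o0; have [v1 v10 v1M] := eigenvector o1.
have [v2 v20 v2M] := eigenvector o2.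
pose v i := if i == o0 then v0 else if i == o1 then v1 else v2.
have vn0 i : v i != 0 by elim/ord3P: i.
have vM i : v i *m M = x i *: v i by elim/ord3P: i.
pose P := \matrix_i v i; exists P; last first.
  apply/row_matrixP => i; rewrite !row_mul rowK vM row_diag_mx mxE.
  by rewrite -scalemxAl -rowE rowK.
rewrite unitmxE unitfE; apply/negP => /det0P[w w0 wP].
(* The combination w of eigenvectors, multiplied by (M - a) (M - b). *)
have wx a b : (\row_i (w 0 i * ((x i - a) * (x i - b)))) *m P = 0.
  have -> : (\row_i (w 0 i * ((x i - a) * (x i - b)))) *m P = w *m P *m ((M - a%:M) *m (M - b%:M)).
    rewrite -mulmxA; apply/rowP => j; rewrite !mxE; apply: eq_bigr => i _.
    rewrite !mxE -mulrA; congr (_ * _).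
    transitivity ((v i *m ((M - a%:M) *m (M - b%:M))) 0 j).
      have e c : v i *m (M - c%:M) = (x i - c) *: v i.
        by rewrite mulmxBr vM mul_mx_scalar scalerBl.
      by rewrite mulmxA e -scalemxAl e scalerA !mxE.
    by rewrite !mxE; apply: eq_bigr => k _; rewrite !mxE.
  by rewrite wP mul0mx.
have wi i : w 0 i = 0.
  have [j [k [nij nik ljk]]] : exists j k, [/\ x i - x j != 0, x i - x k != 0 &
      forall l, l != i -> (x l - x j) * (x l - x k) = 0].
    elim/ord3P: i; [exists o1, o2|exists o0, o2|exists o0, o1];
      (split; rewrite ?subr_eq0 ?(inj_eq xI) //); elim/ord3P => // _;
      by rewrite subrr ?mulr0 ?mul0r.
  have := wx (x j) (x k).
  rewrite mulmx_sum_row (bigD1 i) //= big1 => [|l nl]; last first.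
    by rewrite mxE ljk // mulr0 scale0r.
  rewrite addr0 rowK mxE => /eqP; rewrite scaler_eq0 (negPf (vn0 i)) orbF.
  by rewrite !mulf_eq0 (negPf nij) (negPf nik) !orbF => /eqP.
by case/eqP: w0; apply/rowP => i; rewrite wi mxE.
Qed.
End Diagonalize.

(** * The generic triple is conjugate to a slice *)

Lemma disc4Z (R : comNzRingType) (d f1 f2 f4 f7 : R) :
  disc4 (d * f1) (d * f2) (d * f4) (d * f7) = d ^+ 4 * disc4 f1 f2 f4 f7.
Proof. rewrite /disc4; ring. Qed.

Lemma rmorph_disc4 (R S : comNzRingType) (f : {rmorphism R -> S}) f1 f2 f4 f7 :
  f (disc4 f1 f2 f4 f7) = disc4 (f f1) (f f2) (f f4) (f f7).
Proof.
by rewrite /disc4 !(rmorph_nat, rmorphXn, rmorphM, rmorphB, rmorphD) .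
Qed.

Lemma vdm_inj (R : idomainType) (x : 'I_3 -> R) : vdm x != 0 -> injective x.
Proof.
rewrite /vdm !mulf_eq0 !negb_or !subr_eq0 => /andP[/andP[n01 n02] n12].
elim/ord3P; elim/ord3P => // /eqP; rewrite ?(negPf n01) ?(negPf n02) ?(negPf n12) //;
by rewrite eq_sym ?(negPf n01) ?(negPf n02) ?(negPf n12).
Qed.

Lemma rmorph_inj (R : nzRingType) (S : nzRingType) (f : {rmorphism R -> S}) :
  (forall p, f p = 0 -> p = 0) -> injective f.
Proof.
by move=> f0 p q /eqP; rewrite -subr_eq0 -rmorphB => /eqP/f0/eqP; rewrite subr_eq0 => /eqP.
Qed.

(** The discriminant of det (t A + B), as a semi-invariant of the pair (A,
    B). *)
Definition disc2 (R : comNzRingType) (A B : 'M[R]_3) :=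
  disc4 (\det A) (polar A B) (polar B A) (\det B).

Lemma map_disc2 (R S : comNzRingType) (f : {rmorphism R -> S}) (A B : 'M[R]_3) :
  disc2 (map_mx f A) (map_mx f B) = f (disc2 A B).
Proof. by rewrite /disc2 !map_polar !det_map_mx rmorph_disc4. Qed.

Lemma disc2_lract (R : comNzRingType) (g g' A B : 'M[R]_3) :
  disc2 (g *m A *m g') (g *m B *m g') = (\det g * \det g') ^+ 4 * disc2 A B.
Proof.
have e (C : 'M_3) : \det (g *m C *m g') = \det g * \det g' * \det C.
  by rewrite !det_mulmx mulrAC.
by rewrite /disc2 !polar_lract !e disc4Z.
Qed.

Lemma disc2_slc (R : comNzRingType) (x : 'I_3 -> R) :
  disc2 1%:M (diag_mx (\row_i x i)) = vdm x ^+ 2.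
Proof.
have := hf_slc x 0; rewrite /hfseq /slc /= => -[_ e1 e2 _ e3 _ _ e4 _ _ _].
by rewrite /disc2 e1 e2 e3 e4 disc4E.
Qed.

(** Specialize to A1 = 1 and A2 = diag (0, 1, t), whose eigenvalues are
    distinct. *)
Lemma generic_disc_neq0 (K : idomainType) :
  disc2 (generic_matrix K o0) (generic_matrix K o1) != 0.
Proof.
pose x (i : 'I_3) : {poly K} := if i == o0 then 0 else if i == o1 then 1 else 'X.
apply/eqP => /(congr1 (ev (@polyC K) (slc x 1%:M))).
rewrite rmorph0 -map_disc2 !ev_generic disc2_slc.
apply/eqP; rewrite expf_neq0 // /vdm /x /= !mulf_neq0 //.
- by rewrite sub0r oppr_eq0 oner_neq0.
- by rewrite sub0r oppr_eq0 polyX_eq0.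
by rewrite -opprB oppr_eq0 -polyC1 polyXsubC_eq0.
Qed.

(** A1 is invertible over the fraction field, and A1^-1 A2 has distinct
    eigenvalues because the discriminant of the generic pencil is nonzero;
    diagonalizing it over a splitting field by P gives g = A1 P^-1 and g' =
    P. *)
Lemma generic_diag (K : idomainType) :
  exists (F : fieldType) (j : {rmorphism coord_ring K -> F}) (x : 'I_3 -> F)
    (g g' Y : 'M[F]_3),
  [/\ injective j, injective x, g \in unitmx, g' \in unitmx &
      forall r, map_mx j (generic_matrix K r) = lract g g' (slc x Y) r].
Proof.
pose j0 := @tofrac (coord_ring K).
pose A0 r := map_mx j0 (generic_matrix K r).
have uA0 : A0 o0 \in unitmx.
  by rewrite unitmxE unitfE det_map_mx tofrac_eq0 generic_det_neq0.
have [M0 M0E] : exists M, A0 o1 = A0 o0 *m M.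
  by exists (invmx (A0 o0) *m A0 o1); rewrite mulKVmx.
have [F [i [x [xT xS xD]]]] := split3 (polar 1%:M M0) (polar M0 1%:M) (\det M0).
pose j : {rmorphism coord_ring K -> F} := i \o j0.
have jI : injective j.
  by apply: rmorph_inj => p /eqP; rewrite fmorph_eq0 tofrac_eq0 => /eqP.
pose A r := map_mx j (generic_matrix K r); pose M := map_mx i M0.
have AE r : A r = map_mx i (A0 r) by rewrite /A map_mx_comp.
have A1E : A o1 = A o0 *m M by rewrite !AE M0E map_mxM.
have uA : A o0 \in unitmx by rewrite AE map_unitmx.
have xT' : polar 1%:M M = x o0 + x o1 + x o2 by rewrite -xT -map_polar map_mx1.
have xS' : polar M 1%:M = x o0 * x o1 + x o0 * x o2 + x o1 * x o2.
  by rewrite -xS -map_polar map_mx1.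
have xD' : \det M = x o0 * x o1 * x o2 by rewrite -xD -det_map_mx.
have xI : injective x.
  have : disc2 (A o0 *m 1%:M *m 1%:M) (A o0 *m M *m 1%:M) != 0.
    rewrite !mulmx1 -A1E map_disc2 -(rmorph0 j) (inj_eq jI).
    exact: generic_disc_neq0.
  rewrite disc2_lract mulf_eq0 => /norP[_ dM].
  apply: vdm_inj; apply: contraNneq dM => vx0.
  by rewrite /disc2 det1 xT' xS' xD' disc4E vx0 expr0n.
have [P uP PM] := diagonalize3 xI xT' xS' xD'.
exists F, j, x, (A o0 *m invmx P), P, (P *m invmx (A o0) *m A o2 *m invmx P).
split=> //; first by rewrite unitmx_mul uA unitmx_inv.
move=> r; rewrite -/(A r) /lract /slc; elim/ord3P: r => /=.
- by rewrite mulmx1 mulmxKV.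
- by rewrite -mulmxA -PM A1E mulmxA mulmxKV.
by rewrite -!mulmxA mulVmx // mulmx1 mulKmx // mulKVmx.
Qed.

Lemma hfseq_ext (R : comNzRingType) (A B : 'I_3 -> 'M[R]_3) :
  A =1 B -> hfseq A = hfseq B.
Proof. by move=> AB; rewrite /hfseq !AB. Qed.

Lemma qv_ext (R : comNzRingType) (A B : 'I_3 -> 'M[R]_3) : A =1 B -> qv A = qv B.
Proof. by move=> AB; rewrite /qv !AB. Qed.

Lemma ev_ext (K F : comNzRingType) (iota : {rmorphism K -> F}) A B :
  A =1 B -> ev iota A =1 ev iota B.
Proof.
move=> AB p; apply: mmap_ext => // k.
by rewrite /coordinates; congr (mxvec _ _ _); apply/matrixP => i l; rewrite !mxE AB.
Qed.

(** An identity between polynomial functions of three matrices which are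
    natural in the ring and semi-invariant of weight k need only be checked on
    the slice over fields: the integral generic triple embeds, in an extension
    of its fraction field, as (g, g') applied to a slice point, and it
    specializes to any triple over any ring. *)
Lemma slice_principle (Phi : forall R : comNzRingType, 'M[R]_3 -> 'M[R]_3 -> 'M[R]_3 -> R) k :
  (forall (R S : comNzRingType) (f : {rmorphism R -> S}) A B C,
     Phi S (map_mx f A) (map_mx f B) (map_mx f C) = f (Phi R A B C)) ->
  (forall (F : fieldType) (g g' A B C : 'M[F]_3),
     Phi F (g *m A *m g') (g *m B *m g') (g *m C *m g') =
       (\det g * \det g') ^+ k * Phi F A B C) ->
  (forall (F : fieldType) x Y, Phi F 1%:M (diag_mx (\row_i x i)) Y = 0) ->
  forall (R : comNzRingType) A B C, Phi R A B C = 0.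
Proof.
move=> nat equi sl R A B C.
pose At r : 'M[R]_3 := if r == o0 then A else if r == o1 then B else C.
pose G r := generic_matrix int r.
have -> : Phi R A B C = ev intr At (Phi _ (G o0) (G o1) (G o2)).
  by rewrite -nat !ev_generic.
suff -> : Phi _ (G o0) (G o1) (G o2) = 0 by rewrite rmorph0.
have [F [j [x [g [g' [Y [jI _ _ _ AE]]]]]]] := generic_diag int.
apply: jI; rewrite rmorph0 -nat /G !AE /lract /slc /= equi sl; exact: mulr0.
Qed.

(** * The relation between the generators *)

Definition tri (R : nmodType) (A B C : 'M[R]_3) (r : 'I_3) : 'M[R]_3 :=
  if r == o0 then A else if r == o1 then B else C.

Lemma triE (R : nmodType) (A : 'I_3 -> 'M[R]_3) : A =1 tri (A o0) (A o1) (A o2).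
Proof. by elim/ord3P. Qed.

Section Nat.
Variables (R S : comNzRingType) (f : {rmorphism R -> S}).

Lemma map_hfseq (A : 'I_3 -> 'M[R]_3) :
  hfseq (fun r => map_mx f (A r)) = map f (hfseq A).
Proof. by rewrite /hfseq map_hmx !map_polar map_mixed !det_map_mx. Qed.

Lemma nth_map0 (s : seq R) i : (map f s)`_i = f s`_i.
Proof.
have [lt|le] := ltnP i (size s); first by rewrite (nth_map 0).
by rewrite !nth_default ?size_map ?rmorph0.
Qed.

Lemma rmorph_A_of q s : f (A_of q s) = A_of (f q) (map f s).
Proof.
rewrite /A_of !nth_map0 /A_expr; ring.
Qed.

Lemma rmorph_Sval s : f (Sval s) = Sval (map f s).
Proof. by rewrite /Sval rmorphB rmorphD rmorph1 !rmorph_A_of rmorph0 rmorph1. Qed.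
End Nat.

Lemma map_qv (R S : comNzRingType) (f : {rmorphism R -> S}) (A : 'I_3 -> 'M[R]_3) :
  qv (fun r => map_mx f (A r)) = f (qv A).
Proof. exact: map_qmx. Qed.

(** The effect on h, f_1, ..., f_10 of the action of a pair with product of
    determinants d: h has weight 2 and each f has weight 1. *)
Definition scale_hf (R : comNzRingType) (d : R) (s : seq R) : seq R :=
  [:: d ^+ 2 * s`_0; d * s`_1; d * s`_2; d * s`_3; d * s`_4; d * s`_5; d * s`_6;
      d * s`_7; d * s`_8; d * s`_9; d * s`_10].

Lemma A_of_scale (R : comNzRingType) (d q : R) s :
  A_of (d ^+ 3 * q) (scale_hf d s) = d ^+ 6 * A_of q s.
Proof. rewrite /A_of /scale_hf /A_expr /=; ring. Qed.

Lemma Sval_scale (R : comNzRingType) (d : R) s :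
  Sval (scale_hf d s) = d ^+ 3 * Sval s.
Proof. rewrite !SvalE /scale_hf /=; ring. Qed.

Lemma hfseq_lract (R : comNzRingType) (g g' : 'M[R]_3) A :
  hfseq (lract g g' A) = scale_hf (\det g * \det g') (hfseq A).
Proof.
have e (a : R) : \det g * a * \det g' = \det g * \det g' * a by rewrite mulrAC.
by rewrite /hfseq /scale_hf /lract /= hmx_lract !polar_lract mixed_lract !det_mulmx !e.
Qed.

(** A is homogeneous of weight 6 for the grading by the powers of the
    determinant, so the slice principle applies. *)
Lemma A_relation (R : comNzRingType) (A : 'I_3 -> 'M[R]_3) : A_of (qv A) (hfseq A) = 0.
Proof.
rewrite (qv_ext (triE A)) (hfseq_ext (triE A)).
pose Phi (R : comNzRingType) (A B C : 'M[R]_3) := A_of (qv (tri A B C)) (hfseq (tri A B C)).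
apply: (@slice_principle Phi 6) => [R0 S f A0 B C|F g g' A0 B C|F x Y] /=.
- rewrite /Phi rmorph_A_of -map_hfseq -map_qv.
  by congr A_of.
- rewrite /Phi -A_of_scale -hfseq_lract -qv_lract.
  by congr A_of.
rewrite -[RHS](A_of_slc x Y) /Phi.
by congr A_of.
Qed.

Lemma qv_tr_sw (R : comNzRingType) (A : 'I_3 -> 'M[R]_3) : qv (swA A) = qv (trA A).
Proof. by rewrite /qv /trA qmx_tr_sw. Qed.

(** The difference of the two sides is a semi-invariant of weight 3, so
    [S_slc] suffices. *)
Lemma qv_tr (R : comNzRingType) (A : 'I_3 -> 'M[R]_3) :
  qv A + qv (trA A) = Sval (hfseq A).
Proof.
rewrite -qv_tr_sw; apply/eqP; rewrite -subr_eq0; apply/eqP.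
pose Phi (R : comNzRingType) (A B C : 'M[R]_3) :=
  qmx A B C + qmx C B A - Sval (hfseq (tri A B C)).
rewrite (hfseq_ext (triE A)).
apply: (@slice_principle Phi 3) => [R0 S f A0 B C|F g g' A0 B C|F x Y] /=.
- rewrite /Phi rmorphB rmorphD rmorph_Sval !map_qmx -map_hfseq.
  by congr (_ - Sval _).
- rewrite /Phi !qmx_lract mulrBr mulrDr -Sval_scale -hfseq_lract.
  by congr (_ - Sval _).
rewrite /Phi -(qmx_tr_sw 1%:M _ Y) -[X in _ - Sval X](hfseq_ext (triE (slc x Y))).
by rewrite trmx1 tr_diag_mx -S_slc subrr.
Qed.

(** Unlike the f's, which are permuted, h is not symmetric in A1 and A3; the
    correction is read off on the slice. *)
Lemma hmx_sw (R : comNzRingType) (A : 'I_3 -> 'M[R]_3) (s := hfseq A) :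
  hmx (A o2) (A o1) (A o0) = s`_0 - s`_3 * s`_8 + s`_4 * s`_6.
Proof.
rewrite /s; apply/eqP; rewrite -subr_eq0; apply/eqP.
pose Phi (R : comNzRingType) (A B C : 'M[R]_3) :=
  hmx C B A - (hmx A B C - polar A C * polar B C + polar B A * polar C A).
apply: (@slice_principle Phi 2) => [R0 S f A0 B C|F g g' A0 B C|F x Y] /=.
- by rewrite /Phi !map_hmx !map_polar !(rmorphB, rmorphD, rmorphM).
- rewrite /Phi !hmx_lract !polar_lract; ring.
have := h_sw_slc x Y; rewrite /Phi /hfseq /slc /= => ->; exact: subrr.
Qed.

(** * Univariate view of polynomials, and vanishing over an infinite field *)

Section HeadVariable.
Variables (K : comNzRingType) (n : nat).

Definition uni_var (i : 'I_n.+1) : {poly {mpoly K[n]}} :=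
  if unlift ord0 i is Some j then ('X_j)%:P else 'X.

(** {mpoly K[n.+1]} viewed as polynomials in the variable ord0 over the
    others; [shift] renames the other variables and [of_uni] is the inverse
    map. *)
Definition to_uni : {mpoly K[n.+1]} -> {poly {mpoly K[n]}} :=
  mmap (polyC \o @mpolyC n K) uni_var.
HB.instance Definition _ := GRing.RMorphism.copy to_uni
  (mmap (polyC \o @mpolyC n K) uni_var).

Definition shift : {mpoly K[n]} -> {mpoly K[n.+1]} :=
  mmap (@mpolyC n.+1 K) (fun j => 'X_(lift ord0 j)).
HB.instance Definition _ := GRing.RMorphism.copy shift
  (mmap (@mpolyC n.+1 K) (fun j => 'X_(lift ord0 j))).

Definition of_uni : {poly {mpoly K[n]}} -> {mpoly K[n.+1]} :=
  horner_eval 'X_ord0 \o map_poly shift.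
HB.instance Definition _ := GRing.RMorphism.copy of_uni
  (horner_eval 'X_ord0 \o map_poly shift).

Lemma to_uniC c : to_uni c%:MP = (c%:MP)%:P. Proof. exact: mmapC. Qed.
Lemma to_uniX0 : to_uni 'X_ord0 = 'X.
Proof. by rewrite /to_uni mmapX mmap1U /uni_var unlift_none. Qed.
Lemma to_uniXS j : to_uni 'X_(lift ord0 j) = ('X_j)%:P.
Proof. by rewrite /to_uni mmapX mmap1U /uni_var liftK. Qed.
Lemma shiftX j : shift 'X_j = 'X_(lift ord0 j).
Proof. by rewrite /shift mmapX mmap1U. Qed.
Lemma of_uniC c : of_uni c%:P = shift c.
Proof. by rewrite /of_uni /= /horner_eval map_polyC hornerC. Qed.
Lemma of_uniX : of_uni 'X = 'X_ord0.
Proof. by rewrite /of_uni /= /horner_eval map_polyX hornerX. Qed.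

Lemma to_uniK : cancel to_uni of_uni.
Proof.
move=> p; rewrite -[LHS]/((of_uni \o to_uni) p) -(rmorph_mmap (of_uni \o to_uni)).
rewrite -[RHS](rmorph_mmap idfun); apply: mmap_ext => [c|i] /=.
  by rewrite to_uniC of_uniC /shift mmapC.
case: (unliftP ord0 i) => [j|] ->; first by rewrite to_uniXS of_uniC shiftX.
by rewrite to_uniX0 of_uniX.
Qed.
End HeadVariable.

Section Infinite.
Variable K : fieldType.
Hypothesis infK : infinite_type K.

Lemma infinite_uniq n : exists2 s : seq K, uniq s & size s = n.
Proof.
elim: n => [|n [s us sn]]; first by exists [::].
have [x xs] : exists x, x \notin s.
  apply: NNPP => nex; apply: infK; exists s => x.
  by apply: contraT => xs; case: nex; exists x.
by exists (x :: s); rewrite /= ?xs ?sn.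
Qed.

Lemma poly_vanish (p : {poly K}) : (forall x, p.[x] = 0) -> p = 0.
Proof.
move=> p0; apply/eqP; apply: contraT => np.
have [s us ss] := infinite_uniq (size p).
have := max_poly_roots np _ us; rewrite ss ltnn; apply.
by apply/allP => x _; rewrite /root p0.
Qed.

(** Multiplying by X handles the excluded point. *)
Lemma poly_vanish0 (p : {poly K}) : (forall x, x != 0 -> p.[x] = 0) -> p = 0.
Proof.
move=> p0; have : 'X * p = 0.
  apply: poly_vanish => x; rewrite hornerM hornerX.
  by have [->|/p0 ->] := eqVneq x 0; rewrite ?mul0r ?mulr0.
by move/eqP; rewrite mulf_eq0 polyX_eq0 => /eqP.
Qed.

(** Induction on the number of variables, through the univariate case. *)
Lemma mpoly_vanish n (p : {mpoly K[n]}) : (forall v, p.@[v] = 0) -> p = 0.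
Proof.
elim: n p => [|n IHn] p p0.
  have m0 (m : 'X_{1..0}) : m = 0%MM by apply/mnmP => -[].
  have pE : p = (p@_0)%:MP.
    by apply/mpolyP => m; rewrite (m0 m) mcoeffC eqxx mulr1.
  by have := p0 (fun=> 0); rewrite pE mevalC => ->.
rewrite -[p]to_uniK; suff -> : to_uni p = 0 by rewrite rmorph0.
apply/polyP => i; rewrite coef0; apply: IHn => v.
suff /(congr1 (fun q : {poly K} => q`_i)) : map_poly (meval v) (to_uni p) = 0.
  by rewrite coef_map coef0.
apply: poly_vanish => a; pose w i := if unlift ord0 i is Some j then v j else a.
rewrite -(p0 w) -[LHS]/((horner_eval a \o map_poly (meval v) \o @to_uni K n) p).
rewrite -rmorph_mmap; apply: mmap_ext => [c|k] /=.
  by rewrite to_uniC map_polyC /horner_eval hornerC /= mevalC.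
rewrite /w; case: (unliftP ord0 k) => [j|] ->.
  by rewrite to_uniXS map_polyC /horner_eval hornerC /= mevalXU.
by rewrite to_uniX0 map_polyX /horner_eval hornerX.
Qed.
End Infinite.

(** * Invariants of SL are semi-invariants of GL *)

Lemma mmap1_scale (R : comNzRingType) n (v : 'I_n -> R) (s : R) m :
  mmap1 (fun i => s * v i) m = s ^+ mdeg m * mmap1 v m.
Proof.
rewrite /mmap1 (eq_bigr (fun i => s ^+ m i * v i ^+ m i)) => [|i _]; last exact: exprMn.
by rewrite big_split /= prodrXr mdegE.
Qed.

Lemma homog_eval (K F : comNzRingType) (iota : {rmorphism K -> F}) n d
    (p : {mpoly K[n]}) (v : 'I_n -> F) s :
  p \is d.-homog -> mmap iota (fun i => s * v i) p = s ^+ d * mmap iota v p.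
Proof.
move=> /dhomogP hp; rewrite /mmap mulr_sumr; apply: eq_big_seq => m mp.
by rewrite mmap1_scale (hp m mp) mulrCA.
Qed.

(** Along the ray X v, the coefficient of X ^+ d is the value at v of the
    homogeneous component of degree d. This is how invariance passes to
    homogeneous components. *)
Lemma coef_ray (K : comNzRingType) n (p : {mpoly K[n]}) (v : 'I_n -> K) d :
  (mmap (@polyC K) (fun i => 'X * (v i)%:P) p)`_d = (pihomog mdeg d p).@[v].
Proof.
rewrite pihomogE /mmap coef_sum rmorph_sum /= [RHS]big_mkcond.
apply: eq_bigr => m _; rewrite mmap1_scale coefCM.
have -> : mmap1 (fun i => (v i)%:P) m = (mmap1 v m)%:P.
  by rewrite /mmap1 rmorph_prod; apply: eq_bigr => i _; rewrite rmorphXn.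
rewrite coefMC coefXn mevalZ mevalX eq_sym.
by case: eqVneq => _ /=; rewrite ?mul1r // mul0r mulr0.
Qed.

Section Invariants.
Variable K : fieldType.
Hypothesis infK : infinite_type K.
Implicit Types (p : coord_ring K) (A : 'I_3 -> 'M[K]_3).

(** Evaluation at triples with entries in K itself: this is the evaluation in
    the definition of invariance. *)
Definition eid := ev (idfun : {rmorphism K -> K}).

Lemma eidE A p : eid A p = p.@[coordinates A].
Proof. by []. Qed.

(** Homogeneity as a property of the associated function. Over an infinite
    field it carries the same information as homogeneity of the polynomial,
    and it is stable under substitutions. *)
Definition homog_fun d p :=
  forall s A, eid (fun r => s *: A r) p = s ^+ d * eid A p.

Lemma coordinates_scale (R : comNzRingType) (s : R) (B : 'I_3 -> 'M[R]_3) k :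
  coordinates (fun r => s *: B r) k = s * coordinates B k.
Proof.
case/mxvec_indexP: k => r k; case/mxvec_indexP: k => i j.
by rewrite /coordinates !mxvecE !mxE !mxvecE mxE.
Qed.

Lemma ev_homog (F : comNzRingType) (iota : {rmorphism K -> F}) d p s B :
  p \is d.-homog -> ev iota (fun r => s *: B r) p = s ^+ d * ev iota B p.
Proof.
move=> hp; rewrite /ev -homog_eval //; apply: mmap_ext => // k.
exact: coordinates_scale.
Qed.

Lemma SL_act_coord g g' A s :
  coordinates (SL_act g g' (fun r => s *: A r)) =1
  coordinates (fun r => s *: SL_act g g' A r).
Proof.
move=> k; rewrite /coordinates; congr (mxvec _ _ _); apply/matrixP => i j.
by rewrite !mxE /SL_act -scalemxAr -scalemxAl.
Qed.

(** Both sides are the coefficients of a polynomial in the ray parameter s,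
    and these polynomials agree at every s because p is invariant. *)
Lemma invariant_pihomog p d : SL_invariant p -> SL_invariant (pihomog mdeg d p).
Proof.
move=> ip g g' dg dg' A; rewrite -!coef_ray.
pose ray B := mmap (@polyC K) (fun i => 'X * (coordinates B i)%:P) p.
suff : ray (SL_act g g' A) = ray A by rewrite /ray => ->.
apply/eqP; rewrite -subr_eq0; apply/eqP; apply: poly_vanish => // s.
rewrite hornerD hornerN.
have e B : (ray B).[s] =
    p.@[coordinates (fun r => s *: B r)].
  rewrite -[LHS]/(horner_eval s _) /ray mmap_comp; apply: mmap_ext => [c|i] /=.
    by rewrite /horner_eval hornerC.
  by rewrite /horner_eval hornerM hornerX hornerC coordinates_scale.
rewrite !e -(meval_eq _ (SL_act_coord g g' A s)) ip // subrr //.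
Qed.

Lemma mpoly_coord_vanish p : (forall A, eid A p = 0) -> p = 0.
Proof.
move=> p0; apply: mpoly_vanish => // v.
pose A r : 'M[K]_3 := \matrix_(i, j) v (mxvec_index r (mxvec_index i j)).
rewrite -(p0 A) eidE; apply: meval_eq => k.
case/mxvec_indexP: k => r k; case/mxvec_indexP: k => i j.
by rewrite /coordinates mxvecE mxE mxvecE mxE.
Qed.

(** A matrix of given determinant: diag (s, 1, 1). *)
Definition D1 (R : comNzRingType) (s : R) : 'M[R]_3 :=
  diag_mx (\row_i if i == o0 then s else 1).

Lemma det_D1 (R : comNzRingType) (s : R) : \det (D1 s) = s.
Proof. by rewrite det_diag big_ord_recl big1 ?mulr1 => [|i _]; rewrite !mxE. Qed.

Lemma D1_invl (s : K) : s != 0 -> D1 s^-1 *m D1 s = 1%:M.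
Proof.
move=> s0; rewrite mul_diag_mx; apply/matrixP => i j; rewrite !mxE.
by elim/ord3P: i; elim/ord3P: j; rewrite /= ?mulr0 ?mulr1 ?mulVf.
Qed.

Lemma invariant_l p g A : SL_invariant p -> \det g = 1 ->
  eid (fun r => g *m A r) p = eid A p.
Proof.
move=> ip dg; rewrite [RHS]/eid -[RHS](ip g 1%:M) ?det1 //.
by apply: ev_ext => r; rewrite /SL_act invmx1 mulmx1.
Qed.

(** For invertible g the value p (g A) depends only on det g, since g and diag
    (det g, 1, 1) differ by an element of SL_3: it is c (det g) for a
    polynomial c. Taking g scalar gives c (s ^+ 3) = s ^+ d p (A), so c is a
    monomial. *)
Lemma left_semi p d : SL_invariant p ->
  homog_fun d p -> p != 0 ->
  exists2 k, d = (3 * k)%N &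
    forall g A, g \in unitmx -> eid (fun r => g *m A r) p = \det g ^+ k * eid A p.
Proof.
move=> ip hp p0.
pose c A := ev (@polyC K) (fun r => D1 'X *m map_mx polyC (A r)) p.
have cE A s : (c A).[s] = eid (fun r => D1 s *m A r) p.
  rewrite -[LHS]/(horner_eval s _) /c /ev mmap_comp; apply: mmap_ext => [a|k] /=.
    by rewrite /horner_eval hornerC.
  rewrite /coordinates; case/mxvec_indexP: k => r k; case/mxvec_indexP: k => i j.
  rewrite !mxvecE !mxE !mxvecE /D1 !mul_diag_mx !mxE /horner_eval hornerM hornerC.
  by case: ifP => _; rewrite ?hornerX ?hornerC.
have gD A g : g \in unitmx -> eid (fun r => g *m A r) p = (c A).[\det g].
  move=> ug; have dg : \det g != 0 by rewrite -unitfE -unitmxE.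
  rewrite cE -[RHS](@invariant_l p (g *m D1 (\det g)^-1)) //; last first.
    by rewrite det_mulmx det_D1 divff.
  by apply: ev_ext => r; rewrite -mulmxA [D1 _ *m (_ *m _)]mulmxA D1_invl // mul1mx.
(* On scalar matrices s%:M, of determinant s ^+ 3, p scales by s ^+ d. *)
have c3 A : c A \Po 'X^3 = (eid A p)%:P * 'X^d.
  apply/eqP; rewrite -subr_eq0; apply/eqP; apply: poly_vanish0 => // s s0.
  rewrite !hornerE horner_comp !hornerE -[3%N]/(3%N).
  have <- : \det (s%:M : 'M[K]_3) = s ^+ 3 by rewrite det_scalar.
  rewrite -gD ?unitmxE ?det_scalar ?unitfE ?expf_neq0 //.
  rewrite /eid (@ev_ext K K _ _ (fun r => s *: A r)) => [|r]; last by rewrite mul_scalar_mx.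
  by rewrite [X in X - _]hp mulrC subrr.
have [A nA] : exists A, eid A p != 0.
  apply: NNPP => nex; case/eqP: p0; apply: mpoly_coord_vanish => A.
  by apply/eqP; apply: contraT => nA; case: nex; exists A.
have d3 : (3 %| d)%N.
  have := congr1 (fun q : {poly K} => q`_d) (c3 A).
  rewrite coef_comp_poly_Xn // coefCM coefXn eqxx mulr1; case: ifP => // _ e0.
  by rewrite -e0 eqxx in nA.
exists (d %/ 3)%N; first by rewrite mulnC divnK.
have cX B : c B = (eid B p)%:P * 'X^(d %/ 3).
  apply/polyP => i; have := congr1 (fun q : {poly K} => q`_(i * 3)) (c3 B).
  rewrite coef_comp_poly_Xn // dvdn_mull // mulnK // => ->.
  by rewrite !coefCM !coefXn -{1}(divnK d3) eqn_pmul2r.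
by move=> g B ug; rewrite gD // cX !hornerE mulrC.
Qed.
End Invariants.

Section Subst.
Variables (K F : comNzRingType) (iota : {rmorphism K -> F}).

(** Endomorphisms of the coordinate ring coming from polynomial maps of the
    space of triples to itself. *)
Definition subst (R : comNzRingType) (B : 'I_3 -> 'M[coord_ring R]_3) :
  coord_ring R -> coord_ring R := ev (@mpolyC _ R) B.
HB.instance Definition _ (R : comNzRingType) B :=
  GRing.RMorphism.copy (@subst R B) (ev (@mpolyC _ R) B).

(** Transposition of the triple, on polynomial functions; [swp] exchanges the
    first and third matrices. *)
Definition trp (R : comNzRingType) := subst (fun r => (generic_matrix R r)^T).
Definition swp (R : comNzRingType) := subst (swA (generic_matrix R)).
HB.instance Definition _ (R : comNzRingType) :=
  GRing.RMorphism.copy (@trp R) (subst (fun r => (generic_matrix R r)^T)).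
HB.instance Definition _ (R : comNzRingType) :=
  GRing.RMorphism.copy (@swp R) (subst (swA (generic_matrix R))).

Lemma ev_subst A B (p : coord_ring K) :
  ev iota A (subst B p) = ev iota (fun r => map_mx (ev iota A) (B r)) p.
Proof.
rewrite /subst {2}/ev mmap_comp; apply: mmap_ext => [c|k] /=.
  by rewrite evC.
case/mxvec_indexP: k => r k; case/mxvec_indexP: k => i j.
by rewrite /coordinates !mxvecE !mxE !mxvecE mxE.
Qed.

Lemma ev_trp A (p : coord_ring K) : ev iota A (trp p) = ev iota (trA A) p.
Proof.
by rewrite /trp ev_subst; apply: ev_ext => r; rewrite -map_trmx ev_generic.
Qed.

Lemma ev_swp A (p : coord_ring K) : ev iota A (swp p) = ev iota (swA A) p.
Proof.
by rewrite /swp ev_subst; apply: ev_ext => r; rewrite /swA ev_generic.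
Qed.
End Subst.

Section Semi.
Variable K : fieldType.
Hypothesis infK : infinite_type K.
Implicit Types (p : coord_ring K).

Lemma trp_invariant p : SL_invariant p -> SL_invariant (trp p).
Proof.
move=> ip g g' dg dg' A; change (eid (SL_act g g' A) (trp p) = eid A (trp p)); rewrite /eid !ev_trp.
have ug' : g' \in unitmx by rewrite unitmxE dg' unitr1.
rewrite -[RHS](ip (invmx g'^T) (invmx g^T)) ?det_inv ?det_tr ?dg ?dg' ?invr1 //.
apply: ev_ext => r; rewrite /trA /SL_act !trmx_mul trmx_inv invmxK.
by rewrite mulmxA.
Qed.

Lemma swp_invariant p : SL_invariant p -> SL_invariant (swp p).
Proof.
move=> ip g g' dg dg' A; change (eid (SL_act g g' A) (swp p) = eid A (swp p)); rewrite /eid !ev_swp.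
by rewrite -[RHS](ip g g').
Qed.

(** The right action is the left action composed with transposition. Both
    weights are a third of the degree, hence equal. *)
Lemma semi_point p d : SL_invariant p -> homog_fun d p ->
  exists k, forall g g' (A : 'I_3 -> 'M[K]_3), g \in unitmx -> g' \in unitmx ->
    eid (lract g g' A) p = (\det g * \det g') ^+ k * eid A p.
Proof.
move=> ip hp; have [->|p0] := eqVneq p 0.
  by exists 0 => *; rewrite /eid !rmorph0 mulr0.
have [k dk lk] := left_semi infK ip hp p0.
have hs' : homog_fun d (trp p).
  move=> s A; rewrite /eid !ev_trp -[RHS]hp; apply: ev_ext => r.
  by rewrite /trA linearZ.
have trpp0 : trp p != 0.
  apply: contra_neq p0 => tp0; apply: mpoly_coord_vanish => // A.
  have := ev_trp idfun (trA A) p; rewrite tp0 rmorph0 => /esym <-.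
  by apply: ev_ext => r; rewrite /trA trmxK.
have [k' dk' rk] := left_semi infK (trp_invariant ip) hs' trpp0.
have kk : k' = k by apply/eqP; rewrite -(eqn_pmul2l (isT : 0 < 3)%N) -dk -dk'.
exists k => g g' A ug ug'.
have -> : eid (lract g g' A) p = eid (fun r => g *m (A r *m g')) p.
  by apply: ev_ext => r; rewrite /lract mulmxA.
rewrite lk // exprMn -mulrA; congr (_ * _).
have -> : eid (fun r => A r *m g') p = eid (fun r => g'^T *m (trA A) r) (trp p).
  by rewrite /eid ev_trp; apply: ev_ext => r; rewrite /trA trmx_mul !trmxK.
rewrite rk ?unitmx_tr // kk det_tr; congr (_ * _).
by rewrite /eid ev_trp; apply: ev_ext => r; rewrite /trA trmxK.
Qed.

Lemma swp_homog d p : homog_fun d p -> homog_fun d (swp p).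
Proof. by move=> hp s A; rewrite /eid !ev_swp -[RHS]hp; apply: ev_ext. Qed.

Lemma pihomog_homog d p : homog_fun d (pihomog mdeg d p).
Proof. by move=> s A; apply: ev_homog; apply: pihomogP. Qed.
End Semi.

(** * Semi-invariance over every algebra *)

Lemma ev_map (K F S : comNzRingType) (iota : {rmorphism K -> F})
    (f : {rmorphism F -> S}) A p :
  f (ev iota A p) = ev (f \o iota) (fun r => map_mx f (A r)) p.
Proof.
rewrite {1}/ev mmap_comp; apply: mmap_ext => // k /=.
case/mxvec_indexP: k => r k; case/mxvec_indexP: k => i j.
by rewrite /coordinates !mxvecE !mxE !mxvecE mxE.
Qed.

Lemma ev_extl (K F : comNzRingType) (i1 i2 : {rmorphism K -> F}) A :
  i1 =1 i2 -> ev i1 A =1 ev i2 A.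
Proof. by move=> e p; apply: mmap_ext. Qed.

Lemma ev_over (K F S : comNzRingType) (iota : {rmorphism K -> F})
    (iota' : {rmorphism K -> S}) (f : {rmorphism F -> S}) A p :
  (forall a, f (iota a) = iota' a) ->
  f (ev iota A p) = ev iota' (fun r => map_mx f (A r)) p.
Proof. by move=> e; rewrite ev_map; apply: mmap_ext. Qed.

Section Universal.
Variables (K : comNzRingType) (m : nat).
(** Generic matrices in any number, used as universal data for identities
    involving group elements as well as the triple. *)
Definition gen (r : 'I_m) : 'M[{mpoly K[m * (3 * 3)]}]_3 :=
  \matrix_(i, j) 'X_(mxvec_index r (mxvec_index i j)).

Variables (F : comNzRingType) (iota : {rmorphism K -> F}) (A : 'I_m -> 'M[F]_3).
Definition gcoord (k : 'I_(m * (3 * 3))) : F := mxvec (\matrix_r mxvec (A r)) 0 k.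
Definition gev : {mpoly K[m * (3 * 3)]} -> F := mmap iota gcoord.
HB.instance Definition _ := GRing.RMorphism.copy gev (mmap iota gcoord).

Lemma gev_gen r : map_mx gev (gen r) = A r.
Proof.
by apply/matrixP => i j; rewrite !mxE /gev mmapX mmap1U /gcoord !mxvecE !mxE mxvecE.
Qed.

Lemma gevC c : gev c%:MP = iota c. Proof. exact: mmapC. Qed.
End Universal.

Section Semi.
Variable K : fieldType.
Hypothesis infK : infinite_type K.
Implicit Types (p : coord_ring K).

(** The identity is a polynomial identity in five generic matrices. It holds
    whenever both group elements are invertible, so its product with the two
    determinants vanishes at all points over the infinite field K, hence
    identically; the determinants are not zero divisors, and the identity
    specializes to all K-algebras. *)
Lemma semi_alg p d : SL_invariant p -> homog_fun d p ->
  exists k, forall (F : comNzRingType) (iota : {rmorphism K -> F}) g g' A,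
    ev iota (lract g g' A) p = (\det g * \det g') ^+ k * ev iota A p.
Proof.
move=> ip hp; have [k kP] := semi_point infK ip hp; exists k => F iota g g' A.
pose U := {mpoly K[5 * (3 * 3)]}.
pose i3 := inord 3 : 'I_5; pose i4 := inord 4 : 'I_5.
pose w (r : 'I_3) := inord r : 'I_5.
pose c : {rmorphism K -> U} := @mpolyC _ K.
have det0 r : \det (gen K (r : 'I_5)) != 0.
  apply/eqP => /(congr1 (gev (idfun : {rmorphism K -> K}) (fun=> 1%:M))).
  by rewrite -det_map_mx gev_gen det1 rmorph0 => /eqP; rewrite oner_eq0.
have [P gevP] : exists P : U, forall (S : comNzRingType) (j : {rmorphism K -> S})
    (B : 'I_5 -> 'M[S]_3), gev j B P = ev j (lract (B i3) (B i4) (B \o w)) p -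
      (\det (B i3) * \det (B i4)) ^+ k * ev j (B \o w) p.
  exists (ev c (lract (gen K i3) (gen K i4) (@gen K 5 \o w)) p -
    (\det (gen K i3) * \det (gen K i4)) ^+ k * ev c (@gen K 5 \o w) p).
  move=> S j B.
  have e1 Q : gev j B (ev c Q p) = ev j (fun r => map_mx (gev j B) (Q r)) p.
    apply: etrans (ev_map c (gev j B) Q p) _; apply: ev_extl => a; exact: gevC.
  have e2 r : gev j B (\det (gen K r)) = \det (B r) by rewrite -det_map_mx gev_gen.
  apply: etrans (rmorphB (gev j B) _ _) _; congr (_ - _).
    apply: etrans (e1 _) _; apply: ev_ext => r.
    by rewrite /lract !map_mxM /= !gev_gen.
  apply: etrans (rmorphM (gev j B) _ _) _; congr (_ * _).
    apply: etrans (rmorphXn (gev j B) _ _) _; congr (_ ^+ k).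
    apply: etrans (rmorphM (gev j B) _ _) _; congr (_ * _); exact: e2.
  by apply: etrans (e1 _) _; apply: ev_ext => r; rewrite /= gev_gen.
(* Semi-invariance gives the vanishing of P at points where both determinants
   are nonzero; multiplying by them takes care of the others. *)
have P0 : P = 0.
  have : \det (gen K i3) * \det (gen K i4) * P = 0.
    apply: mpoly_vanish => // v.
    pose B r : 'M[K]_3 := \matrix_(i, j) v (mxvec_index r (mxvec_index i j)).
    have -> (Q : U) : Q.@[v] = gev idfun B Q.
      apply: mmap_ext => // x; case/mxvec_indexP: x => r x.
      case/mxvec_indexP: x => i j.
      by rewrite /gcoord mxvecE mxE mxvecE mxE.
    apply: etrans (rmorphM (gev idfun B) _ _) _.
    have e : gev idfun B (\det (gen K i3) * \det (gen K i4)) = \det (B i3) * \det (B i4).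
      apply: etrans (rmorphM (gev idfun B) _ _) _.
      by congr (_ * _); rewrite -det_map_mx gev_gen.
    apply: etrans (congr2 *%R e (gevP _ idfun B)) _.
    have [->|d3] := eqVneq (\det (B i3)) 0; first by rewrite !mul0r.
    have [->|d4] := eqVneq (\det (B i4)) 0; first by rewrite mulr0 mul0r.
    have := kP (B i3) (B i4) (B \o w); rewrite /eid => ->; rewrite ?unitmxE ?unitfE //.
    by rewrite subrr mulr0.
  by move/eqP; rewrite !mulf_eq0 !(negPf (det0 _)) => /eqP.
pose B (r : 'I_5) := if r == i3 then g else if r == i4 then g' else A (inord r).
have Bw : B \o w =1 A.
  move=> r; have rw : val (w r) = r by rewrite /w /= inordK // (leq_trans (ltn_ord r)).
  rewrite /B /= -!val_eqE /= !inordK // ?(leq_trans (ltn_ord r)) //.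
  by rewrite !ltn_eqF ?(leq_trans (ltn_ord r)) // inord_val.
have B3 : B i3 = g by rewrite /B eqxx.
have B4 : B i4 = g' by rewrite /B -!val_eqE /= !inordK.
have := gevP F iota B; rewrite P0 rmorph0 B3 B4 => /esym/eqP.
rewrite subr_eq0 (ev_ext _ Bw) => /eqP <-.
by apply: ev_ext => r; rewrite /lract Bw.
Qed.
End Semi.

(** * The ring of functions of the slice *)

Lemma mmap_closed (K F : comNzRingType) (iota : {rmorphism K -> F}) n (v : 'I_n -> F)
    (P : F -> Prop) :
  (forall c, P (iota c)) -> (forall i, P (v i)) ->
  (forall a b, P a -> P b -> P (a + b)) -> (forall a b, P a -> P b -> P (a * b)) ->
  forall p, P (mmap iota v p).
Proof.
move=> Pc Pv PD PM p.
have P0 : P 0 by rewrite -(rmorph0 iota).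
have P1 : P 1 by rewrite -(rmorph1 iota).
have PX a k : P a -> P (a ^+ k).
  by move=> Pa; elim: k => [|k IH]; rewrite ?expr0 // exprS; apply: PM.
rewrite /mmap; apply: (big_ind P P0 PD) => m _; apply: (PM) => //.
by rewrite /mmap1; apply: (big_ind P P1 PM) => i _; apply: PX.
Qed.

Notation slring K := {mpoly {mpoly K[7]}[3]}.

Section SliceRing.
Variables (K F : comNzRingType) (iota : {rmorphism K -> F}).
Variables (x : 'I_3 -> F) (Y : 'M[F]_3).
Let s := hfseq (slc x Y).
Let q := qv (slc x Y).

(** The seven of the values h, f_1, ..., f_10 that are not symmetric functions
    of x on the slice. *)
Definition cv (t : seq F) (i : 'I_7) : F :=
  [:: t`_3; t`_5; t`_8; t`_6; t`_9; t`_0; t`_10]`_i.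

(** Polynomials in x whose coefficients are polynomials in the seven other
    values. Keeping these values as variables separates the symmetric group
    action on x from the invariants, which it fixes. *)
Definition sev (c : 'I_7 -> F) (y : 'I_3 -> F) : slring K -> F := mmap (mmap iota c) y.
HB.instance Definition _ c y := GRing.RMorphism.copy (sev c y) (mmap (mmap iota c) y).

Lemma sevC c y a : sev c y a%:MP%:MP = iota a.
Proof. by rewrite /sev mmapC /= mmapC. Qed.
Lemma sevX c y i : sev c y 'X_i = y i.
Proof. by rewrite /sev mmapX mmap1U. Qed.
Lemma sevc c y i : sev c y ('X_i)%:MP = c i.
Proof. by rewrite /sev mmapC /= mmapX mmap1U. Qed.

(** The eleven values on the slice, as elements of [slring]. *)
Definition sgen : seq (slring K) :=
  let X i : slring K := 'X_i in let c k (lt : (k < 7)%N) : slring K := ('X_(Ordinal lt))%:MP in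
  [:: @c 5 isT; 1; X o0 + X o1 + X o2; @c 0%N isT;
      X o0 * X o1 + X o0 * X o2 + X o1 * X o2; @c 1%N isT; @c 3 isT;
      X o0 * X o1 * X o2; @c 2 isT; @c 4 isT; @c 6 isT].

Local Notation phi := (sev (cv s) x).

Lemma map_sgen : map phi sgen = s.
Proof.
have [e1 e2 e4 e7] : [/\ s`_1 = 1, s`_2 = x o0 + x o1 + x o2,
    s`_4 = x o0 * x o1 + x o0 * x o2 + x o1 * x o2 & s`_7 = x o0 * x o1 * x o2].
  by rewrite /s hf_slc.
transitivity [:: s`_0; s`_1; s`_2; s`_3; s`_4; s`_5; s`_6; s`_7; s`_8; s`_9; s`_10].
  by rewrite e1 e2 e4 e7 /sgen /= !(rmorphD, rmorphM, rmorph1) /= !sevX !sevc.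
by [].
Qed.

(** mem0 is the ring generated by x and the values of h and the f's; mem1 =
    mem0 + mem0 q is a ring because q is a root of A; smem consists of the
    elements that fall into mem1 after multiplication by a power of the
    Vandermonde determinant of x. *)
Definition mem0 w := exists a, w = phi a.
Lemma mem0D w w' : mem0 w -> mem0 w' -> mem0 (w + w').
Proof. by move=> [a ->] [b ->]; exists (a + b); rewrite rmorphD. Qed.
Lemma mem0M w w' : mem0 w -> mem0 w' -> mem0 (w * w').
Proof. by move=> [a ->] [b ->]; exists (a * b); rewrite rmorphM. Qed.
Lemma mem0N w : mem0 w -> mem0 (- w).
Proof. by move=> [a ->]; exists (- a); rewrite rmorphN. Qed.
Lemma mem0X w k : mem0 w -> mem0 (w ^+ k).
Proof. by move=> [a ->]; exists (a ^+ k); rewrite rmorphXn. Qed.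
Lemma mem0C a : mem0 (iota a).
Proof. by exists a%:MP%:MP; rewrite sevC. Qed.
Lemma mem01 : mem0 1. Proof. by rewrite -(rmorph1 iota); apply: mem0C. Qed.
Lemma mem00 : mem0 0. Proof. by rewrite -(rmorph0 iota); apply: mem0C. Qed.
Lemma mem0x i : mem0 (x i). Proof. by exists ('X_i); rewrite sevX. Qed.
Lemma mem0S : mem0 (Sval s).
Proof. by exists (Sval sgen); rewrite rmorph_Sval map_sgen. Qed.
Lemma mem0T : mem0 (A_of 0 s).
Proof.
exists (A_of 0 sgen).
by have := rmorph_A_of phi 0 sgen; rewrite rmorph0 map_sgen => ->.
Qed.
Lemma mem0vdm : mem0 (vdm x).
Proof. by rewrite /vdm; do ?[apply: mem0D | apply: mem0N| apply: mem0M | apply: mem0x]. Qed.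

Definition mem1 w := exists2 ab, mem0 ab.1 /\ mem0 ab.2 & w = ab.1 + ab.2 * q.

Lemma mem1_0 w : mem0 w -> mem1 w.
Proof. by exists (w, 0); rewrite ?mul0r ?addr0 //; split => //; apply: mem00. Qed.
Lemma mem1D w w' : mem1 w -> mem1 w' -> mem1 (w + w').
Proof.
move=> [[a b] /= [? ?] ->] [[a' b'] /= [? ?] ->]; exists (a + a', b + b') => /=; last by ring.
by split; apply: mem0D.
Qed.
(** Reduce q ^+ 2 by means of A. *)
Lemma mem1M w w' : mem1 w -> mem1 w' -> mem1 (w * w').
Proof.
move=> [[a b] /= [? ?] ->] [[a' b'] /= [? ?] ->].
exists (a * a' - b * b' * A_of 0 s, a * b' + a' * b + b * b' * Sval s) => /=.
  have ? := mem0S; have ? := mem0T.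
  by split; do ?[assumption|apply: mem0D|apply: mem0M|apply: mem0N].
have := A_of_slc x Y; rewrite A_ofE -/s -/q => e.
apply/eqP; rewrite -subr_eq0 -[X in _ == X](mulr0 (b * b')) -[X in _ == _ * X]e.
by apply/eqP; ring.
Qed.
Lemma mem1q : mem1 q.
Proof. by exists (0, 1); rewrite ?mul1r ?add0r //; split; [apply: mem00|apply: mem01]. Qed.

Definition smem w := exists N, mem1 (vdm x ^+ N * w).

Lemma smem_mem1 w : mem1 w -> smem w.
Proof. by exists 0; rewrite mul1r. Qed.
Lemma smem_mem0 w : mem0 w -> smem w. Proof. by move=> /mem1_0/smem_mem1. Qed.
Let vdmX N : mem1 (vdm x ^+ N). Proof. by apply: mem1_0; apply: mem0X; apply: mem0vdm. Qed.
Lemma smemD w w' : smem w -> smem w' -> smem (w + w').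
Proof.
move=> [N h] [N' h']; exists (N + N')%N.
have -> : vdm x ^+ (N + N') * (w + w') =
  vdm x ^+ N' * (vdm x ^+ N * w) + vdm x ^+ N * (vdm x ^+ N' * w').
  by rewrite exprD; ring.
by apply: mem1D; apply: mem1M.
Qed.
Lemma smemM w w' : smem w -> smem w' -> smem (w * w').
Proof.
move=> [N h] [N' h']; exists (N + N')%N.
have -> : vdm x ^+ (N + N') * (w * w') = (vdm x ^+ N * w) * (vdm x ^+ N' * w').
  by rewrite exprD; ring.
exact: mem1M.
Qed.
Lemma smemN w : smem w -> smem (- w).
Proof.
by move=> h; rewrite -mulN1r; apply: smemM => //; apply: smem_mem0; apply: mem0N; apply: mem01.
Qed.
Lemma smemX w k : smem w -> smem (w ^+ k).
Proof.
move=> h; elim: k => [|k IH]; first by rewrite expr0; apply: smem_mem0; apply: mem01.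
by rewrite exprS; apply: smemM.
Qed.
Lemma smem_vdm w : smem (vdm x * w) -> smem w.
Proof. by move=> [N h]; exists N.+1; rewrite exprSr -mulrA. Qed.

Lemma smem_x i : smem (x i). Proof. by apply: smem_mem0; apply: mem0x. Qed.
Lemma smem_s i : smem s`_i.
Proof. by apply: smem_mem0; exists sgen`_i; rewrite -{1}map_sgen nth_map0. Qed.
Let y i := Y i i.
Let z0 := Y o1 o2 * Y o2 o1. Let z1 := Y o0 o2 * Y o2 o0. Let z2 := Y o0 o1 * Y o1 o0.
Let u := Y o0 o1 * Y o1 o2 * Y o2 o0. Let v := Y o0 o2 * Y o2 o1 * Y o1 o0.

Ltac smemtac := do ?[assumption | exact: smem_x | exact: smem_s | apply: smemD | apply: smemM
  | apply: smemN | apply: smemX].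

Let hs := hf_slc x Y.

(** The values f_3, f_5, f_8 are linear in the diagonal of Y; the system is
    solved by Lagrange interpolation at the x_i, with the Vandermonde
    determinant as denominator. *)
Lemma smem_y i : smem (y i).
Proof.
apply: smem_vdm.
have [e3 e5 e8] : [/\ s`_3 = y o0 + y o1 + y o2,
  s`_5 = y o0 * (x o1 + x o2) + y o1 * (x o0 + x o2) + y o2 * (x o0 + x o1) &
  s`_8 = y o0 * (x o1 * x o2) + y o1 * (x o0 * x o2) + y o2 * (x o0 * x o1)].
  by rewrite /s hs.
have [c [mc e]] : exists c, smem c /\
  vdm x * y i = c * (x i ^+ 2 * s`_3 - x i * s`_5 + s`_8).
  rewrite e3 e5 e8 /vdm; elim/ord3P: i.
  - by exists (x o1 - x o2); split; [smemtac|ring].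
  - by exists (- (x o0 - x o2)); split; [smemtac|ring].
  by exists (x o0 - x o1); split; [smemtac|ring].
by rewrite e; smemtac.
Qed.

(** The principal minors m_i = y_j y_k - z_i of Y satisfy a system of the
    same shape as the diagonal entries, with right-hand sides from f_6, f_9
    and h. *)
Lemma smem_z : [/\ smem z0, smem z1 & smem z2].
Proof.
have my0 := smem_y o0; have my1 := smem_y o1; have my2 := smem_y o2.
pose m0 := y o1 * y o2 - z0; pose m1 := y o0 * y o2 - z1; pose m2 := y o0 * y o1 - z2.
have [e6 e9 eh e1] : [/\ s`_6 = m0 + m1 + m2, s`_9 = x o0 * m0 + x o1 * m1 + x o2 * m2,
  s`_0 = - (x o1 * x o2 * m0 + x o0 * x o2 * m1 + x o0 * x o1 * m2) &
  s`_2 = x o0 + x o1 + x o2].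
  by rewrite /s hs.
have mm0 : smem m0.
  apply: smem_vdm.
  have -> : vdm x * m0 = (x o1 - x o2) *
      (x o0 ^+ 2 * s`_6 - x o0 * (s`_2 * s`_6 - s`_9) - s`_0).
    by rewrite e6 e9 eh e1 /vdm; ring.
  by smemtac.
have mm1 : smem m1.
  apply: smem_vdm.
  have -> : vdm x * m1 = - (x o0 - x o2) *
      (x o1 ^+ 2 * s`_6 - x o1 * (s`_2 * s`_6 - s`_9) - s`_0).
    by rewrite e6 e9 eh e1 /vdm; ring.
  by smemtac.
have mm2 : smem m2.
  apply: smem_vdm.
  have -> : vdm x * m2 = (x o0 - x o1) *
      (x o2 ^+ 2 * s`_6 - x o2 * (s`_2 * s`_6 - s`_9) - s`_0).
    by rewrite e6 e9 eh e1 /vdm; ring.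
  by smemtac.
have [-> [-> ->]] : z0 = y o1 * y o2 - m0 /\ z1 = y o0 * y o2 - m1 /\ z2 = y o0 * y o1 - m2.
  by rewrite /m0 /m1 /m2; split; [ring|split; ring].
by split; smemtac.
Qed.

(** The values f_10 and q give two linear equations for u and v, of
    determinant al - be = vdm x. *)
Lemma smem_uv : smem u /\ smem v.
Proof.
have my0 := smem_y o0; have my1 := smem_y o1; have my2 := smem_y o2.
have [mz0 mz1 mz2] := smem_z; have mq : smem q by apply: smem_mem1; apply: mem1q.
have e10 : s`_10 = u + v + y o0 * y o1 * y o2 - (y o0 * z0 + y o1 * z1 + y o2 * z2).
  by rewrite /s hs.
have eq := qv_slc x Y; rewrite -/q -/u -/v -/z0 -/z1 -/z2 -!/(y _) in eq.
set al := _ + _ * x o0 in eq; set be := _ + _ * x o1 in eq; set rr := _ - _ in eq.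
have mal : smem al by smemtac.
have mbe : smem be by smemtac.
have mrr : smem rr by rewrite /rr; smemtac.
have eab : al - be = vdm x by rewrite /al /be /vdm; ring.
pose w := s`_10 - y o0 * y o1 * y o2 + (y o0 * z0 + y o1 * z1 + y o2 * z2).
have mw : smem w by smemtac.
split; apply: smem_vdm; rewrite -eab.
  have -> : (al - be) * u = q - rr - be * w by rewrite eq /w e10; ring.
  by smemtac.
have -> : (al - be) * v = - (q - rr - al * w) by rewrite eq /w e10; ring.
by smemtac.
Qed.

(** A balanced exponent matrix is a flow on three vertices, so it decomposes
    into loops, 2-cycles and copies of one of the two 3-cycles: these
    contribute the y_i, the z_i, and u or v. *)
Lemma smem_balanced (e : 'I_3 -> 'I_3 -> nat) :
  (forall i, \sum_j e i j = \sum_j e j i)%N -> smem (\prod_i \prod_j Y i j ^+ e i j).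
Proof.
move=> bal.
have my0 := smem_y o0; have my1 := smem_y o1; have my2 := smem_y o2.
have [mz0 mz1 mz2] := smem_z; have [mu mv] := smem_uv.
rewrite !prod3.
have b0 := bal o0; have b1 := bal o1; rewrite !sum3 in b0 b1.
have [le|lt] := leqP (e o1 o0) (e o0 o1).
  have [n [e1 e2 e3]] : exists n, [/\ e o0 o1 = (e o1 o0 + n)%N,
      e o2 o0 = (e o0 o2 + n)%N & e o1 o2 = (e o2 o1 + n)%N].
    by exists (e o0 o1 - e o1 o0)%N; split; lia.
  rewrite e1 e2 e3.
  set w := (X in smem X).
  have -> : w = y o0 ^+ e o0 o0 * y o1 ^+ e o1 o1 * y o2 ^+ e o2 o2 *
     (z2 ^+ e o1 o0 * z1 ^+ e o0 o2 * z0 ^+ e o2 o1 * u ^+ n).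
    by rewrite /w /z0 /z1 /z2 /u /y !exprD !exprMn; ring.
  by smemtac.
have [n [e1 e2 e3]] : exists n, [/\ e o1 o0 = (e o0 o1 + n)%N,
    e o0 o2 = (e o2 o0 + n)%N & e o2 o1 = (e o1 o2 + n)%N].
  by exists (e o1 o0 - e o0 o1)%N; split; lia.
rewrite e1 e2 e3.
set w := (X in smem X).
have -> : w = y o0 ^+ e o0 o0 * y o1 ^+ e o1 o1 * y o2 ^+ e o2 o2 *
   (z2 ^+ e o0 o1 * z1 ^+ e o2 o0 * z0 ^+ e o1 o2 * v ^+ n).
  by rewrite /w /z0 /z1 /z2 /v /y !exprD !exprMn; ring.
by smemtac.
Qed.
End SliceRing.

(** * Restriction of an invariant to the slice *)

Lemma prod_mxvec (R : comNzRingType) a b (F : 'I_(a * b) -> R) :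
  \prod_k F k = \prod_i \prod_j F (mxvec_index i j).
Proof.
rewrite pair_bigA /= (reindex (uncurry (@mxvec_index a b))) /=.
  by apply: eq_bigr => -[].
exact: curry_mxvec_bij.
Qed.

Lemma mcoeff_rescale (K : comNzRingType) n (t : 'I_n -> K) (P : {mpoly K[n]}) m :
  (mmap (@mpolyC n K) (fun k => (t k)%:MP * 'X_k) P)@_m = P@_m * mmap1 t m.
Proof.
rewrite {2}(mpolyE P) /mmap !raddf_sum /= mulr_suml; apply: eq_bigr => m' _.
have -> : mmap1 (fun k => (t k)%:MP * 'X_k) m' = (mmap1 t m')%:MP * 'X_[m'] :> {mpoly K[n]}.
  rewrite /mmap1 mpolyXE_id rmorph_prod -big_split; apply: eq_bigr => i _ /=.
  by rewrite exprMn rmorphXn.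
rewrite !mcoeffCM mcoeffZ !mcoeffX.
by case: eqVneq => [->|_]; rewrite /= ?mulr1 ?mulr0 ?mul0r.
Qed.

Section Slice.
Variable K : fieldType.
Local Notation W := {mpoly K[4 * 3]}.
(** The universal slice point has coordinates in {mpoly K[4 * 3]}, with x in
    the first row and Y in the other three. *)
Definition xW (i : 'I_3) : W := 'X_(mxvec_index (ord0 : 'I_4) i).
Definition YW : 'M[W]_3 := \matrix_(a, b) 'X_(mxvec_index (lift ord0 a : 'I_4) b).
Definition cW : {rmorphism K -> W} := @mpolyC _ K.
Definition restr (p : coord_ring K) : W := ev cW (slc xW YW) p.

Definition rescale (t : 'I_(4 * 3) -> K) : W -> W :=
  mmap cW (fun k => cW (t k) * 'X_k).
HB.instance Definition _ t := GRing.RMorphism.copy (rescale t)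
  (mmap cW (fun k => cW (t k) * 'X_k)).

Definition torus (i : 'I_3) (s : K) (R : comNzRingType) (f : {rmorphism K -> R}) : 'M[R]_3 :=
  diag_mx (\row_j f (if j == i then s else 1)).
(** The weights of the entries of (x, Y) under conjugation by [torus i s]. *)
Definition weight (i : 'I_3) (s : K) (k : 'I_(4 * 3)) : K :=
  mxvec (\matrix_(r < 4, b < 3) (if unlift ord0 r is Some a then
     (if a == i then s else 1) * (if b == i then s^-1 else 1) else 1)) 0 k.

Lemma rescaleX t k : rescale t 'X_k = cW (t k) * 'X_k.
Proof. by rewrite /rescale mmapX mmap1U. Qed.

Lemma rescaleC t a : rescale t (cW a) = cW a.
Proof. exact: mmapC. Qed.

Lemma rescale_x i s j : rescale (weight i s) (xW j) = xW j.
Proof. by rewrite rescaleX /weight mxvecE mxE unlift_none rmorph1 mul1r. Qed.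

Lemma rescale_Y i s a b : rescale (weight i s) (YW a b) =
  cW (if a == i then s else 1) * YW a b * cW (if b == i then s^-1 else 1).
Proof.
by rewrite mxE rescaleX /weight mxvecE mxE liftK rmorphM /= mulrAC.
Qed.

Hypothesis infK : infinite_type K.

(** Conjugation by a diagonal matrix preserves the slice and has determinant
    factor one. *)
Lemma restr_torus p d i s : SL_invariant p -> homog_fun d p -> s != 0 ->
  rescale (weight i s) (restr p) = restr p.
Proof.
move=> ip hp s0; have [k kP] := semi_alg infK ip hp.
pose g := torus i s cW; pose g' := torus i s^-1 cW.
have gg' : g *m g' = 1%:M.
  rewrite mulmx_diag; apply/matrixP => a b; rewrite !mxE -rmorphM.
  by case: ifP => _; rewrite ?mulfV ?mulr1 // rmorph1.
have e : \det g * \det g' = 1 by rewrite -det_mulmx gg' det1.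
have := kP _ cW g g' (slc xW YW); rewrite e expr1n mul1r -/(restr p) => eS; rewrite -[RHS]eS {eS}.
apply: etrans (ev_over _ _ (rescaleC (weight i s))) _.
apply: ev_ext; elim/ord3P; rewrite /lract /slc /=.
- by rewrite map_mx1 mulmx1 gg'.
- rewrite map_diag_mx /g /g' /torus !mulmx_diag; congr diag_mx.
  apply/rowP => j; rewrite !mxE /= rescale_x mulrAC -rmorphM.
  by case: ifP => _; rewrite ?mulfV ?mulr1 // rmorph1 mul1r.
apply/matrixP => a b; rewrite mxE rescale_Y mul_mx_diag mxE mul_diag_mx !mxE.
by case: (a == i); case: (b == i).
Qed.

Definition expo (m : 'X_{1..4 * 3}) (a b : 'I_3) : nat :=
  m (mxvec_index (lift ord0 a : 'I_4) b).

(** Invariance under the i-th one-parameter torus forces the exponents of the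
    i-th row and of the i-th column of Y to have equal sums, as the powers of
    s agree for infinitely many s. *)
Lemma restr_balanced p d m : SL_invariant p -> homog_fun d p -> m \in msupp (restr p) ->
  forall i, (\sum_j expo m i j = \sum_j expo m j i)%N.
Proof.
move=> ip hp mp i; rewrite mcoeff_msupp in mp.
have h (s : K) : s != 0 -> s ^+ (\sum_j expo m i j) = s ^+ (\sum_j expo m j i).
  move=> s0; have := congr1 (mcoeff m) (restr_torus i ip hp s0).
  rewrite mcoeff_rescale -[RHS]mulr1 => /(mulfI mp).
  rewrite /mmap1 prod_mxvec big_ord_recl big1 ?mul1r => [|j _]; last first.
    by rewrite /weight mxvecE mxE unlift_none expr1n.
  rewrite (eq_bigr (fun a => (\prod_b (if a == i then s else 1) ^+ expo m a b) *
     (\prod_b (if b == i then s^-1 else 1) ^+ expo m a b))); last first.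
    move=> a _; rewrite -big_split; apply: eq_bigr => b _.
    by rewrite /weight mxvecE mxE liftK exprMn.
  rewrite big_split /= [X in _ * X]exchange_big /=.
  rewrite (bigD1 i) //= [X in _ * X * _]big1 ?mulr1 => [|a /negPf ai]; last first.
    by rewrite ai big1 // => b _; rewrite expr1n.
  rewrite [X in _ * X](bigD1 i) //= [X in _ * (_ * X)]big1 ?mulr1 => [|b /negPf bi]; last first.
    by rewrite bi big1 // => a _; rewrite expr1n.
  rewrite eqxx !prodrXr exprVn => /(canRL (mulfK _)); rewrite mul1r => -> //.
    by rewrite invrK.
  by rewrite invr_eq0 expf_neq0.
have /polyP e : ('X^(\sum_j expo m i j) : {poly K}) - 'X^(\sum_j expo m j i) = 0.
  by apply: poly_vanish0 => // s s0; rewrite !hornerE h // subrr.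
have := e (\sum_j expo m i j)%N; rewrite coefB !coefXn eqxx coef0.
by case: eqVneq => // _ /eqP; rewrite subr0 oner_eq0.
Qed.

Lemma restr_smem p d : SL_invariant p -> homog_fun d p -> smem cW xW YW (restr p).
Proof.
move=> ip hp; rewrite (mpolyE (restr p)) big_seq.
have m0 : smem cW xW YW 0 by apply: smem_mem0; apply: mem00.
apply: (big_ind (smem cW xW YW) m0) => [a b|m mp]; first exact: smemD.
rewrite -mul_mpolyC; apply: smemM; first by apply: smem_mem0; apply: mem0C.
rewrite mpolyXE_id prod_mxvec big_ord_recl; apply: smemM.
  have m1 : smem cW xW YW 1 by apply: smem_mem0; apply: mem01.
  apply: (big_ind (smem cW xW YW) m1) => [a b|j _]; first exact: smemM.
  by apply: smemX; apply: smem_x.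
rewrite (eq_bigr (fun a => \prod_b YW a b ^+ expo m a b)) => [|a _]; last first.
  by apply: eq_bigr => b _; rewrite mxE.
by apply: smem_balanced; apply: restr_balanced ip hp mp.
Qed.
End Slice.

Lemma sev_ext (K F : comNzRingType) (iota iota' : {rmorphism K -> F}) c c' y y' :
  iota =1 iota' -> c =1 c' -> y =1 y' -> sev iota c y =1 sev iota' c' y'.
Proof. by move=> ei ec ey a; apply: mmap_ext => // b; apply: mmap_ext. Qed.

Lemma sev_over (K F S : comNzRingType) (iota : {rmorphism K -> F})
    (iota' : {rmorphism K -> S}) (f : {rmorphism F -> S}) c y a :
  (forall a, f (iota a) = iota' a) ->
  f (sev iota c y a) = sev iota' (f \o c) (f \o y) a.
Proof.
move=> e; rewrite {1}/sev mmap_comp; apply: mmap_ext => // b /=.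
by rewrite mmap_comp; apply: mmap_ext.
Qed.

Section SliceFormula.
Variable K : fieldType.
Hypothesis infK : infinite_type K.

Definition vdmP : slring K := vdm (fun i => 'X_i).

Lemma sev_vdm (F : comNzRingType) (iota : {rmorphism K -> F}) c y :
  sev iota c y vdmP = vdm y.
Proof. by rewrite /vdmP /vdm !(rmorphM, rmorphB) /= !sevX. Qed.

(** The coordinates of the slice point (x, Y), in the layout of [xW] and
    [YW]. *)
Definition slcoord (F : comNzRingType) (x : 'I_3 -> F) (Y : 'M[F]_3) : 'I_(4 * 3) -> F :=
  fun k => mxvec (\matrix_(r < 4, b < 3) (if unlift ord0 r is Some a then Y a b else x b)) 0 k.

(** The universal membership of the restriction specializes to all slice
    points over all K-algebras, with the same a and b. The exponent of the
    Vandermonde determinant is doubled to make the denominator symmetric in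
    x. *)
Lemma slice_formula p d : SL_invariant p -> homog_fun d p ->
  exists N (a b : slring K), forall (F : comNzRingType) (iota : {rmorphism K -> F}) x Y,
    let ev0 := sev iota (cv (hfseq (slc x Y))) x in
    (vdm x ^+ 2) ^+ N * ev iota (slc x Y) p = ev0 a + ev0 b * qv (slc x Y).
Proof.
move=> ip hp; have [N [[_ _] /= [[a ->] [b ->]] e]] := restr_smem infK ip hp.
exists N, (vdmP ^+ N * a), (vdmP ^+ N * b) => F iota x Y /=.
set ev0 := sev iota _ _.
have [psi [psiC psix psiY]] : exists psi : {rmorphism {mpoly K[4 * 3]} -> F},
    [/\ forall c, psi (cW K c) = iota c, forall i, psi (xW K i) = x i &
        forall i j, psi (YW K i j) = Y i j].
  exists (mmap iota (slcoord x Y)); split=> [c|i|i j]; first exact: mmapC.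
    by rewrite /= /xW mmapX mmap1U /slcoord mxvecE mxE unlift_none.
  by rewrite /= mxE mmapX mmap1U /slcoord mxvecE mxE liftK.
have psiS r : map_mx psi (slc (xW K) (YW K) r) = slc x Y r.
  elim/ord3P: r; rewrite /slc /=.
  - exact: map_mx1.
  - rewrite map_diag_mx; congr diag_mx; apply/rowP => j; rewrite !mxE; exact: psix.
  by apply/matrixP => i j; rewrite mxE psiY.
have psih : map psi (hfseq (slc (xW K) (YW K))) = hfseq (slc x Y).
  by rewrite -map_hfseq; apply: hfseq_ext.
have psiq : psi (qv (slc (xW K) (YW K))) = qv (slc x Y).
  by rewrite -map_qv; apply: qv_ext.
have psiev w : psi (sev (cW K) (cv (hfseq (slc (xW K) (YW K)))) (xW K) w) = ev0 w.
  rewrite (sev_over _ _ _ psiC); apply: sev_ext => // i.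
  rewrite /= /cv -psih; case: i; do 7?[case=> [|]] => //= *; exact: esym (nth_map0 _ _ _).
have {e} := congr1 psi e.
have psiv : psi (vdm (xW K)) = vdm x by rewrite /vdm !(rmorphM, rmorphB) !psix.
have psip : psi (restr p) = ev iota (slc x Y) p.
  by apply: etrans (ev_over _ _ psiC) _; apply: ev_ext.
rewrite rmorphM rmorphXn psiv psip rmorphD rmorphM !psiev psiq => e.
have ev0v : ev0 (vdmP ^+ N) = vdm x ^+ N by rewrite /ev0 rmorphXn /= sev_vdm.
have ev0M w w' : ev0 (w * w') = ev0 w * ev0 w' by rewrite /ev0 rmorphM.
rewrite !ev0M ev0v -mulrA -mulrDr -e mulrA -expr2.
by rewrite exprAC.
Qed.
End SliceFormula.

(** * Symmetrization in the eigenvalues *)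

(** The Vandermonde matrix, ordered so that its determinant is [vdm]. *)
Definition vmx (R : comNzRingType) (x : 'I_3 -> R) : 'M[R]_3 :=
  \matrix_(i, j) x j ^+ (2 - i).

Lemma det_vmx (R : comNzRingType) (x : 'I_3 -> R) : \det (vmx x) = vdm x.
Proof. rewrite det3 !mxE /vdm /= !subn0 !subnn !subSS !subn0; ring. Qed.

Lemma vdm_perm (R : comNzRingType) (x : 'I_3 -> R) (s : 'S_3) :
  vdm (x \o s) = (-1) ^+ s * vdm x.
Proof.
rewrite -!det_vmx.
have -> : vmx (x \o s) = col_perm s (vmx x) by apply/matrixP => i j; rewrite !mxE.
by rewrite col_permE det_mulmx det_perm odd_permV mulrC.
Qed.

(** The determinant of the Vandermonde matrix, expanded: the
    antisymmetrization of x0 ^+ 2 x1 is the Vandermonde determinant. It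
    produces a symmetrization formula without dividing by 6, so that all
    characteristics are allowed. *)
Lemma sum_perm_vdm (R : comNzRingType) (x : 'I_3 -> R) :
  \sum_(s : 'S_3) vdm (x \o s) * (x (s o0) ^+ 2 * x (s o1)) = vdm x ^+ 2.
Proof.
rewrite expr2 -{2}det_vmx /determinant mulr_sumr; apply: eq_bigr => s _.
by rewrite vdm_perm prod3 !mxE /= expr1 mulr1 [in RHS]mulrA [vdm x * _]mulrC.
Qed.

Definition esym3 (R : comNzRingType) (x : 'I_3 -> R) (i : 'I_3) : R :=
  [:: x o0 + x o1 + x o2; x o0 * x o1 + x o0 * x o2 + x o1 * x o2; x o0 * x o1 * x o2]`_i.

Lemma mesym3E (R : comNzRingType) (i : 'I_3) :
  mesym 3 R i.+1 = esym3 (fun i => 'X_i : {mpoly R[3]}) i.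
Proof.
elim/ord3P: i; rewrite /esym3 /=.
- by rewrite mesym1E sum3.
- have w0 : mnmwiden U_(ord0 : 'I_2) = U_(o0)%MM
    by rewrite mnmwiden1; congr U_(_)%MM; apply: val_inj.
  have w1 : mnmwiden U_(lift ord0 ord0 : 'I_2) = U_(o1)%MM
    by rewrite mnmwiden1; congr U_(_)%MM; apply: val_inj.
  have w2 : (ord_max : 'I_3) = o2 by apply: val_inj.
  rewrite mesymSS mesymnnE mesym1E !big_ord_recl !big_ord0 addr0 mulr1.
  rewrite mwidenM mwidenD !mwidenX w0 w1 w2; ring.
by rewrite mesymnnE prod3.
Qed.

Section Symmetrize.
Variable K : comNzRingType.

Definition symz (a : slring K) : slring K := \sum_(s : 'S_3) msym s a.

Lemma symz_sym a : symz a \is symmetric.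
Proof.
apply/issymP => s; rewrite /symz raddf_sum /= [RHS](reindex_inj (mulIg s)) /=.
by apply: eq_bigr => t _; rewrite msymMm.
Qed.

Variables (F : comNzRingType) (iota : {rmorphism K -> F}) (c : 'I_7 -> F).

Lemma sev_msym x (s : 'S_3) a : sev iota c x (msym s a) = sev iota c (x \o s) a.
Proof.
rewrite /msym mmap_comp; apply: mmap_ext => [b|i] /=; last exact: sevX.
exact: mmapC.
Qed.

Lemma sev_mPo x (t : slring K) (S : 3.-tuple (slring K)) :
  sev iota c x (t \mPo S) = sev iota c (fun i => sev iota c x (tnth S i)) t.
Proof.
rewrite /comp_mpoly mmap_comp; apply: mmap_ext => [b|i] //=; exact: mmapC.
Qed.
End Symmetrize.

(** Multiplying a by vdm x * x0 ^+ 2 * x1 and summing over S_3 gives a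
    symmetric polynomial, hence a polynomial in the elementary ones; where a
    takes a constant value al on all rearrangements of x, this sum is vdm x ^+
    2 * al. *)
Lemma symmetrize (K : comNzRingType) (a : slring K) : exists t : slring K,
  forall (F : comNzRingType) (iota : {rmorphism K -> F}) c x al,
    (forall s : 'S_3, sev iota c (x \o s) a = al) ->
    vdm x ^+ 2 * al = sev iota c (esym3 x) t.
Proof.
(* By [sum_perm_vdm], summing over S_3 the factor before a gives vdm ^+ 2. *)
pose w : slring K := vdm (fun i => 'X_i) * ('X_o0 ^+ 2 * 'X_o1) * a.
have [t [tE _]] := sym_fundamental (symz_sym w).
exists t => F iota c x al ala.
have <- : sev iota c x (t \mPo [tuple mesym 3 _ i.+1 | i < 3]) = sev iota c (esym3 x) t.
  rewrite sev_mPo; apply: sev_ext => // i; rewrite tnth_mktuple mesym3E.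
  elim/ord3P: i; rewrite /esym3 /= !(rmorphD, rmorphM) /= !sevX //.
rewrite tE /symz rmorph_sum -sum_perm_vdm mulr_suml; apply: eq_bigr => s _ /=.
rewrite sev_msym /w !rmorphM /= !sevX ala; congr (_ * _ * _).
by rewrite /vdm !(rmorphM, rmorphB) /= !sevX.
Qed.

(** * Substituting the generators *)

(** Evaluation at the generic triple is the identity, so identities in the
    coordinate ring are identities between values. *)
Lemma ev_id (K : comNzRingType) (p : coord_ring K) :
  ev (@mpolyC _ K) (generic_matrix K) p = p.
Proof.
apply: etrans _ (esym (rmorph_ev (idfun : {rmorphism coord_ring K -> coord_ring K}) p)).
apply: mmap_ext => // k.
case/mxvec_indexP: k => r k; case/mxvec_indexP: k => i j.
by rewrite /coordinates !mxvecE !mxE !mxvecE !mxE.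
Qed.

Lemma hf_tupleE (K : comNzRingType) :
  tval (hf_tuple K) = hfseq (generic_matrix K).
Proof.
have [[e1 e2 e3 e4 e5] [e6 e7 e8 e9 e10]] :=
  ev_fE (@mpolyC _ K) (generic_matrix K).
have eh := ev_hE (@mpolyC _ K) (generic_matrix K).
transitivity (map (ev (@mpolyC _ K) (generic_matrix K)) (hf_tuple K)).
  by rewrite (eq_map (@ev_id K)) map_id.
by rewrite /hfseq -eh -e1 -e2 -e3 -e4 -e5 -e6 -e7 -e8 -e9 -e10.
Qed.

Lemma q_E (K : comNzRingType) : q_ K = qv (generic_matrix K).
Proof. by rewrite -[LHS]ev_id ev_qE. Qed.

Lemma tnth_hf (K : comNzRingType) i :
  tnth (hf_tuple K) i = (hfseq (generic_matrix K))`_i.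
Proof. by rewrite (tnth_nth 0) hf_tupleE. Qed.

Lemma ev_hfseq (K F : comNzRingType) (iota : {rmorphism K -> F}) A :
  map (ev iota A) (hfseq (generic_matrix K)) = hfseq A.
Proof. by rewrite -map_hfseq; apply: hfseq_ext => r; rewrite ev_generic. Qed.

Lemma ev_comp_hf (K F : comNzRingType) (iota : {rmorphism K -> F}) A (P : {mpoly K[11]}) :
  ev iota A (P \mPo hf_tuple K) = mmap iota (fun i => (hfseq A)`_i) P.
Proof.
rewrite /comp_mpoly mmap_comp; apply: mmap_ext => [c|i] /=; first exact: evC.
by rewrite tnth_hf -nth_map0 ev_hfseq.
Qed.

Lemma ev_qv (K F : comNzRingType) (iota : {rmorphism K -> F}) A : ev iota A (q_ K) = qv A.
Proof. exact: ev_qE. Qed.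

Section Vars.
Variable K : comNzRingType.
(** Variables number 0 to 10 of {mpoly K[11]} stand for h, f_1, ..., f_10. *)
Definition X11 (i : nat) : {mpoly K[11]} := 'X_(inord i).
(** The discriminant of det (t A1 + A2), in terms of f_1, f_2, f_4, f_7. *)
Definition discP : {mpoly K[11]} := disc4 (X11 1) (X11 2) (X11 4) (X11 7).

Lemma X11_hf i : (i < 11)%N -> X11 i \mPo hf_tuple K = (hfseq (generic_matrix K))`_i.
Proof. by move=> lti; rewrite /X11 comp_mpolyXU hf_tupleE inordK. Qed.

Lemma discP_hf : discP \mPo hf_tuple K = disc2 (generic_matrix K o0) (generic_matrix K o1).
Proof. by rewrite /discP (rmorph_disc4 (comp_mpoly (hf_tuple K))) /= !X11_hf. Qed.
End Vars.

(** Specialize to a slice point with distinct eigenvalues 0, 1, t at which u =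
    1 and v = 0. *)
Lemma generic_qdiff_neq0 (K : idomainType) :
  q_ K - trp (q_ K) != 0.
Proof.
pose x (i : 'I_3) : {poly K} := if i == o0 then 0 else if i == o1 then 1 else 'X.
pose Y : 'M[{poly K}]_3 := \matrix_(i, j)
  (((i == o0) && (j == o1)) || ((i == o1) && (j == o2)) || ((i == o2) && (j == o0)))%:R.
apply/eqP => /(congr1 (ev (@polyC K) (slc x Y))).
rewrite rmorphB rmorph0 /= ev_trp !ev_qv.
rewrite (qv_ext (trA_slc x Y)) qv_sub_slc !mxE /= !mulr0 subr0 !mulr1.
apply/eqP; rewrite /vdm /x /= !mulf_neq0 //.
- by rewrite sub0r oppr_eq0 oner_neq0.
- by rewrite sub0r oppr_eq0 polyX_eq0.
by rewrite -opprB oppr_eq0 -polyC1 polyXsubC_eq0.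
Qed.

Definition permY (R : comNzRingType) (s : 'S_3) (Y : 'M[R]_3) : 'M[R]_3 :=
  \matrix_(i, j) Y (s i) (s j).

(** Renumbering the eigenvalues amounts to acting by a permutation matrix and
    its inverse, so all invariants are unchanged. *)
Lemma slc_perm (R : comNzRingType) (s : 'S_3) (x : 'I_3 -> R) Y :
  lract (perm_mx s) (perm_mx s^-1) (slc x Y) =1 slc (x \o s) (permY s Y).
Proof.
have e (A : 'M[R]_3) : perm_mx s *m A *m perm_mx s^-1 = permY s A.
  by rewrite -row_permE -col_permE; apply/matrixP => i j; rewrite !mxE.
elim/ord3P; rewrite /lract /slc /= e //.
  by apply/matrixP => i j; rewrite !mxE (inj_eq perm_inj).
by apply/matrixP => i j; rewrite !mxE (inj_eq perm_inj).
Qed.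

Lemma det_perm_perm (R : comNzRingType) (s : 'S_3) :
  \det (perm_mx s : 'M[R]_3) * \det (perm_mx s^-1 : 'M[R]_3) = 1.
Proof. by rewrite -det_mulmx -perm_mxM mulgV perm_mx1 det1. Qed.

Lemma scale_hf1 (R : comNzRingType) (A : 'I_3 -> 'M[R]_3) : scale_hf 1 (hfseq A) = hfseq A.
Proof. by rewrite /scale_hf /= expr1n !mul1r. Qed.

Lemma hfseq_perm (R : comNzRingType) (s : 'S_3) (x : 'I_3 -> R) Y :
  hfseq (slc (x \o s) (permY s Y)) = hfseq (slc x Y).
Proof. by rewrite -(hfseq_ext (slc_perm s x Y)) hfseq_lract det_perm_perm scale_hf1. Qed.

Lemma qv_perm (R : comNzRingType) (s : 'S_3) (x : 'I_3 -> R) Y :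
  qv (slc (x \o s) (permY s Y)) = qv (slc x Y).
Proof. by rewrite -(qv_ext (slc_perm s x Y)) qv_lract det_perm_perm expr1n mul1r. Qed.

Lemma hfseq_tr (R : comNzRingType) (A : 'I_3 -> 'M[R]_3) : hfseq (trA A) = hfseq A.
Proof. by rewrite /hfseq /trA hmx_tr !polar_tr mixed_tr !det_tr. Qed.

Lemma vdm_perm2 (R : comNzRingType) (s : 'S_3) (x : 'I_3 -> R) :
  vdm (x \o s) ^+ 2 = vdm x ^+ 2.
Proof.
by rewrite vdm_perm exprMn -signr_odd -exprM muln2 oddb -signr_odd odd_double expr0 mul1r.
Qed.

Section Localize.
Variable K : fieldType.
Hypothesis infK : infinite_type K.

(** The formula a (x) + b (x) q holds at all six orderings of the eigenvalues
    and at the transposed point, where only q changes. As q differs from its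
    transpose, b has the same value at all orderings, and then so does a;
    both can be replaced by functions of the elementary symmetric functions
    of x. *)
Lemma slice_sym_formula p d (F : fieldType) (iota : {rmorphism K -> F}) x Y :
  SL_invariant p -> homog_fun d p ->
  qv (slc x Y) != qv (slc x Y^T) ->
  exists N (ta tb : slring K),
   let e := sev iota (cv (hfseq (slc x Y))) (esym3 x) in
   (vdm x ^+ 2) ^+ N * ev iota (slc x Y) p = e ta + e tb * qv (slc x Y).
Proof.
move=> ip hp nq; have [k kP] := semi_alg infK ip hp.
have [N [a [b abE]]] := slice_formula infK ip hp.
have [ta taP] := symmetrize a; have [tb tbP] := symmetrize b.
exists N.+1, ta, tb => e.
pose one3 : 'S_3 := 1%g.
pose c := cv (hfseq (slc x Y)).
have evs (s : 'S_3) Z : ev iota (slc (x \o s) (permY s Z)) p = ev iota (slc x Z) p.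
  by rewrite -(ev_ext iota (slc_perm s x Z)) kP det_perm_perm expr1n mul1r.
have E1 (s : 'S_3) : (vdm x ^+ 2) ^+ N * ev iota (slc x Y) p =
    sev iota c (x \o s) a + sev iota c (x \o s) b * qv (slc x Y).
  have /= := abE F iota (x \o s) (permY s Y).
  by rewrite hfseq_perm qv_perm vdm_perm2 evs.
have hT : hfseq (slc x Y^T) = hfseq (slc x Y).
  by rewrite -(hfseq_ext (trA_slc x Y)) hfseq_tr.
have E2 (s : 'S_3) : (vdm x ^+ 2) ^+ N * ev iota (slc x Y^T) p =
    sev iota c (x \o s) a + sev iota c (x \o s) b * qv (slc x Y^T).
  have /= := abE F iota (x \o s) (permY s Y^T).
  by rewrite hfseq_perm hT qv_perm vdm_perm2 evs.
have dq : qv (slc x Y) - qv (slc x Y^T) != 0 by rewrite subr_eq0.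
have bc (s : 'S_3) : sev iota c (x \o s) b = sev iota c x b.
  apply: (mulIf dq).
  have e1 (t : 'S_3) : sev iota c (x \o t) b * (qv (slc x Y) - qv (slc x Y^T)) =
    (vdm x ^+ 2) ^+ N * (ev iota (slc x Y) p - ev iota (slc x Y^T) p).
    by rewrite [RHS]mulrBr (E1 t) (E2 t); ring.
  have -> : sev iota c x b = sev iota c (x \o one3) b.
    by apply: sev_ext => // i; rewrite /= perm1.
  by rewrite !e1.
have ac (s : 'S_3) : sev iota c (x \o s) a = sev iota c x a.
  have e1 (t : 'S_3) : sev iota c (x \o t) a =
    (vdm x ^+ 2) ^+ N * ev iota (slc x Y) p - sev iota c x b * qv (slc x Y).
    by rewrite (E1 t) bc addrK.
  have -> : sev iota c x a = sev iota c (x \o one3) a.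
    by apply: sev_ext => // i; rewrite /= perm1.
  by rewrite !e1.
rewrite /e -/c -(taP _ _ _ _ _ ac) -(tbP _ _ _ _ _ bc) exprS -mulrA (E1 one3).
by rewrite ac bc mulrDr mulrA.
Qed.
End Localize.

(** * Denominators supported on A1 and A2 *)

Section Denominators.
Variables (R F : comNzRingType) (E : {rmorphism R -> F}) (t : R).

(** Elements of F that are images under E of fractions with a power of t as
    denominator. *)
Definition frac_of w := exists M a, E t ^+ M * w = E a.

Lemma frac_im a : frac_of (E a). Proof. by exists 0, a; rewrite mul1r. Qed.
Lemma frac_div w : frac_of (E t * w) -> frac_of w.
Proof. by move=> [M [a e]]; exists M.+1, a; rewrite exprSr -mulrA. Qed.
Lemma fracD w w' : frac_of w -> frac_of w' -> frac_of (w + w').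
Proof.
move=> [M [a e]] [M' [a' e']]; exists (M + M')%N, (t ^+ M' * a + t ^+ M * a').
by rewrite !rmorphD !rmorphM !rmorphXn /= -e -e' exprD; ring.
Qed.
Lemma fracM w w' : frac_of w -> frac_of w' -> frac_of (w * w').
Proof.
move=> [M [a e]] [M' [a' e']]; exists (M + M')%N, (a * a').
by rewrite rmorphM /= -e -e' exprD; ring.
Qed.
End Denominators.

Lemma scale_hf_nth (R : comNzRingType) (d : R) s i : (i < 11)%N ->
  (scale_hf d s)`_i = (if i == 0%N then d ^+ 2 else d) * s`_i.
Proof. by do 11?[case: i => [|i] //]. Qed.

Lemma cv_nth (F : comNzRingType) (t : seq F) (i : 'I_7) :
  exists2 k, (k < 11)%N & cv t i = t`_k.
Proof.
case: i; do 7?[case=> [|]] => //= *; [exists 3|exists 5|exists 8|exists 6|exists 9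
  |exists 0|exists 10] => //.
Qed.

Section Localize.
Variable K : fieldType.
Hypothesis infK : infinite_type K.
Local Notation F1 := (X11 K 1).

(** Pull the slice formula back along the diagonalization of the generic
    triple. The values at the slice point are those at the generic triple
    divided by powers of D = f_1, and vdm x ^+ 2 is the discriminant divided
    by D ^+ 4; clearing all denominators gives an identity in the coordinate
    ring. *)
Lemma invariant_localized p d : SL_invariant p -> homog_fun d p ->
  exists M N (a b : {mpoly K[11]}),
  ((F1 ^+ M * discP K ^+ N) \mPo hf_tuple K) * p =
  (a \mPo hf_tuple K) + (b \mPo hf_tuple K) * q_ K.
Proof.
move=> ip hp; have [k kP] := semi_alg infK ip hp.
have [F [j [x [g [g' [Y [jI _ ug ug' AE]]]]]]] := generic_diag K.
pose iota : {rmorphism K -> F} := j \o @mpolyC _ K.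
pose D := \det g * \det g'.
have D0 : D != 0 by rewrite mulf_neq0 // -unitfE -unitmxE.
have jev w : j w = ev iota (lract g g' (slc x Y)) w.
  by rewrite (rmorph_ev j); apply: ev_ext.
pose E : {rmorphism {mpoly K[11]} -> F} := j \o comp_mpoly (hf_tuple K).
have EE P : E P = mmap iota (fun i => (scale_hf D (hfseq (slc x Y)))`_i) P.
  by rewrite /E /= jev ev_comp_hf; apply: mmap_ext => // i; rewrite hfseq_lract.
have EX i : (i < 11)%N -> E (X11 K i) = (scale_hf D (hfseq (slc x Y)))`_i.
  by move=> lti; rewrite EE mmapX mmap1U inordK.
have EC c : E c%:MP = iota c by rewrite EE mmapC.
have jq : j (q_ K) = D ^+ 3 * qv (slc x Y) by rewrite jev ev_qv qv_lract.
have jp : j p = D ^+ k * ev iota (slc x Y) p by rewrite jev kP.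
have EF1 : E F1 = D by rewrite EX // /scale_hf /= det1 mulr1.
have EdiscP : E (discP K) = D ^+ 4 * vdm x ^+ 2.
  rewrite /discP (rmorph_disc4 E) !EX // /scale_hf /= disc4Z; congr (_ * _).
  exact: disc2_slc.
(* q and its transpose differ at the generic triple, hence at the slice point. *)
have nq : qv (slc x Y) != qv (slc x Y^T).
  apply: contra_neq (generic_qdiff_neq0 K) => eq; apply: jI.
  rewrite rmorphB rmorph0 jq (jev (trp _)) ev_trp ev_qv.
  have -> : qv (trA (lract g g' (slc x Y))) = qv (lract g'^T g^T (slc x Y^T)).
    apply: qv_ext => r; rewrite [RHS]/lract -trA_slc /trA /lract !trmx_mul mulmxA //.
  by rewrite qv_lract !det_tr eq [\det g' * _]mulrC subrr.
have [N [ta [tb]]] := slice_sym_formula infK iota ip hp nq.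
set e := sev _ _ _ => eP.
(* The values at the slice point are quotients of values at the generic triple
   by powers of f_1. *)
have fr w : frac_of E F1 (e w).
  have frs i : (i < 11)%N -> frac_of E F1 (hfseq (slc x Y))`_i.
    move=> lti; have := frac_im E F1 (X11 K i).
    rewrite EX // scale_hf_nth // -EF1; case: ifP => _.
      by rewrite expr2 -mulrA => /frac_div/frac_div.
    exact: frac_div.
  apply: mmap_closed => [b|i||].
  - apply: mmap_closed => [c|i||].
    + by rewrite -EC; apply: frac_im.
    + by have [l ltl ->] := cv_nth (hfseq (slc x Y)) i; apply: (frs).
    + exact: fracD.
    exact: fracM.
  - have [h2 h4 h7] : [/\ frac_of E F1 (esym3 x o0), frac_of E F1 (esym3 x o1) &
        frac_of E F1 (esym3 x o2)].
      have := frs 2 isT; have := frs 4 isT; have := frs 7 isT.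
      by rewrite hf_slc.
    by elim/ord3P: i.
  - exact: fracD.
  exact: fracM.
have [Ma [a aE]] := fr ta; have [Mb [b bE]] := fr tb.
rewrite EF1 in aE bE.
exists (Ma + Mb + 3)%N, N, (F1 ^+ (Mb + 3 + 4 * N + k) * a), (F1 ^+ (Ma + 4 * N + k) * b).
have EM n P : E (F1 ^+ n * P) = D ^+ n * E P by rewrite (rmorphM E) (rmorphXn E) EF1.
have EN : E (discP K ^+ N) = (D ^+ 4 * vdm x ^+ 2) ^+ N by rewrite (rmorphXn E) EdiscP.
have Ej P : j (P \mPo hf_tuple K) = E P by [].
have jM u v : j (u * v) = j u * j v by exact: rmorphM.
apply: jI; rewrite rmorphD [LHS]jM [in RHS](jM (_ \mPo _)) !Ej !EM EN jp jq -aE -bE.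
rewrite (exprMn N (D ^+ 4)) -exprM.
transitivity (D ^+ (Ma + Mb + 3 + 4 * N + k) * ((vdm x ^+ 2) ^+ N * ev iota (slc x Y) p)).
  by rewrite !exprD; ring.
by rewrite eP !exprD; ring.
Qed.
End Localize.

(** * Independence *)

Lemma quad_ext (F : fieldType) (a b : F) :
  exists (F' : fieldType) (iota : {rmorphism F -> F'}) (u v : F'),
    iota a = u + v /\ iota b = u * v.
Proof.
pose q : {poly F} := 'X^2 - a *: 'X + b%:P.
have sq : size q = 3.
  rewrite /q -!addrA size_polyDl size_polyXn // ltnS.
  rewrite (leq_trans (size_polyD _ _)) // geq_max size_polyN size_polyC.
  by rewrite (leq_trans (size_scale_leq _ _)) ?size_polyX //; case: (b != 0).
have [|F' [i [u r]]] := @root_ext _ q; first by rewrite sq.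
have {r} e : u ^+ 2 - i a * u + i b = 0.
  move: r; rewrite /root /q !(rmorphB, rmorphD) /= !map_polyZ /= !map_polyXn.
  rewrite map_polyX map_polyC !hornerE => /eqP <-; ring.
exists F', i, u, (i a - u); split; first by ring.
by apply/eqP; rewrite -subr_eq0 -[X in _ == X]e; apply/eqP; ring.
Qed.

(** Off-diagonal entries with prescribed products along the 2-cycles and the
    3-cycles; u v = z0 z1 z2 is the only constraint. The degenerate cases with
    u = 0 or v = 0 are treated separately. *)
Lemma offdiag (F : fieldType) (z0 z1 z2 u v : F) : u * v = z0 * z1 * z2 ->
  exists a01 a10 a02 a20 a12 a21,
   [/\ a12 * a21 = z0, a02 * a20 = z1, a01 * a10 = z2, a01 * a12 * a20 = u &
       a02 * a21 * a10 = v].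
Proof.
move=> uv; have [u0|nu] := eqVneq u 0; last first.
  exists 1, z2, (z1 / u), u, 1, z0; split; rewrite ?mul1r ?divfK //.
  apply: (mulfI nu); rewrite uv; field; exact: nu.
rewrite {}u0 mul0r in uv *; have [v0|nv] := eqVneq v 0; last first.
  exists z2, 1, v, (z1 / v), z0, 1; split; rewrite ?mul1r ?mulr1 //.
    by rewrite mulrC divfK.
  by transitivity (z0 * z1 * z2 / v); [ring|rewrite -uv mul0r].
rewrite {}v0; move/esym/eqP: uv; rewrite !mulf_eq0 -orbA => /or3P[] /eqP ->.
- by exists 1, z2, 1, z1, 0, 0; split; rewrite ?(mul0r, mul1r, mulr0, mulr1).
- by exists 1, z2, 0, 0, 1, z0; split; rewrite ?(mul0r, mul1r, mulr0, mulr1).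
by exists 0, 0, 1, z1, 1, z0; split; rewrite ?(mul0r, mul1r, mulr0, mulr1).
Qed.

(** With distinct eigenvalues, interpolation yields the diagonal y and the
    principal minors of Y, hence the z_i; then u and v are the roots of a
    quadratic polynomial, since their sum is given by f_10 and their product
    is z0 z1 z2. *)
Lemma realize_slice (F : fieldType) (x : 'I_3 -> F) (c3 c5 c8 c6 c9 ch c10 : F) :
  vdm x != 0 ->
  exists (F' : fieldType) (iota : {rmorphism F -> F'}) (Y : 'M[F']_3),
    hfseq (slc (iota \o x) Y) = map iota [:: ch; 1; x o0 + x o1 + x o2; c3;
      x o0 * x o1 + x o0 * x o2 + x o1 * x o2; c5; c6; x o0 * x o1 * x o2; c8; c9; c10].
Proof.
move=> nv.
have solve a b c : exists y0 y1 y2, [/\ a = y0 + y1 + y2,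
    b = y0 * (x o1 + x o2) + y1 * (x o0 + x o2) + y2 * (x o0 + x o1) &
    c = y0 * (x o1 * x o2) + y1 * (x o0 * x o2) + y2 * (x o0 * x o1)].
  exists ((x o1 - x o2) * (x o0 ^+ 2 * a - x o0 * b + c) / vdm x).
  exists (- (x o0 - x o2) * (x o1 ^+ 2 * a - x o1 * b + c) / vdm x).
  exists ((x o0 - x o1) * (x o2 ^+ 2 * a - x o2 * b + c) / vdm x).
  have nd : [&& x o1 - x o2 != 0, x o0 - x o2 != 0 & x o0 - x o1 != 0].
    by move: nv; rewrite /vdm !mulf_eq0 !negb_or => /andP[/andP[-> ->] ->].
  by split; apply: (mulfI nv); rewrite /vdm; field; exact: nd.
have [y0 [y1 [y2 [e3 e5 e8]]]] := solve c3 c5 c8.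
have [m0 [m1 [m2 [e6 e9 eh]]]] := solve c6 ((x o0 + x o1 + x o2) * c6 - c9) (- ch).
pose z0 := y1 * y2 - m0; pose z1 := y0 * y2 - m1; pose z2 := y0 * y1 - m2.
pose s := c10 - y0 * y1 * y2 + (y0 * z0 + y1 * z1 + y2 * z2).
have [F' [i [u [v [es ez]]]]] := quad_ext s (z0 * z1 * z2).
rewrite !rmorphM in ez.
have [a01 [a10 [a02 [a20 [a12 [a21 [ez0 ez1 ez2 eu ev]]]]]]] := offdiag (esym ez).
pose Y : 'M[F']_3 := \matrix_(r, c)
  (if r == o0 then if c == o0 then i y0 else if c == o1 then a01 else a02
   else if r == o1 then if c == o0 then a10 else if c == o1 then i y1 else a12
   else if c == o0 then a20 else if c == o1 then a21 else i y2).
exists F', i, Y; rewrite hf_slc !mxE /= eu ev ez0 ez1 ez2.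
have mE : [/\ i y1 * i y2 - i z0 = i m0, i y0 * i y2 - i z1 = i m1 &
    i y0 * i y1 - i z2 = i m2].
  by rewrite /z0 /z1 /z2 !rmorphB !rmorphM /=; split; ring.
have [-> -> ->] := mE.
have e9' : c9 = x o0 * m0 + x o1 * m1 + x o2 * m2.
  by have -> : c9 = (x o0 + x o1 + x o2) * c6 - ((x o0 + x o1 + x o2) * c6 - c9);
   [ring|rewrite e9 e6; ring].
have eh' : ch = - (x o1 * x o2 * m0 + x o0 * x o2 * m1 + x o0 * x o1 * m2).
  by rewrite -[ch]opprK eh; ring.
have e10 : i c10 = u + v + i (y0 * y1 * y2 - (y0 * z0 + y1 * z1 + y2 * z2)).
  by rewrite -es -rmorphD /s; congr (i _); ring.
rewrite e10 {1}eh' e3 {1}e5 e6 {1}e8 {1}e9' !(rmorphN, rmorphB, rmorphD, rmorphM, rmorph1) /=.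
by congr [:: _; _; _; _; _; _; _; _; _; _; _]; ring.
Qed.

(** Every sequence of values with f_1 and the discriminant nonzero occurs:
    solve for x, realize the rescaled values on the slice, and multiply by a
    matrix of determinant f_1. *)
Lemma realize (F : fieldType) (t : seq F) :
  t`_1 != 0 -> disc4 t`_1 t`_2 t`_4 t`_7 != 0 ->
  exists (F' : fieldType) (iota : {rmorphism F -> F'}) (A : 'I_3 -> 'M[F']_3),
    forall i, (i < 11)%N -> (hfseq A)`_i = iota t`_i.
Proof.
move=> t1 td; pose d := t`_1.
have [F1 [i1 [x [e1 e2 e3]]]] := split3 (t`_2 / d) (t`_4 / d) (t`_7 / d).
have dE a : d * (a / d) = a by rewrite mulrC divfK.
have nv : vdm x != 0.
  suff : vdm x ^+ 2 != 0 by rewrite sqrf_eq0.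
  rewrite -disc4E -e1 -e2 -e3 -(rmorph1 i1) -rmorph_disc4 fmorph_eq0.
  apply: contraNneq td => e; rewrite -[X in disc4 X]mulr1 -/d -[t`_2]dE -[t`_4]dE -[t`_7]dE.
  by rewrite disc4Z e mulr0.
pose w k := i1 (t`_k / d).
have [F2 [i2 [Y YE]]] := realize_slice (w 3) (w 5) (w 8) (w 6) (w 9) (i1 (t`_0 / d ^+ 2)) (w 10) nv.
exists F2, (i2 \o i1), (lract (D1 (i2 (i1 d))) 1%:M (slc (i2 \o x) Y)).
move=> i lti; rewrite hfseq_lract det_D1 det1 mulr1 YE -e1 -e2 -e3 -(rmorph1 i1).
have h k : i2 (i1 d) * i2 (i1 (t`_k / d)) = i2 (i1 t`_k) by rewrite -!rmorphM dE.
have h0 : i2 (i1 d) ^+ 2 * i2 (i1 (t`_0 / d ^+ 2)) = i2 (i1 t`_0).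
  by rewrite -!rmorphXn -!rmorphM mulrC divfK // expf_neq0.
have h1 : i2 (i1 d) * i2 (i1 1) = i2 (i1 t`_1) by rewrite !rmorph1 mulr1.
by rewrite /scale_hf /= /w h0 h1 !h; do 11?[case: i lti => [|i] lti //].
Qed.

Section Independence.
Variable K : idomainType.

Lemma discP_neq0 : discP K != 0.
Proof.
apply: contra_neq (generic_disc_neq0 K) => e.
by rewrite -discP_hf e (rmorph0 (comp_mpoly (hf_tuple K))).
Qed.

(** Realize the variables themselves, as elements of the fraction field of
    {mpoly K[11]}: at such a triple, a polynomial in h and the f's takes the
    value of the polynomial. *)
Lemma hf_independent (P : {mpoly K[11]}) : P \mPo hf_tuple K = 0 -> P = 0.
Proof.
move=> P0.
pose j := @tofrac {mpoly K[11]}.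
have X0 (i : 'I_11) : j 'X_i != 0 by rewrite tofrac_eq0 mX_neq0.
pose t := [seq j (X11 K i) | i <- iota 0 11].
have tE k : (k < 11)%N -> t`_k = j (X11 K k).
  by move=> ltk; rewrite (nth_map 0%N) ?size_iota // nth_iota.
have [||F [i [A AE]]] := @realize _ t.
- by rewrite tE // X0.
- by rewrite !tE // -rmorph_disc4 tofrac_eq0 discP_neq0.
pose kap : {rmorphism K -> F} := i \o j \o @mpolyC _ K.
have : ev kap A (P \mPo hf_tuple K) = i (j P).
  rewrite ev_comp_hf -[RHS]/((i \o j) P) -(rmorph_mmap (i \o j)).
  apply: mmap_ext => // k; rewrite AE ?ltn_ord // tE ?ltn_ord //.
  by rewrite /X11 inord_val.
rewrite P0 rmorph0 => /esym/eqP; rewrite fmorph_eq0 tofrac_eq0 => /eqP //.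
Qed.

Lemma trp_hf (P : {mpoly K[11]}) : trp (P \mPo hf_tuple K) = P \mPo hf_tuple K.
Proof.
rewrite -[LHS]ev_id ev_trp ev_comp_hf -[RHS]ev_id ev_comp_hf.
apply: mmap_ext => [c|i]; first by [].
by rewrite hfseq_tr.
Qed.

(** Transposition fixes h and the f's but moves q. *)
Lemma hfq_independent (a b : {mpoly K[11]}) :
  (a \mPo hf_tuple K) + (b \mPo hf_tuple K) * q_ K = 0 -> a = 0 /\ b = 0.
Proof.
move=> e.
have e' : (a \mPo hf_tuple K) + (b \mPo hf_tuple K) * trp (q_ K) = 0.
  by have := congr1 (@trp K) e; rewrite rmorph0 rmorphD rmorphM /= !trp_hf.
have b0 : b = 0.
  apply: hf_independent; apply: (mulIf (generic_qdiff_neq0 K)).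
  by rewrite mul0r mulrBr -(subrr (0 : coord_ring K)) -{1}e -{1}e'; ring.
split=> //; apply: hf_independent.
by move: e; rewrite b0 (rmorph0 (comp_mpoly (hf_tuple K))) mul0r addr0.
Qed.
End Independence.

(** * Coprime denominators *)

Section Regular.
Variables (R : idomainType) (theta : {rmorphism R -> {poly R}})
  (back : {rmorphism {poly R} -> R}).
Hypothesis thetaK : cancel theta back.

(** In a polynomial ring over a domain, a monic polynomial G divides a as
    soon as it divides c a for some nonzero constant c: compare degrees of
    the remainder. The embedding theta chooses the variable in which G is
    monic. *)
Lemma monic_regular (G H a b c : R) : theta G \is monic -> theta H = c%:P -> c != 0 ->
  G * b = H * a -> exists w, a = G * w.
Proof.
move=> mG tH c0 /(congr1 theta); rewrite !rmorphM tH => e.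
have ea := Pdiv.IdomainMonic.divp_eq mG (theta a).
set w := _ %/ _ in ea; set r := _ %% _ in ea.
have sr : (size r < size (theta G))%N.
  by rewrite ltn_modp ?monic_neq0.
have er : theta G * (theta b - c%:P * w) = c%:P * r.
  by rewrite mulrBr e ea; ring.
have r0 : r = 0.
  apply/eqP; apply: contraT => nr.
  have nz : theta b - c%:P * w != 0.
    apply: contra_neq nr => z; move: er; rewrite z mulr0 => /esym/eqP.
    by rewrite mulf_eq0 polyC_eq0 (negPf c0) => /eqP.
  move: er nz; set D := theta b - _ => er nz.
  have sl : size (theta G * D) = (size (theta G) + (size D).-1)%N.
    by rewrite size_monicM // -subn1 -addnBA ?size_poly_gt0 // subn1.
  have sr' : size (c%:P * r) = size r by rewrite mul_polyC size_scale.
  by move: sr; rewrite -sr' -er sl ltnNge leq_addr.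
by exists (back w); rewrite -[LHS]thetaK ea r0 addr0 rmorphM thetaK mulrC.
Qed.
End Regular.

Section Coprime.
Variable K : fieldType.
Local Notation R := {mpoly K[11]}.
Local Notation X := (X11 K).

(** The discriminant of det (t A3 + A2): [discP] after the exchange of A1 and
    A3. *)
Definition discP' : R := disc4 (X 10) (X 9) (X 8) (X 7).

Definition th1v (i : 'I_11) : {poly R} := if i == inord 1 then 'X else ('X_i)%:P.
(** The variable f_1 as main variable. *)
Definition th1 : {rmorphism R -> {poly R}} := mmap (polyC \o @mpolyC _ K) th1v.
Definition back1 : {rmorphism {poly R} -> R} := horner_eval (X 1).

Lemma inord11_eq a b : (a < 11)%N -> (b < 11)%N ->
  (inord a == inord b :> 'I_11) = (a == b).
Proof. by move=> lta ltb; rewrite -val_eqE /= !inordK. Qed.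

Lemma th1K : cancel th1 back1.
Proof.
move=> p; rewrite -[LHS]/((back1 \o th1) p) -[LHS](rmorph_mmap (back1 \o th1)).
rewrite -[RHS](rmorph_mmap idfun); apply: mmap_ext => [c|i] /=.
  by rewrite mmapC /= /horner_eval hornerC.
rewrite mmapX mmap1U /th1v /horner_eval; case: eqP => [->|_]; last exact: hornerC.
exact: hornerX.
Qed.

Definition th2v (i : 'I_11) : {poly R} :=
  if i == inord 2 then 'X else if i == inord 4 then ('X_i)%:P + 'X else ('X_i)%:P.
(** The discriminant is not monic in f_2, but after the substitution f_4 :=
    f_4 + f_2 its terms of top degree reduce to f_2 ^+ 4; [back2] undoes the
    substitution. *)
Definition th2 : {rmorphism R -> {poly R}} := mmap (polyC \o @mpolyC _ K) th2v.
Definition tau : {rmorphism R -> R} :=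
  mmap (@mpolyC _ K) (fun i => if i == inord 4 then 'X_i - X 2 else 'X_i).
Definition back2 : {rmorphism {poly R} -> R} := horner_eval (X 2) \o map_poly tau.

Lemma tauX i : tau 'X_i = if i == inord 4 then 'X_i - X 2 else 'X_i.
Proof. by rewrite /tau /= mmapX mmap1U. Qed.

Lemma th2K : cancel th2 back2.
Proof.
move=> p; rewrite -[LHS]/((back2 \o th2) p) -[LHS](rmorph_mmap (back2 \o th2)).
rewrite -[RHS](rmorph_mmap idfun); apply: mmap_ext => [c|i] /=.
  by rewrite mmapC /= /horner_eval map_polyC hornerC /= mmapC.
rewrite mmapX mmap1U /th2v /horner_eval.
case: eqP => [->|ni2]; first by rewrite map_polyX hornerX.
case: eqP => [->|/eqP ni4].
  rewrite rmorphD /= map_polyC map_polyX hornerD hornerC hornerX /= -/(tau _) tauX.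
  by rewrite eqxx subrK.
by rewrite map_polyC hornerC /= -/(tau _) tauX (negPf ni4).
Qed.

Lemma th1X k : (k < 11)%N -> k != 1%N -> th1 (X k) = (X k)%:P.
Proof.
by move=> ltk k1; rewrite /th1 /= mmapX mmap1U /th1v inord11_eq // (negPf k1).
Qed.
Lemma th2X k : (k < 11)%N -> k != 2 -> k != 4 -> th2 (X k) = (X k)%:P.
Proof.
move=> ltk k2 k4; rewrite /th2 /= mmapX mmap1U /th2v !inord11_eq //.
by rewrite (negPf k2) (negPf k4).
Qed.
Lemma th1X1 : th1 (X 1) = 'X.
Proof. by rewrite /th1 /= mmapX mmap1U /th1v eqxx. Qed.
Lemma th2X2 : th2 (X 2) = 'X.
Proof. by rewrite /th2 /= mmapX mmap1U /th2v eqxx. Qed.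
Lemma th2X4 : th2 (X 4) = (X 4)%:P + 'X.
Proof. by rewrite /th2 /= mmapX mmap1U /th2v inord11_eq // eqxx. Qed.

Lemma th2_discP_monic : th2 (discP K) \is monic.
Proof.
rewrite /discP (rmorph_disc4 th2) th2X2 th2X4 !th2X //.
set a := X 1; set c := X 4; set d := X 7.
(* The coefficients of degree 0 to 3 in f_2, after the shift of f_4. *)
pose s := [:: - 4 * a * c ^+ 3 - 27 * a ^+ 2 * d ^+ 2;
  - 12 * a * c ^+ 2 + 18 * a * c * d; c ^+ 2 - 12 * a * c + 18 * a * d;
  2 * c - 4 * a - 4 * d].
have -> : disc4 a%:P 'X (c%:P + 'X) d%:P = 'X^4 + \poly_(i < 4) s`_i :> {poly R}.
  rewrite poly_def !big_ord_recr big_ord0 /= /disc4 -!mul_polyC.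
  by rewrite /s /=; ring.
rewrite monicE lead_coefDl ?lead_coefXn //.
by rewrite size_polyXn ltnS size_poly.
Qed.

(** A renaming of the variables carries it to [discP]. *)
Lemma discP'_neq0 : discP' != 0.
Proof.
pose f : {rmorphism R -> R} := mmap (@mpolyC _ K)
  (fun i : 'I_11 => X (nth 0%N [:: 0; 0; 0; 0; 0; 0; 0; 7; 4; 2; 1]%N i)).
have fX k : (k < 11)%N -> f (X k) = X (nth 0%N [:: 0; 0; 0; 0; 0; 0; 0; 7; 4; 2; 1]%N k).
  by move=> ltk; rewrite /f /= mmapX mmap1U inordK.
apply: contra_neq (discP_neq0 K) => e.
have : f discP' = discP K by rewrite /discP' (rmorph_disc4 f) !fX.
by rewrite e rmorph0 => ->.
Qed.

(** f_1 and the discriminant of (A1, A2) are monic in suitable variables that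
    do not occur in the other denominator, once f_4 is shifted for the
    discriminant; they are cancelled one after the other. *)
Lemma denominators_coprime M N M' N' (a b : R) :
  X 10 ^+ M' * discP' ^+ N' * a = X 1 ^+ M * discP K ^+ N * b ->
  exists w, a = X 1 ^+ M * discP K ^+ N * w.
Proof.
set G2 := X 10 ^+ M' * discP' ^+ N' => e.
have G20 : G2 != 0 by rewrite mulf_neq0 // expf_neq0 ?discP'_neq0 ?mX_neq0.
have t1 : th1 G2 = G2%:P.
  rewrite (rmorphM th1) !(rmorphXn th1) (rmorph_disc4 th1) !th1X //.
  by rewrite -(rmorph_disc4 (@polyC R)) -!rmorphXn -rmorphM.
have t2 : th2 G2 = G2%:P.
  rewrite (rmorphM th2) !(rmorphXn th2) (rmorph_disc4 th2) !th2X //.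
  by rewrite -(rmorph_disc4 (@polyC R)) -!rmorphXn -rmorphM.
have m1 : th1 (X 1 ^+ M) \is monic by rewrite (rmorphXn th1) th1X1 monicXn.
have m2 : th2 (discP K ^+ N) \is monic by rewrite (rmorphXn th2) monic_exp ?th2_discP_monic.
have [w ew] := monic_regular th1K m1 t1 G20 (etrans (mulrA _ _ _) (esym e)).
have X10 : X 1 ^+ M != 0 by rewrite expf_neq0 ?mX_neq0.
have e2 : discP K ^+ N * b = G2 * w.
  by apply: (mulfI X10); rewrite mulrA -e ew; ring.
have [w' ew'] := monic_regular th2K m2 t2 G20 e2.
by exists w'; rewrite ew ew' mulrA.
Qed.
End Coprime.

(** * Generation over an infinite field *)

(** Over a domain this is the subalgebra generated by q, h, f_1, ..., f_10,
    see [hfq_span_subalgebra]. *)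
Definition hfq_span (K : comNzRingType) (p : coord_ring K) :=
  exists a b : {mpoly K[11]},
    p = (a \mPo hf_tuple K) + (b \mPo hf_tuple K) * q_ K.

Section SpanClosure.
Variable K : comNzRingType.
Local Notation hfK := (hf_tuple K).
Implicit Types p : coord_ring K.

Let h0 : (0 : {mpoly K[11]}) \mPo hfK = 0.
Proof. exact: (rmorph0 (comp_mpoly hfK)). Qed.
Let h1 : (1 : {mpoly K[11]}) \mPo hfK = 1.
Proof. exact: (rmorph1 (comp_mpoly hfK)). Qed.

Lemma hfq_span_hf (a : {mpoly K[11]}) : hfq_span (a \mPo hfK).
Proof. by exists a, 0; rewrite h0 mul0r addr0. Qed.

Lemma hfq_span_q : hfq_span (q_ K).
Proof. by exists 0, 1; rewrite h0 h1 mul1r add0r. Qed.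

Lemma hfq_spanD p p' : hfq_span p -> hfq_span p' -> hfq_span (p + p').
Proof.
move=> [a [b ->]] [a' [b' ->]]; exists (a + a'), (b + b').
by rewrite !(rmorphD (comp_mpoly hfK)) /= mulrDl addrACA.
Qed.
End SpanClosure.

Section Swap.
Variable K : comNzRingType.
Local Notation X := (X11 K).
Definition hfX : seq {mpoly K[11]} := [seq X i | i <- iota 0 11].
(** The values of h, f_1, ..., f_10 after the exchange of A1 and A3, in terms
    of those before. *)
Definition swap_vars : 11.-tuple {mpoly K[11]} :=
  [tuple X 0 - X 3 * X 8 + X 4 * X 6; X 10; X 9; X 6; X 8; X 5; X 3; X 7; X 4; X 2; X 1].
Definition SX : {mpoly K[11]} := Sval hfX.

Lemma map_hfX : map (comp_mpoly (hf_tuple K)) hfX = hfseq (generic_matrix K).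
Proof. by rewrite /hfX /= !X11_hf. Qed.

Lemma SX_hf : SX \mPo hf_tuple K = Sval (hfseq (generic_matrix K)).
Proof. by rewrite /SX (rmorph_Sval (comp_mpoly (hf_tuple K))) map_hfX. Qed.

Lemma hfseq_swA :
  hfseq (swA (generic_matrix K)) = map (comp_mpoly (hf_tuple K)) swap_vars.
Proof.
pose gm := generic_matrix K; pose s := hfseq gm.
have hE : hmx (gm o2) (gm o1) (gm o0) = s`_0 - s`_3 * s`_8 + s`_4 * s`_6 := hmx_sw gm.
have mE : mixed (gm o2) (gm o1) (gm o0) = s`_5 := mixed_sw _ _ _.
transitivity [:: s`_0 - s`_3 * s`_8 + s`_4 * s`_6; s`_10; s`_9; s`_6; s`_8; s`_5; s`_3;
  s`_7; s`_4; s`_2; s`_1]; first by rewrite -hE -mE.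
have XE i : (i < 11)%N -> comp_mpoly (hf_tuple K) (X i) = s`_i := @X11_hf K i.
clearbody s; rewrite /swap_vars [RHS]/= (rmorphD (comp_mpoly (hf_tuple K))).
rewrite (rmorphB (comp_mpoly (hf_tuple K))) !(rmorphM (comp_mpoly (hf_tuple K))).
by rewrite /= !XE.
Qed.

Lemma hfseq_sw (i : 'I_11) : (hfseq (swA (generic_matrix K)))`_i =
  tnth swap_vars i \mPo hf_tuple K.
Proof.
by rewrite hfseq_swA (nth_map0 (comp_mpoly (hf_tuple K))) (tnth_nth 0).
Qed.

Lemma swp_hf P : swp (P \mPo hf_tuple K) = (P \mPo swap_vars) \mPo hf_tuple K.
Proof.
rewrite -[LHS]ev_id ev_swp ev_comp_hf.
rewrite [in RHS]/comp_mpoly mmap_comp; apply: mmap_ext => [c|i] /=.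
  by rewrite mmapC.
exact: hfseq_sw.
Qed.

Lemma swp_q : swp (q_ K) = SX \mPo hf_tuple K - q_ K.
Proof.
rewrite -[LHS]ev_id ev_swp ev_qv qv_tr_sw SX_hf q_E -(qv_tr (generic_matrix K)).
by rewrite addrC addKr.
Qed.

Lemma swpK : involutive (@swp K).
Proof.
move=> p; rewrite -[LHS]ev_id !ev_swp -[RHS]ev_id; apply: ev_ext.
by elim/ord3P.
Qed.
End Swap.

Section Generation.
Variable K : fieldType.
Hypothesis infK : infinite_type K.
Local Notation X := (X11 K).
Local Notation hfK := (hf_tuple K).

Let cM (P Q : {mpoly K[11]}) : (P * Q) \mPo hfK = (P \mPo hfK) * (Q \mPo hfK).
Proof. exact: (rmorphM (comp_mpoly hfK)). Qed.
Let cD (P Q : {mpoly K[11]}) : (P + Q) \mPo hfK = (P \mPo hfK) + (Q \mPo hfK).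
Proof. exact: (rmorphD (comp_mpoly hfK)). Qed.
Let cN (P : {mpoly K[11]}) : (- P) \mPo hfK = - (P \mPo hfK).
Proof. exact: (rmorphN (comp_mpoly hfK)). Qed.

(** Uniqueness of a + b q representations turns equality of two fractions into
    equalities between their coefficients. *)
Lemma compare_fractions (G1 G2 a1 b1 a2 b2 : {mpoly K[11]}) (p : coord_ring K) :
  (G1 \mPo hfK) * p = (a1 \mPo hfK) + (b1 \mPo hfK) * q_ K ->
  (G2 \mPo hfK) * p = (a2 \mPo hfK) + (b2 \mPo hfK) * q_ K ->
  G2 * a1 = G1 * a2 /\ G2 * b1 = G1 * b2.
Proof.
move=> e1 e2.
suff [/eqP ea /eqP eb] : G2 * a1 + - (G1 * a2) = 0 /\ G2 * b1 + - (G1 * b2) = 0.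
  by rewrite !subr_eq0 in ea eb; split; apply/eqP.
apply: (@hfq_independent K); rewrite !cD !cN !cM.
transitivity ((G2 \mPo hfK) * ((a1 \mPo hfK) + (b1 \mPo hfK) * q_ K)
  - (G1 \mPo hfK) * ((a2 \mPo hfK) + (b2 \mPo hfK) * q_ K)); last first.
  by rewrite -e1 -e2; move: (G1 \mPo hfK) (G2 \mPo hfK) => g1 g2; ring.
move: (G1 \mPo hfK) (G2 \mPo hfK) (a1 \mPo hfK) (b1 \mPo hfK) (a2 \mPo hfK)
  (b2 \mPo hfK) (q_ K) => g1 g2 u1 v1 u2 v2 q; ring.
Qed.

(** A denominator for the exchanged invariant gives, by exchanging back, a
    denominator for p itself. *)
Lemma swap_formula (G a b : {mpoly K[11]}) (p : coord_ring K) :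
  (G \mPo hfK) * swp p = (a \mPo hfK) + (b \mPo hfK) * q_ K ->
  exists a' b', ((G \mPo swap_vars K) \mPo hfK) * p =
    (a' \mPo hfK) + (b' \mPo hfK) * q_ K.
Proof.
move=> e; have [S SE] : exists S, swp (q_ K) = S \mPo hfK - q_ K.
  by exists (SX K); apply: swp_q.
exists (a \mPo swap_vars K + (b \mPo swap_vars K) * S), (- (b \mPo swap_vars K)).
have sM (u v : coord_ring K) : swp (u * v) = swp u * swp v by exact: rmorphM.
have sD (u v : coord_ring K) : swp (u + v) = swp u + swp v by exact: rmorphD.
have := congr1 (@swp K) e; rewrite sM swpK sD sM !swp_hf SE => ->.
rewrite cD cM cN.
move: (_ \mPo swap_vars K \mPo hfK) (_ \mPo swap_vars K \mPo hfK) (S \mPo hfK) (q_ K)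
  => u1 u2 u3 u4; ring.
Qed.

(** Two representations with coprime denominators G and G': by uniqueness G' a
    = G a', so G divides a, and likewise for b. *)
Lemma homog_hfq_span (p : coord_ring K) d : SL_invariant p -> homog_fun d p -> hfq_span p.
Proof.
move=> ip hp; have [M [N [a1 [b1 e1]]]] := invariant_localized infK ip hp.
have [M' [N' [a [b e]]]] := invariant_localized infK (swp_invariant ip) (swp_homog hp).
have [a2 [b2 {a b}e]] := swap_formula e.
have eG : (X 1 ^+ M' * discP K ^+ N') \mPo swap_vars K = X 10 ^+ M' * discP' K ^+ N'.
  rewrite (rmorphM (comp_mpoly (swap_vars K))) !(rmorphXn (comp_mpoly (swap_vars K))).
  rewrite /discP (rmorph_disc4 (comp_mpoly (swap_vars K))) /=.
  by rewrite !comp_mpolyXU !inordK.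
rewrite eG in e; have [ea eb] := compare_fractions e1 e.
have [wa wE] := denominators_coprime ea; have [wb wE'] := denominators_coprime eb.
exists wa, wb; set G1 := X 1 ^+ M * _ in e1 wE wE'.
have G10 : G1 \mPo hfK != 0.
  apply/eqP => /hf_independent/eqP; apply/negP.
  by rewrite mulf_neq0 // expf_neq0 ?discP_neq0 ?mX_neq0.
clearbody G1; apply: (mulfI G10); rewrite e1 wE wE' !cM; ring.
Qed.

Lemma invariant_hfq_span (p : coord_ring K) : SL_invariant p -> hfq_span p.
Proof.
move=> ip; rewrite (pihomog_partitionE (mf := mdeg) (leqnn (mmeasure mdeg p))).
apply: (big_ind (@hfq_span K)) => [|a b|d _].
- by rewrite -(rmorph0 (comp_mpoly hfK)); apply: hfq_span_hf.
- exact: hfq_spanD.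
apply: homog_hfq_span; first exact: invariant_pihomog.
exact: pihomog_homog.
Qed.
End Generation.

(** * The ideal of relations *)

Lemma subalgebra_tuple (K : comNzRingType) n m (t : m.-tuple {mpoly K[n]}) p :
  subalgebra (tval t) p <-> exists P : {mpoly K[m]}, p = P \mPo t.
Proof.
case: t => s sm /=; have e := eqP sm; subst m.
by split=> -[P ->]; exists P; congr (_ \mPo _); apply: val_inj.
Qed.

Lemma rmorph_A_of_eq (R S : comNzRingType) (f : {rmorphism R -> S}) q s q' s' :
  f q = q' -> map f s = s' -> f (A_of q s) = A_of q' s'.
Proof. by move=> <- <-; apply: rmorph_A_of. Qed.

Section Ring.
Variable K : idomainType.
Local Notation hfK := (hf_tuple K).
Local Notation qhfK := (qhf_tuple K).

Lemma A_q_hf : A_of (q_ K) (tval hfK) = 0.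
Proof. by rewrite hf_tupleE q_E A_relation. Qed.

Lemma tnth_qhf0 : tnth qhfK ord0 = q_ K. Proof. by []. Qed.
Lemma tnth_qhfS i : tnth qhfK (lift ord0 i) = tnth hfK i.
Proof. by rewrite !(tnth_nth 0). Qed.

(** Polynomials in h and the f's, as polynomials in all twelve generators; q
    is variable number 0. *)
Lemma shift_qhf (P : {mpoly K[11]}) : shift P \mPo qhfK = P \mPo hfK.
Proof.
rewrite /shift /comp_mpoly mmap_comp; apply: mmap_ext => [c|i] /=.
  by rewrite mmapC.
by rewrite mmapX mmap1U tnth_qhfS.
Qed.

Lemma X0_qhf : 'X_ord0 \mPo qhfK = q_ K.
Proof. by rewrite /comp_mpoly mmapX mmap1U. Qed.

Let qD (P Q : {mpoly K[12]}) : (P + Q) \mPo qhfK = (P \mPo qhfK) + (Q \mPo qhfK).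
Proof. exact: (rmorphD (comp_mpoly qhfK)). Qed.
Let qM (P Q : {mpoly K[12]}) : (P * Q) \mPo qhfK = (P \mPo qhfK) * (Q \mPo qhfK).
Proof. exact: (rmorphM (comp_mpoly qhfK)). Qed.

(** The variables of {mpoly K[12]} in the order of [qhf_tuple]. *)
Definition XA (i : nat) : {mpoly K[12]} := 'X_(inord i).
Definition XAs : seq {mpoly K[12]} := [seq XA i | i <- iota 1 11].
Lemma A_polyE : A_poly K = A_of (XA 0) XAs. Proof. by []. Qed.

Lemma A_poly_relation : A_poly K \mPo qhfK = 0.
Proof.
rewrite A_polyE -A_q_hf; apply: (rmorph_A_of_eq (f := comp_mpoly qhfK)).
  by rewrite /XA /= comp_mpolyXU inordK.
by rewrite /XAs /XA /= !comp_mpolyXU !inordK.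
Qed.

Lemma to_uni_A_monic : to_uni (A_poly K) \is monic /\ size (to_uni (A_poly K)) = 3.
Proof.
have X0 : to_uni (XA 0) = 'X.
  by rewrite /XA -[inord 0](_ : ord0 = _) ?to_uniX0 //; apply: val_inj; rewrite /= inordK.
have XS i : (i < 11)%N -> to_uni (XA i.+1) = (X11 K i)%:P.
  move=> lti; rewrite -to_uniXS; congr (to_uni 'X__); apply: val_inj.
  by rewrite /= !inordK // ltnS.
have [s es] : exists s : seq {mpoly K[11]}, map (@to_uni K 11) XAs = map polyC s.
  by exists [seq X11 K i | i <- iota 0 11]; rewrite /XAs /= !XS.
have -> : to_uni (A_poly K) = A_of 'X (map polyC s).
  by rewrite A_polyE; apply: rmorph_A_of_eq.
rewrite A_ofE.
rewrite -(rmorph_Sval (@polyC _)) -(rmorph0 (@polyC _)) -(rmorph_A_of (@polyC _)).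
set a := Sval s; set b := A_of 0 s.
pose r : {poly {mpoly K[11]}} := b%:P - a%:P * 'X.
have sb : (size r <= 2)%N.
  rewrite /r (leq_trans (size_polyD _ _)) // geq_max size_polyN size_polyC mul_polyC.
  by rewrite (leq_trans (size_scale_leq _ _)) ?size_polyX //; case: (b != 0).
have -> : 'X ^+ 2 - a%:P * 'X + b%:P = 'X^2 + r by rewrite /r; ring.
split; last by rewrite size_polyDl size_polyXn.
by rewrite monicE lead_coefDl ?lead_coefXn // size_polyXn.
Qed.

(** Divide by A, which is monic of degree two in q: the remainder a + b q is
    again a relation, so it vanishes. *)
Lemma relation_ideal (P : {mpoly K[12]}) :
  algebraic_relation qhfK P <-> principal_ideal (A_poly K) P.
Proof.
rewrite /algebraic_relation /principal_ideal; split=> [P0|[c ->]]; last first.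
  by rewrite qM A_poly_relation mulr0.
have [mA sA] := to_uni_A_monic.
have e := Pdiv.IdomainMonic.divp_eq mA (to_uni P).
set c := _ %/ _ in e; set r := _ %% _ in e.
have sr : (size r <= 2)%N.
  by have := ltn_modp (to_uni P) (to_uni (A_poly K)); rewrite monic_neq0 // -/r sA ltnS.
have rE : r = (r`_0)%:P + (r`_1)%:P * 'X.
  apply/polyP => -[|[|k]]; rewrite coefD coefC coefCM coefX /= ?mulr0 ?mulr1 ?addr0 ?add0r //.
  by rewrite nth_default // (leq_trans sr).
have PE : P = of_uni c * A_poly K + (shift r`_0 + shift r`_1 * 'X_ord0).
  have oD (p q : {poly {mpoly K[11]}}) : of_uni (p + q) = of_uni p + of_uni q.
    exact: rmorphD.
  have oM (p q : {poly {mpoly K[11]}}) : of_uni (p * q) = of_uni p * of_uni q.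
    exact: rmorphM.
  by rewrite -[LHS]to_uniK e oD oM to_uniK; congr (_ + _); rewrite rE oD oM !of_uniC of_uniX -rE.
exists (of_uni c); rewrite {1}PE.
move: P0; rewrite {1}PE qD qM A_poly_relation mulr0 add0r qD qM !shift_qhf X0_qhf.
move=> /hfq_independent[-> ->].
by rewrite !rmorph0 mul0r !addr0.
Qed.
End Ring.

(** * Structure of the span *)

Section SpanIsSubalgebra.
Variable K : idomainType.
Local Notation hfK := (hf_tuple K).
Local Notation qhfK := (qhf_tuple K).
Implicit Types p : coord_ring K.

Let hD (P Q : {mpoly K[11]}) : (P + Q) \mPo hfK = (P \mPo hfK) + (Q \mPo hfK).
Proof. exact: (rmorphD (comp_mpoly hfK)). Qed.
Let hM (P Q : {mpoly K[11]}) : (P * Q) \mPo hfK = (P \mPo hfK) * (Q \mPo hfK).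
Proof. exact: (rmorphM (comp_mpoly hfK)). Qed.
Let h0 : (0 : {mpoly K[11]}) \mPo hfK = 0.
Proof. exact: (rmorph0 (comp_mpoly hfK)). Qed.

Lemma q_square : exists S U : {mpoly K[11]},
  q_ K ^+ 2 = (S \mPo hfK) * q_ K + (U \mPo hfK).
Proof.
exists (SX K), (- A_of 0 (hfX K)).
have e : A_of 0 (hfX K) \mPo hfK = A_of 0 (hfseq (generic_matrix K)).
  apply: (rmorph_A_of_eq (f := comp_mpoly hfK)) (map_hfX K); exact: h0.
rewrite (rmorphN (comp_mpoly hfK)) /= e SX_hf -hf_tupleE.
have := A_q_hf K; rewrite A_ofE => /eqP.
by rewrite addrAC subr_eq0 => /eqP <-; rewrite addrK.
Qed.

(** The relation A expresses q ^+ 2 through q and 1. *)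
Lemma hfq_spanM p p' : hfq_span p -> hfq_span p' -> hfq_span (p * p').
Proof.
move=> [a [b ->]] [a' [b' ->]]; have [S [U e]] := q_square.
exists (a * a' + b * b' * U), (a * b' + a' * b + b * b' * S).
rewrite !hD !hM.
move: (a \mPo hfK) (b \mPo hfK) (a' \mPo hfK) (b' \mPo hfK) (S \mPo hfK)
  (U \mPo hfK) (q_ K) e => a1 b1 a1' b1' S1 U1 q1 e.
transitivity (a1 * a1' + (a1 * b1' + a1' * b1) * q1 + b1 * b1' * q1 ^+ 2).
  by ring.
by rewrite e; ring.
Qed.

Lemma hfq_span_subalgebra p : hfq_span p <-> subalgebra (tval qhfK) p.
Proof.
rewrite subalgebra_tuple; split=> [[a [b ->]]|[P ->]].
  exists (shift a + shift b * 'X_ord0).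
  by rewrite rmorphD rmorphM /= !shift_qhf X0_qhf.
apply: (mmap_closed (P := @hfq_span K)) => [c|i|a b|a b]; [| |exact: hfq_spanD|exact: hfq_spanM].
  by rewrite -[_ c](comp_mpolyC c hfK); apply: hfq_span_hf.
case: (unliftP ord0 i) => [j|] ->; last by rewrite tnth_qhf0; apply: hfq_span_q.
by rewrite tnth_qhfS (tnth_nth 0) -comp_mpolyXU; apply: hfq_span_hf.
Qed.
End SpanIsSubalgebra.

Section Structure.
Variable K : idomainType.
Local Notation hfK := (hf_tuple K).
Local Notation qhfK := (qhf_tuple K).
Variable Inv : coord_ring K -> Prop.
Hypothesis InvE : forall p, Inv p <-> hfq_span p.

Lemma free_basis : free_module_basis (subalgebra hfK) Inv [tuple 1; q_ K].
Proof.
have sumE (c : 'I_2 -> coord_ring K) :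
    \sum_i c i * tnth [tuple 1; q_ K] i = c ord0 + c ord_max * q_ K.
  rewrite !big_ord_recl big_ord0 addr0 /= mulr1 -[lift _ _](_ : ord_max = _) //.
    exact: val_inj.
split=> [p|c Bc].
  rewrite InvE; split=> [[a [b ->]]|[c Bc ->]].
    exists (fun i => if i == ord0 then a \mPo hfK else b \mPo hfK).
      by move=> i; apply/subalgebra_tuple; case: ifP; [exists a | exists b].
    by rewrite sumE.
  rewrite sumE; have /subalgebra_tuple[a ->] := Bc ord0.
  by have /subalgebra_tuple[b ->] := Bc ord_max; exists a, b.
rewrite sumE; have /subalgebra_tuple[a ea] := Bc ord0.
have /subalgebra_tuple[b eb] := Bc ord_max.
rewrite ea eb => /hfq_independent[a0 b0].
move=> i; have [->|->] : i = ord0 \/ i = ord_max.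
- by case: i => [[|[|]]] //= lti; [left|right]; apply: val_inj.
- by rewrite ea a0 (rmorph0 (comp_mpoly hfK)).
by rewrite eb b0 (rmorph0 (comp_mpoly hfK)).
Qed.

(** A has no monomial of degree at most one, so on the i-th coordinate axis it
    is a multiple of the square of the coordinate. *)
Lemma A_axis (i : 'I_12) (chi : {rmorphism {mpoly K[12]} -> {poly K}}) :
  (forall k, chi 'X_k = if k == i then 'X else 0) ->
  exists v : {poly K}, chi (A_poly K) = v * 'X^2.
Proof.
move=> chiX; have cX k : chi (XA K k) = if inord k == i then 'X else 0 by exact: chiX.
rewrite A_polyE (rmorph_A_of_eq (cX 0) (erefl _)) /=.
rewrite /XAs /= !cX.
have E k : (k < 12)%N -> (inord k == i) = (k == i :> nat).
  by move=> ltk; rewrite -val_eqE /= inordK.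
rewrite !E //.
case: i {cX chiX E} => [[|[|[|[|[|[|[|[|[|[|[|[|k]]]]]]]]]]]] lti] //=; rewrite /A_of /A_expr /=;
 try by (exists 0; ring).
  by exists 1; ring.
by exists (- 'X); ring.
Qed.

Lemma axis_rmorph (i : 'I_12) :
  exists chi : {rmorphism {mpoly K[12]} -> {poly K}},
    (forall c, chi c%:MP = c%:P) /\ (forall k, chi 'X_k = if k == i then 'X else 0).
Proof.
exists (mmap (@polyC K) (fun k => if k == i then 'X else 0)); split=> [c|k] /=.
  exact: mmapC.
by rewrite mmapX mmap1U.
Qed.

(** A polynomial expression of one generator by others would be a relation
    with nonzero linear part along the axis of that generator, contrary to
    [A_axis]. *)
Lemma no_elimination (i : 'I_12) n (t : n.-tuple (coord_ring K)) (P : {mpoly K[n]}) :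
  (forall j, exists2 k, k != i & tnth t j = tnth qhfK k) -> tnth qhfK i <> P \mPo t.
Proof.
move=> tq eP.
have /fin_all_exists2[s si ts] := tq.
pose u := [tuple ('X_(s j) : {mpoly K[12]}) | j < n].
have eu : P \mPo t = (P \mPo u) \mPo qhfK.
  rewrite [in RHS]/comp_mpoly mmap_comp; apply: mmap_ext => [c|j] /=.
    by rewrite mmapC.
  by rewrite tnth_mktuple mmapX mmap1U.
have rel : algebraic_relation qhfK ('X_i - (P \mPo u)).
  rewrite /algebraic_relation rmorphB /= -eu -eP comp_mpolyXU -tnth_nth.
  exact: subrr.
have /relation_ideal[c ec] := rel.
have [chi [chiC chiX]] := axis_rmorph i.
have [v ev] := A_axis chiX.
have [d ed] : exists d, chi (P \mPo u) = d%:P.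
  rewrite [comp_mpoly _ _]/comp_mpoly mmap_comp.
  apply: (mmap_closed (iota := chi \o @mpolyC _ K)
    (P := fun p : {poly K} => exists d, p = d%:P)) => [c'|j|a b|a b].
  - by exists c'; apply: chiC.
  - by exists 0; rewrite /= tnth_mktuple chiX (negbTE (si j)) polyC0.
  - by case=> a' -> [b' ->]; exists (a' + b'); rewrite polyCD.
  by case=> a' -> [b' ->]; exists (a' * b'); rewrite polyCM.
have := congr1 (fun p => chi p) ec.
rewrite rmorphB rmorphM /= chiX eqxx ed ev mulrA => /(congr1 (fun p : {poly K} => p`_1)).
by rewrite coefMXn coefB coefX coefC /= subr0 => /eqP; rewrite oner_eq0.
Qed.

Lemma minimal_generation : minimally_generates qhfK Inv.
Proof.
split=> [p|s' ss' gs' x xs]; first by rewrite InvE hfq_span_subalgebra.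
apply: contraT => xns'.
have [i ei] : exists i, x = tnth qhfK i by apply/tnthP.
have /gs'[P] : Inv x.
  rewrite InvE ei; case: (unliftP ord0 i) => [j|] ->; last exact: hfq_span_q.
  by rewrite tnth_qhfS (tnth_nth 0) -comp_mpolyXU; apply: hfq_span_hf.
rewrite ei => /no_elimination; apply: absurd => j.
have /ss'/tnthP[k ek] : tnth (in_tuple s') j \in s' by apply: mem_tnth.
exists k => //; apply: contraNneq xns' => ki.
by rewrite ei -ki -ek mem_tnth.
Qed.

Lemma structure_theorem :
  [/\ minimally_generates qhfK Inv,
      forall P : {mpoly K[12]}, algebraic_relation qhfK P <-> principal_ideal (A_poly K) P,
      algebraically_independent hfK
    & free_module_basis (subalgebra hfK) Inv [tuple 1; q_ K]].
Proof.
split; [exact: minimal_generation|exact: relation_ideal| |exact: free_basis].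
exact: hf_independent.
Qed.
End Structure.

(** * Invariants over fields and over the integers *)

Lemma hfq_span_invariant (K : fieldType) (p : coord_ring K) : hfq_span p -> SL_invariant p.
Proof.
move=> [a [b ->]] g g' dg dg' A.
have dgg : \det g * \det (invmx g') = 1 by rewrite det_inv dg dg' invr1 mulr1.
have eh : hfseq (SL_act g g' A) = hfseq A.
  by rewrite -[SL_act _ _ _]/(lract g (invmx g') A) hfseq_lract dgg scale_hf1.
have eq : qv (SL_act g g' A) = qv A.
  by rewrite -[SL_act _ _ _]/(lract g (invmx g') A) qv_lract dgg expr1n mul1r.
rewrite -![_.@[_]]/(ev (idfun : {rmorphism K -> K}) _ _) !rmorphD !rmorphM /= !ev_comp_hf !ev_qv eq.
by congr (_ + _ * _); apply: mmap_ext => // i; rewrite eh.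
Qed.

Lemma invariant_iff_field (K : fieldType) : infinite_type K ->
  forall p : coord_ring K, SL_invariant p <-> hfq_span p.
Proof. by move=> infK p; split; [apply: invariant_hfq_span | apply: hfq_span_invariant]. Qed.

Section Change.
Variables (K L : comNzRingType) (f : {rmorphism K -> L}).

Lemma map_mpoly_mmap n (p : {mpoly K[n]}) :
  map_mpoly f p = mmap (@mpolyC n L \o f) (fun i => 'X_i) p.
Proof.
rewrite -(rmorph_mmap (map_mpoly f)); apply: mmap_ext => [c|i] /=.
  exact: map_mpolyC.
exact: map_mpolyX.
Qed.

(** Base change of coefficients is evaluation at the generic triple over the
    new ring, so it carries generators to generators. *)
Lemma map_mpoly_ev (p : coord_ring K) :
  map_mpoly f p = ev (@mpolyC _ L \o f) (generic_matrix L) p.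
Proof.
rewrite map_mpoly_mmap; apply: mmap_ext => // k.
case/mxvec_indexP: k => r k; case/mxvec_indexP: k => i j.
by rewrite /coordinates !mxvecE !mxE !mxvecE !mxE.
Qed.

Lemma map_mpoly_hf (P : {mpoly K[11]}) :
  map_mpoly f (P \mPo hf_tuple K) = (map_mpoly f P) \mPo hf_tuple L.
Proof.
rewrite map_mpoly_ev ev_comp_hf [in RHS]map_mpoly_mmap [RHS]/comp_mpoly mmap_comp.
apply: mmap_ext => [c|i] /=; first by rewrite mmapC.
by rewrite mmapX mmap1U tnth_hf.
Qed.

Lemma map_mpoly_q : map_mpoly f (q_ K) = q_ L.
Proof. by rewrite map_mpoly_ev ev_qv -q_E. Qed.
End Change.

Lemma infinite_rat : infinite_type rat.
Proof.
case=> s sP.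
have /uniq_leq_size : uniq [seq k%:R : rat | k <- iota 0 (size s).+1].
  by rewrite map_inj_uniq ?iota_uniq //; apply: Num.Theory.mulrIn.
move=> /(_ s (fun x _ => sP x)); rewrite size_map size_iota ltnn.
by [].
Qed.

Lemma intr_rat_inj : injective (map_mpoly intr : coord_ring int -> coord_ring rat).
Proof.
move=> p p' /mpolyP e; apply/mpolyP => m; have := e m; rewrite !mcoeff_map_mpoly /=.
exact: intr_inj.
Qed.

Lemma map_hfq_span (K L : comNzRingType) (f : {rmorphism K -> L}) (a b : {mpoly K[11]}) :
  map_mpoly f ((a \mPo hf_tuple K) + (b \mPo hf_tuple K) * q_ K) =
  (map_mpoly f a \mPo hf_tuple L) + (map_mpoly f b \mPo hf_tuple L) * q_ L.
Proof. by rewrite rmorphD rmorphM /= !map_mpoly_hf map_mpoly_q. Qed.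

Lemma clear_denominators n (a : {mpoly rat[n]}) : exists m : nat, exists a' : {mpoly int[n]},
  (0 < m)%N /\ m%:R * a = map_mpoly intr a'.
Proof.
pose f := map_mpoly (intr : int -> rat) : {mpoly int[n]} -> {mpoly rat[n]}.
have fM u v : f (u * v) = f u * f v by exact: rmorphM.
have fD u v : f (u + v) = f u + f v by exact: rmorphD.
have fn k : f k%:R = k%:R by exact: rmorph_nat.
rewrite -(comp_mpoly_id a).
apply: (mmap_closed (P := fun a : {mpoly rat[n]} => exists m : nat,
  exists a' : {mpoly int[n]}, (0 < m)%N /\ m%:R * a = map_mpoly intr a')) => [c|i|u v|u v].
- exists `|denq c|%N, (numq c)%:MP; split; first by rewrite absz_gt0 denq_neq0.
  rewrite map_mpolyC -[_%:R]mpolyC_nat -mpolyCM; congr (_%:MP).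
  rewrite pmulrn absz_denq mulrC -[X in X * _](divq_num_den c) divfK //.
  by rewrite intr_eq0 denq_neq0.
- by exists 1, 'X_i; rewrite mul1r map_mpolyX tnth_mktuple.
- move=> [m [u' [m0 eu]]] [k [v' [k0 ev]]].
  exists (m * k), (k%:R * u' + m%:R * v'); rewrite muln_gt0 m0; split => //.
  rewrite -/f fD !fM !fn /f -eu -ev natrM; ring.
move=> [m [u' [m0 eu]]] [k [v' [k0 ev]]].
exists (m * k), (u' * v'); rewrite muln_gt0 m0; split => //.
by rewrite -/f fM /f -eu -ev natrM; ring.
Qed.

Lemma dvd_mpoly_Fp n l (a : {mpoly int[n]}) : prime l ->
  map_mpoly (intr : int -> 'F_l) a = 0 -> exists a', a = l%:R * a'.
Proof.
move=> pl a0.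
exists (\sum_(m <- msupp a) (a@_m %/ l)%Z *: 'X_[m]).
rewrite mulr_sumr {1}(mpolyE a); apply: eq_bigr => m _.
rewrite -[l%:R]mpolyC_nat mul_mpolyC scalerA; congr (_ *: _).
have : (a@_m)%:~R = 0 :> 'F_l.
  by have := congr1 (mcoeff m) a0; rewrite mcoeff_map_mpoly mcoeff0.
move/eqP; rewrite -(dvdz_pcharf (pchar_Fp pl)) => dl.
by rewrite mulrC natz divzK.
Qed.

(** Induction on m, dividing by one prime factor of m at a time: modulo l the
    left-hand side vanishes, and independence over the field with l elements
    makes a and b divisible by l. *)
Lemma hfq_span_saturated (m : nat) (p : coord_ring int) (a b : {mpoly int[11]}) :
  (0 < m)%N ->
  m%:R * p = (a \mPo hf_tuple int) + (b \mPo hf_tuple int) * q_ int -> hfq_span p.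
Proof.
elim/ltn_ind: m a b => m IH a b m0 e.
have [m1|m1] := leqP m 1.
  exists a, b; rewrite -e; have -> : m = 1%N by case: m m0 m1 {IH e} => [|[]].
  by rewrite mul1r.
pose l := pdiv m; have pl : prime l := pdiv_prime m1.
have [k mk] : exists k, m = (l * k)%N.
  by exists (m %/ l)%N; rewrite mulnC divnK // pdiv_dvd.
have := congr1 (map_mpoly (intr : int -> 'F_l)) e.
rewrite map_hfq_span rmorphM rmorph_nat /= {1}mk natrM.
have -> : l%:R = 0 :> coord_ring 'F_l.
  by rewrite -[LHS]mpolyC_nat pchar_Fp_0.
rewrite !mul0r => /esym/hfq_independent[/(dvd_mpoly_Fp pl)[a' ea] /(dvd_mpoly_Fp pl)[b' eb]].
apply: (IH k _ a' b').
- by rewrite mk ltn_Pmull ?prime_gt1 //; move: m0; rewrite mk muln_gt0 => /andP[].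
- by move: m0; rewrite mk muln_gt0 => /andP[].
have l0 : l%:R != 0 :> coord_ring int.
  by rewrite -[l%:R]mpolyC_nat mpolyC_eq0 Num.Theory.pnatr_eq0 -lt0n prime_gt0.
apply: (mulfI l0); rewrite mulrA -natrM -mk e ea eb.
rewrite !(rmorphM (comp_mpoly (hf_tuple int))) !(rmorph_nat (comp_mpoly (hf_tuple int))) /=.
move: (a' \mPo _) (b' \mPo _) (q_ int) => a1 b1 q1; ring.
Qed.

Lemma invariant_iff_int (p : coord_ring int) : SL_invariant_int p <-> hfq_span p.
Proof.
split=> [/(invariant_hfq_span infinite_rat)[a [b e]]|[a [b ->]]]; last first.
  by rewrite /SL_invariant_int map_hfq_span; apply: hfq_span_invariant; do 2 eexists.
have [m [a' [m0 ea]]] := clear_denominators a.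
have [k [b' [k0 eb]]] := clear_denominators b.
apply: (@hfq_span_saturated (m * k) p (k%:R * a') (m%:R * b')).
  by rewrite muln_gt0 m0.
apply: intr_rat_inj; rewrite map_hfq_span !rmorphM /= !rmorph_nat -ea -eb e.
rewrite !(rmorphM (comp_mpoly (hf_tuple rat))) !(rmorph_nat (comp_mpoly (hf_tuple rat))) /=.
move: (a \mPo _) (b \mPo _) (q_ rat) => a1 b1 q1; ring.
Qed.

Theorem theorem3 :
  (forall K : fieldType, infinite_type K ->
     [/\ minimally_generates (qhf_tuple K) (@SL_invariant K),
         forall P : {mpoly K[12]},
           algebraic_relation (qhf_tuple K) P <->
           principal_ideal (A_poly K) P,
         algebraically_independent (hf_tuple K)
       & free_module_basis (subalgebra (hf_tuple K)) (@SL_invariant K)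
           [tuple 1; q_ K]]) /\
     [/\ minimally_generates (qhf_tuple int) SL_invariant_int,
         forall P : {mpoly int[12]},
           algebraic_relation (qhf_tuple int) P <->
           principal_ideal (A_poly int) P,
         algebraically_independent (hf_tuple int)
       & free_module_basis (subalgebra (hf_tuple int)) SL_invariant_int
           [tuple 1; q_ int]].
Proof.
split=> [K infK|]; apply: structure_theorem.
  exact: invariant_iff_field.
exact: invariant_iff_int.
Qed.
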